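(* The CGPT-based shape descriptors $\mathcal{I}^{(1)}$ and $\mathcal{I}^{(2)}$ are invariant under translation, rotation and scaling: if $D=T_z\,s\,R_\theta B$ and $\gamma=T_z\star(s\star(R_\theta\star\sigma))$ for some $z\in\mathbb{R}^2$, $s>0$ and $\theta\in[0,2\pi)$, then for all $m,n\ge1$ and $j\in\{1,2\}$, $$\mathcal{I}^{(j)}_{mn}(\gamma,D)=\mathcal{I}^{(j)}_{mn}(\sigma,B),$$ whenever the quantities defining these descriptors are well defined (nonzero denominators).
   Context: $B\subset\mathbb{R}^2$ is a smooth bounded domain and $\sigma\in L^\infty(\mathbb{R}^2)$ a scalar conductivity equal to $1$ outside $B$ with $\lambda^{-1}\le\sigma\le\lambda$ for some $\lambda>0$. $\mathbb{R}^2$ is identified with $\mathbb{C}$. The following definitions are given for a generic such pair $(\gamma,D)$; $\nu$ is the outward unit normal to $\partial D$. Operators. $H_0^{\pm1/2}(\partial D)$ is the mean-zero subspace of $H^{\pm1/2}(\partial D)$. $\Lambda_\gamma:H_0^{-1/2}(\partial D)\to H_0^{1/2}(\partial D)$ is the Neumann-to-Dirichlet map $g\mapsto v|_{\partial D}$, where $\nabla\cdot\gamma\nabla v=0$ in $D$, $\gamma\frac{\partial v}{\partial\nu}|_-=g$ on $\partial D$ and $\int_{\partial D}v\,ds=0$; $\Lambda_1$ is the case $\gamma\equiv1$. $\mathcal{T}_D:=\Lambda_1^{-1}(\Lambda_1-\Lambda_\gamma)$, $I$ is the identity, and $\mathcal{K}_D^*[\varphi](x)=\frac1{2\pi}\int_{\partial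 D}\frac{\langle x-y,\nu_x\rangle}{|x-y|^2}\varphi(y)\,ds_y$. CGPTs. For $m,n\ge1$, with $P_m^c(y)=\mathrm{Re}((y_1+iy_2)^m)$, $P_m^s(y)=\mathrm{Im}((y_1+iy_2)^m)$, and $a,b\in\{c,s\}$, $$M^{ab}_{mn}(\gamma,D):=\int_{\partial D}P_m^a(y)\,\mathcal{T}_D\left(I-\Big(\frac I2+\mathcal{K}_D^*\Big)\mathcal{T}_D\right)^{-1}\left[\frac{\partial P_n^b}{\partial\nu}\right](y)\,ds_y .$$ Complex CGPTs: $\mathbf{N}^{(1)}_{mn}=(M^{cc}_{mn}-M^{ss}_{mn})+i(M^{cs}_{mn}+M^{sc}_{mn})$ and $\mathbf{N}^{(2)}_{mn}=(M^{cc}_{mn}+M^{ss}_{mn})+i(M^{cs}_{mn}-M^{sc}_{mn})$, with matrices $\mathbf{N}^{(j)}=(\mathbf{N}^{(j)}_{mn})_{m,n\ge1}$. Transformations. $T_zD=\{x+z:x\in D\}$, $(T_z\star\gamma)(x)=\gamma(x-z)$; $R_\theta D=\{e^{i\theta}x:x\in D\}$, $(R_\theta\star\gamma)(x)=\gamma(e^{-i\theta}x)$; $sD=\{sx:x\in D\}$, $(s\star\gamma)(x)=\gamma(s^{-1}x)$. Descriptors. For $w\in\mathbb{C}$ let $\mathbf{C}^w$ be the lower triangular matrix with entries $\mathbf{C}^w_{mn}=\binom mn w^{m-n}$ for $n\le m$ (and $0$ for $n>m$), with $w^0=1$. Let $u=\dfrac{\mathbf{N}^{(2)}_{12}(\gamma,D)}{2\,\mathbf{N}^{(2)}_{11}(\gamma,D)}$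 and $$\mathcal{J}^{(1)}(\gamma,D)=\mathbf{C}^{-u}\,\mathbf{N}^{(1)}(\gamma,D)\,(\mathbf{C}^{-u})^T,\qquad \mathcal{J}^{(2)}(\gamma,D)=\overline{\mathbf{C}^{-u}}\,\mathbf{N}^{(2)}(\gamma,D)\,(\mathbf{C}^{-u})^T,$$ $$\mathcal{S}^{(j)}_{mn}(\gamma,D)=\frac{\mathcal{J}^{(j)}_{mn}(\gamma,D)}{\big(\mathcal{J}^{(2)}_{mm}(\gamma,D)\,\mathcal{J}^{(2)}_{nn}(\gamma,D)\big)^{1/2}},\qquad \mathcal{I}^{(j)}_{mn}(\gamma,D)=\big|\mathcal{S}^{(j)}_{mn}(\gamma,D)\big|,\qquad j=1,2,$$ where $|\cdot|$ is the modulus of a complex number. *)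

(* Defs.v *)
From HB Require Import structures.
From mathcomp Require Import all_boot all_order all_algebra.
From mathcomp Require Import complex.
From mathcomp Require Import all_classical all_reals all_analysis.

Set Implicit Arguments.
Unset Strict Implicit.
Unset Printing Implicit Defensive.

Import Order.TTheory GRing.Theory Num.Theory.
Import numFieldNormedType.Exports.

Local Open Scope classical_set_scope.
Local Open Scope ring_scope.

Section plane.
Context {R : realType}.
Implicit Types (x y : R * R) (A : set (R * R)) (f : R * R -> R).

(* The norm which the library puts on [R * R] is the sup norm; it is used only
   through the topology that it defines. *)
Definition dot x y : R := x.1 * y.1 + x.2 * y.2.
Definition enorm x : R := Num.sqrt (dot x x).

Definition frontier A : set (R * R) := closure A `\` A°.

Definition cplx x : R[i] := (x.1 +i* x.2)%C.

(* All iterated directional derivatives exist and are continuous. *)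
Fixpoint class_C (k : nat) f : Prop :=
  continuous f /\
  if k is k'.+1 then forall v, (forall x, derivable f x v) /\ class_C k' ('D_v f)
  else True.
Definition smooth f : Prop := forall k, class_C k f.

Definition grad f x : R * R := ('D_(1, 0) f x, 'D_(0, 1) f x).

Definition lebesgue2 :
    {measure set (measurableTypeR R * measurableTypeR R) -> \bar R} :=
  (@lebesgue_measure R \x @lebesgue_measure R)%E.

End plane.

Section hausdorff.
Context {R : realType}.
Implicit Types (A : set (R * R)) (d : R).
Local Open Scope ereal_scope.

Definition ediam A : \bar R :=
  ereal_sup (0 |` [set (enorm (p.1 - p.2)%R)%:E | p in A `*` A]).

Definition gauge d A : \bar R := if ediam A <= d%:E then ediam A else +oo.

(* Covers containing a set of diameter more than [d] contribute [+oo]. *)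
Definition hausdorff1_delta d A : \bar R :=
  ereal_inf [set \sum_(k <oo) gauge d (U k) | U in
    [set U : (set (R * R))^nat | A `<=` \bigcup_k U k]].

Definition hausdorff1 A : \bar R :=
  ereal_sup [set hausdorff1_delta d A | d in [set d : R | (0 < d)%R]].

Let ediam_ge0 A : 0 <= ediam A.
Proof. by apply: ereal_sup_ubound; left. Qed.

Let ediam0 : ediam set0 = 0.
Proof. by rewrite /ediam set0X image_set0 setU0 ereal_sup1. Qed.

Let gauge_ge0 d A : 0 <= gauge d A.
Proof. by rewrite /gauge; case: ifP. Qed.

Let gauge0 d : (0 < d)%R -> gauge d set0 = 0.
Proof. by move=> d0; rewrite /gauge ediam0 lee_fin ltW. Qed.

Let discrete := g_sigma_algebraType [set: set (R * R)].

Let hausdorff1_deltaE d A :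
  hausdorff1_delta d A = mu_ext (gauge d : set discrete -> \bar R) A.
Proof.
rewrite /hausdorff1_delta /mu_ext; congr (ereal_inf (image _ _)).
apply/seteqP; split=> [U AU|U []//].
by split=> // i; apply: sub_sigma_algebra.
Qed.

Let hausdorff1_0 : hausdorff1 set0 = 0.
Proof.
have d0 (d : R) : (0 < d)%R -> hausdorff1_delta d set0 = 0.
  move=> d0; rewrite hausdorff1_deltaE.
  exact: (@mu_ext0 _ discrete R _ (gauge0 d0) (gauge_ge0 d)).
rewrite /hausdorff1 (_ : [set _ | _ in _] = [set 0]) ?ereal_sup1//.
apply/seteqP; split=> [_ [d /= /d0 -> <-]//|_ ->].
by exists 1%R; [exact: ltr01|exact: d0].
Qed.

Let hausdorff1_ge0 A : 0 <= hausdorff1 A.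
Proof.
apply: (@le_trans _ _ (hausdorff1_delta 1 A)).
  by rewrite hausdorff1_deltaE; exact: (mu_ext_ge0 (T := discrete) (gauge_ge0 1)).
by apply: ereal_sup_ubound; exists 1%R => //; exact: ltr01.
Qed.

Let le_hausdorff1 : {homo hausdorff1 : A B / A `<=` B >-> A <= B}.
Proof.
move=> A B AB; apply: ge_ereal_sup => _ [d /= d0 <-].
apply: (@le_trans _ _ (hausdorff1_delta d B)).
  by rewrite !hausdorff1_deltaE; exact: (@le_mu_ext _ discrete).
by apply: ereal_sup_ubound; exists d.
Qed.

Let hausdorff1_sigma_subadditive : sigma_subadditive hausdorff1.
Proof.
move=> F; apply: ge_ereal_sup => _ [d /= d0 <-]; rewrite hausdorff1_deltaE.
have := @mu_ext_sigma_subadditive _ discrete R _ (gauge_ge0 d) F.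
move=> /le_trans; apply.
apply: lee_nneseries => [n _ _|n _].
  exact: (mu_ext_ge0 (T := discrete) (gauge_ge0 d)).
by rewrite -hausdorff1_deltaE; apply: ereal_sup_ubound; exists d.
Qed.

HB.instance Definition _ := isOuterMeasure.Build R (R * R)%type hausdorff1
  hausdorff1_0 hausdorff1_ge0 le_hausdorff1 hausdorff1_sigma_subadditive.

Definition outer_arclength : {outer_measure set (R * R) -> \bar R} := hausdorff1.

(* A measure on the Carathéodory sigma-algebra of [hausdorff1], which contains
   the Borel sets. *)
Definition arclength :
    {measure set (caratheodory_type outer_arclength) -> \bar R} :=
  outer_arclength.

End hausdorff.

Section square_integrable.
Context d (T : measurableType d) (R : realType) (mu : {measure set T -> \bar R}).
Implicit Types (A : set T) (f : T -> R).

Definition square_integrable A f : Prop :=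
  measurable_fun A f /\ (\int[mu]_(x in A) (f x ^+ 2)%:E < +oo)%E.

Definition cvg_L2 A (u : nat -> T -> R) f : Prop :=
  (fun k => \int[mu]_(x in A) ((u k x - f x) ^+ 2)%:E)%E @ \oo --> 0%E.

End square_integrable.

Section domains.
Context {R : realType}.
Notation plane := (R * R)%type.
Implicit Types (D A : set plane) (x y : plane) (gamma f h v : plane -> R).

Definition defining_function D x (rho : plane -> R) : Prop :=
  [/\ smooth rho, rho x = 0, grad rho x != 0 &
      \forall y \near x, D y <-> rho y < 0].

Definition smooth_bounded_domain D : Prop :=
  [/\ D !=set0, open D, connected D, bounded_set D &
      forall x, frontier D x -> exists rho, defining_function D x rho].

(* The value does not depend on the local defining function. *)
Definition unit_normal D x : plane :=
  xget 0 [set n | exists2 rho, defining_function D x rho &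
                    n = (enorm (grad rho x))^-1 *: grad rho x].

Definition test_function D (phi : plane -> R) : Prop :=
  smooth phi /\
  exists K, [/\ compact K, K `<=` D & forall x, ~ K x -> phi x = 0].

Definition weak_gradient D v (G : plane -> plane) : Prop :=
  forall phi e, test_function D phi ->
    \int[lebesgue2]_(x in D) (v x * 'D_e phi x) =
    - \int[lebesgue2]_(x in D) (dot (G x) e * phi x).

(* [v] is in H^1(D), and its gradient is [G]. *)
Definition sobolev1 D v (G : plane -> plane) : Prop :=
  [/\ square_integrable lebesgue2 D v,
      square_integrable lebesgue2 D (fun x => (G x).1),
      square_integrable lebesgue2 D (fun x => (G x).2) &
      weak_gradient D v G].

(* [f] is the trace on the boundary of the H^1 function [v] of gradient [G]: the
   restriction to the boundary, extended by continuity from the functions which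
   are smooth up to the boundary. *)
Definition is_trace D v (G : plane -> plane) f : Prop :=
  square_integrable arclength (frontier D) f /\
  exists w : nat -> plane -> R,
    [/\ forall k, smooth (w k),
        cvg_L2 lebesgue2 D w v,
        cvg_L2 lebesgue2 D (fun k x => (grad (w k) x).1) (fun x => (G x).1),
        cvg_L2 lebesgue2 D (fun k x => (grad (w k) x).2) (fun x => (G x).2) &
        cvg_L2 arclength (frontier D) w f].

Definition eq_boundary D f h : Prop :=
  {ae arclength, forall x, frontier D x -> f x = h x}.

(* The square of the Gagliardo seminorm of H^(1/2) of a curve; [0 / 0] is [0],
   and the diagonal is negligible. *)
Definition gagliardo2 D f : \bar R :=
  (\int[arclength]_(x in frontier D) \int[arclength]_(y in frontier D)
     ((f x - f y) ^+ 2 / enorm (x - y) ^+ 2)%:E)%E.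

Definition Hhalf D f : Prop :=
  square_integrable arclength (frontier D) f /\ (gagliardo2 D f < +oo)%E.

Definition Hhalf_norm D f : R :=
  Num.sqrt (fine (\int[arclength]_(x in frontier D) (f x ^+ 2)%:E +
                  gagliardo2 D f)%E).

Definition Hhalf0 D f : Prop :=
  Hhalf D f /\ \int[arclength]_(x in frontier D) f x = 0.

(* H^(-1/2), the dual of H^(1/2). Its elements are total functionals, with the
   value 0 outside H^(1/2), so that they are equal when they agree on H^(1/2).
   Their value at [f] is the integral of the product over the boundary. *)
Definition functional := (plane -> R) -> R.

Definition Hmhalf D (g : functional) : Prop :=
  [/\ forall f, ~ Hhalf D f -> g f = 0,
      forall (a : R) f h, Hhalf D f -> Hhalf D h ->
        g (fun x => a * f x + h x) = a * g f + g h &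
      exists C : R, forall f, Hhalf D f -> `|g f| <= C * Hhalf_norm D f].

Definition Hmhalf0 D (g : functional) : Prop :=
  Hmhalf D g /\ g (fun=> 1) = 0.

(* A function on the boundary as an element of H^(-1/2). *)
Definition of_fun D h : functional := fun f =>
  if `[< Hhalf D f >] then \int[arclength]_(x in frontier D) (h x * f x) else 0.

(* [f] is the trace of the weak solution [v] of div (gamma grad v) = 0 in [D] with
   conormal derivative [g] and with mean zero on the boundary. *)
Definition is_NtD gamma D (g : functional) f : Prop :=
  Hhalf0 D f /\
  exists v G, [/\ sobolev1 D v G, is_trace D v G f &
    forall w H h, sobolev1 D w H -> is_trace D w H h ->
      \int[lebesgue2]_(x in D) (gamma x * dot (G x) (H x)) = g h].

Definition NtD gamma D (g : functional) : plane -> R :=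
  xget (fun=> 0) [set f | is_NtD gamma D g f].

Definition NtD1_inv D f : functional :=
  xget (fun=> 0) [set g | Hmhalf0 D g /\ eq_boundary D (NtD (fun=> 1) D g) f].

Definition T_op gamma D (g : functional) : functional :=
  NtD1_inv D (fun x => NtD (fun=> 1) D g x - NtD gamma D g x).

Definition Kstar_fun D (g : functional) : plane -> R := fun x =>
  (2 * pi)^-1 * g (fun y => dot (x - y) (unit_normal D x) / enorm (x - y) ^+ 2).

Definition Kstar D (g : functional) : functional := of_fun D (Kstar_fun D g).

(* I - (I/2 + K^* ) T *)
Definition A_op gamma D (g : functional) : functional := fun f =>
  g f - (T_op gamma D g f / 2 + Kstar D (T_op gamma D g) f).

Definition A_inv gamma D (g : functional) : functional :=
  xget (fun=> 0) [set phi | Hmhalf0 D phi /\ A_op gamma D phi = g].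

Variant parity := Pc | Ps.

Definition harmonic (a : parity) (m : nat) : plane -> R := fun y =>
  match a with
  | Pc => complex.Re (cplx y ^+ m)
  | Ps => complex.Im (cplx y ^+ m)
  end.

Definition normal_derivative D h : plane -> R := fun x =>
  dot (grad h x) (unit_normal D x).

Definition NtD_well_posed gamma D : Prop :=
  forall g, Hmhalf0 D g -> exists2 f, is_NtD gamma D g f &
    forall h, is_NtD gamma D g h -> eq_boundary D h f.

(* The facts of elliptic theory through which the formula for the polarization
   tensors makes sense. They hold for every smooth bounded domain and every
   measurable conductivity bounded away from 0 and infinity: solvability of the
   Neumann problem, bijectivity of the Neumann-to-Dirichlet map of the Laplace
   operator, smoothness of the kernel of K^*, bijectivity of I - (I/2 + K^* ) T and
   the divergence theorem. Where one of them fails, the tensors get the junk value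
   0. *)
Definition well_posed gamma D : Prop :=
  [/\ NtD_well_posed (fun=> 1) D /\ NtD_well_posed gamma D,
      forall f, Hhalf0 D f ->
        exists! g, Hmhalf0 D g /\ eq_boundary D (NtD (fun=> 1) D g) f,
      forall g, Hmhalf0 D g ->
        square_integrable arclength (frontier D) (Kstar_fun D g),
      forall g, Hmhalf0 D g ->
        exists! phi, Hmhalf0 D phi /\ A_op gamma D phi = g &
      forall b n, (0 < n)%N ->
        Hmhalf0 D (of_fun D (normal_derivative D (harmonic b n)))].

Definition cgpt gamma D (a b : parity) (m n : nat) : R :=
  if `[< well_posed gamma D >] then
    T_op gamma D
      (A_inv gamma D (of_fun D (normal_derivative D (harmonic b n))))
      (harmonic a m)
  else 0.

Definition N1 gamma D (m n : nat) : R[i] :=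
  ((cgpt gamma D Pc Pc m n - cgpt gamma D Ps Ps m n) +i*
   (cgpt gamma D Pc Ps m n + cgpt gamma D Ps Pc m n))%C.

Definition N2 gamma D (m n : nat) : R[i] :=
  ((cgpt gamma D Pc Pc m n + cgpt gamma D Ps Ps m n) +i*
   (cgpt gamma D Pc Ps m n - cgpt gamma D Ps Pc m n))%C.

Definition Cmx (w : R[i]) (m n : nat) : R[i] :=
  if (n <= m)%N then 'C(m, n)%:R * w ^+ (m - n) else 0.

Definition u_shift gamma D : R[i] := N2 gamma D 1 2 / (2 * N2 gamma D 1 1).

(* Matrix indices start from 1; the matrices [Cmx w] are lower triangular, so
   that the sums stop at [m] and [n]. *)
Definition J1 gamma D (m n : nat) : R[i] :=
  let w := - u_shift gamma D in
  \sum_(1 <= k < m.+1) \sum_(1 <= l < n.+1)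
    Cmx w m k * N1 gamma D k l * Cmx w n l.

Definition J2 gamma D (m n : nat) : R[i] :=
  let w := - u_shift gamma D in
  \sum_(1 <= k < m.+1) \sum_(1 <= l < n.+1)
    (Cmx w m k)^*%C * N2 gamma D k l * Cmx w n l.

(* Both square roots of a complex number have the same modulus. *)
Definition S1 gamma D (m n : nat) : R[i] :=
  J1 gamma D m n / sqrtC (J2 gamma D m m * J2 gamma D n n).

Definition S2 gamma D (m n : nat) : R[i] :=
  J2 gamma D m n / sqrtC (J2 gamma D m m * J2 gamma D n n).

Definition I1 gamma D (m n : nat) : R[i] := `|S1 gamma D m n|.
Definition I2 gamma D (m n : nat) : R[i] := `|S2 gamma D m n|.

Definition nonzero_denominators gamma D (m n : nat) : Prop :=
  [/\ N2 gamma D 1 1 != 0, J2 gamma D m m != 0 & J2 gamma D n n != 0].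

Definition rot (theta : R) x : plane :=
  (cos theta * x.1 - sin theta * x.2, sin theta * x.1 + cos theta * x.2).

Definition translate_set (z : plane) D : set plane := [set x + z | x in D].
Definition translate_fun (z : plane) gamma : plane -> R := fun x => gamma (x - z).

Definition rotate_set (theta : R) D : set plane := rot theta @` D.
Definition rotate_fun (theta : R) gamma : plane -> R :=
  fun x => gamma (rot (- theta) x).

Definition scale_set (r : R) D : set plane := [set r *: x | x in D].
Definition scale_fun (r : R) gamma : plane -> R := fun x => gamma (r^-1 *: x).

End domains.

(* Main.v *)
Require Import Defs.
From HB Require Import structures.
From mathcomp Require Import all_boot all_order all_algebra.
From mathcomp Require Import complex.
From mathcomp Require Import all_classical all_reals all_analysis.
From mathcomp Require Import measurable_realfun ring lra.

(** Let [Phi x = a x + z] be a similarity of the complex plane, with [a != 0],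
    and let [B] be the preimage of [D] and [sigma] the pullback of [gamma]. Under
    [Phi] Lebesgue measure is multiplied by [|a|^2] ([lebesgue2_iso]), arc length
    by [|a|] ([arclength_iso]), the gradient of a function composed with [Phi] is
    its gradient times the conjugate of [a] ([grad_sim]) and the unit normal turns
    by the argument of [a] ([unit_normal_sim]). The energy of the Neumann problem
    is the planar integral of a product of two gradients, so the factors cancel
    and the Neumann-to-Dirichlet maps of [(sigma, B)] and [(gamma, D)] correspond
    ([is_NtD_sim]). The functionals on the two boundaries are exchanged by [push],
    which commutes with T, with K^* and with the inverse of I - (I/2 + K^* ) T.
    Hence the tensors of [(gamma, D)] are those of [(sigma, B)] evaluated on the
    harmonic polynomials composed with [Phi] ([cgpt_sim]).

    By the binomial formula the powers of [a y + z] are combinations of the powers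
    of [y], with the lower triangular matrix A of entries
    'C(m, k) z^(m - k) a^k ([sim_coef]). The tensors being bilinear, N1 becomes
    A N1 A^T and N2 becomes conj(A) N2 A^T ([N1_transform], [N2_transform]). The
    entries (1, 1) and (1, 2) of N2 give u(D) = z + a u(B), and the matrices C^w
    form a group, so that C^(-u(D)) A is C^(-u(B)) with row m multiplied by a^m
    ([triangular_transform]). The entries of J1 and J2 are thus multiplied by
    numbers of modulus |a|^(m + n), and so is the normalizing square root.

    Bilinearity is the analytic part. Linear combinations of Neumann data must
    have as solutions the linear combinations of the solutions, hence the space
    H^(1/2) must be closed under addition, which means adding double integrals
    over the boundary. This rests on Tonelli's theorem, hence on the
    measurability of closed sets for the one-dimensional Hausdorff measure
    (Caratheodory's criterion, [caratheodory_closed_le]) and on the finiteness of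
    the length of the boundary. The latter comes from N2_11 != 0: on a boundary of
    infinite length every function of H^(1/2) vanishes almost everywhere, so every
    functional is zero ([infinite_length_functional0]). The same hypothesis also
    gives the well-posedness of both problems, since the tensors are 0 without it.

    Some of the integrals to be transported have integrands which are not known
    to be measurable, such as the inner integral of the seminorm. An integral is
    a supremum over simple functions, and simple functions are carried by measure
    isomorphisms, so the change of variables holds for arbitrary functions
    ([integral_iso]). *)

Set Implicit Arguments.
Unset Strict Implicit.
Unset Printing Implicit Defensive.

Import Order.TTheory GRing.Theory Num.Theory.
Import numFieldNormedType.Exports.

Local Open Scope classical_set_scope.
Local Open Scope ring_scope.

(** * Integrals of arbitrary functions and isomorphisms of measure spaces *)

Section nnint.
Context d (T : measurableType d) (R : realType).
Implicit Types (mu : {measure set T -> \bar R}) (D : set T) (f g : T -> \bar R).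
Import HBNNSimple.
Local Open Scope ereal_scope.

(** The supremum that defines the integral of a nonnegative function,
    measurable or not. *)
Definition nnint mu f := ereal_sup [set sintegral mu h |
  h in [set h : {nnsfun T >-> R} | forall x, (h x)%:E <= f x]].

Lemma ge0_integral_nnint mu D f : (forall x, D x -> 0 <= f x) ->
  \int[mu]_(x in D) f x = nnint mu (f \_ D).
Proof. exact: ge0_integralE. Qed.

Lemma integral_nnint mu D f :
  \int[mu]_(x in D) f x = nnint mu ((f \_ D) ^\+) - nnint mu ((f \_ D) ^\-).
Proof. by []. Qed.

Lemma nnint_ge0 mu f : (forall x, 0 <= f x) -> 0 <= nnint mu f.
Proof.
by move=> f0; apply: ereal_sup_ubound; exists nnsfun0 => //; exact: sintegral0.
Qed.

Lemma le_nnint mu f g : (forall x, f x <= g x) -> nnint mu f <= nnint mu g.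
Proof.
move=> fg; apply: ge_ereal_sup => _ [h /= hf <-].
by apply: ereal_sup_ubound; exists h => //= x; exact: le_trans (hf x) (fg x).
Qed.

Lemma ge0_le_integral_nonmeas mu D f g : (forall x, D x -> 0 <= f x) ->
  (forall x, D x -> f x <= g x) ->
  \int[mu]_(x in D) f x <= \int[mu]_(x in D) g x.
Proof.
move=> f0 fg; rewrite !ge0_integral_nnint//; last first.
  by move=> x Dx; exact: le_trans (f0 _ Dx) (fg _ Dx).
by apply: le_nnint => x; rewrite /patch; case: ifPn => // /set_mem; exact: fg.
Qed.

(** Every simple function below [f] vanishes off [N], hence almost everywhere.
    *)
Lemma ge0_integral_eq0_off mu D f N : measurable N -> mu N = 0 ->
  (forall x, D x -> 0 <= f x) -> (forall x, D x -> ~ N x -> f x = 0) ->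
  \int[mu]_(x in D) f x = 0.
Proof.
move=> mN muN f0 fN; rewrite ge0_integral_nnint//.
apply/eqP; rewrite eq_le nnint_ge0 ?andbT; last first.
  by move=> x; rewrite /patch; case: ifPn => // /set_mem; exact: f0.
apply: ge_ereal_sup => _ [h /= hf <-].
have -> : sintegral mu h = \int[mu]_x (h x)%:E.
  by rewrite integral_nnsfun// patch_setT.
rewrite (@ae_eq_integral _ _ _ mu setT (cst 0)) ?integral0//.
  exact/measurable_EFinP.
exists N; split => // x /= /not_implyP[_ hx]; apply: contrapT => Nx; apply: hx.
apply/eqP; rewrite eq_le; apply/andP; split; last by rewrite lee_fin fun_ge0.
apply: (le_trans (hf x)); rewrite /patch; case: ifPn => // /set_mem Dx.
by rewrite fN.
Qed.

End nnint.

Section iso.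
Context d1 d2 (T1 : measurableType d1) (T2 : measurableType d2) (R : realType).
Import HBNNSimple.
Local Open Scope ereal_scope.

Section oneway.
Variables (mu1 : {measure set T1 -> \bar R}) (mu2 : {measure set T2 -> \bar R}).
Variables (Phi : T1 -> T2) (mPhi : measurable_fun setT Phi).
Variable k : R.
Hypothesis muPhi : forall A, measurable A -> mu1 (Phi @^-1` A) = k%:E * mu2 A.

Section comp_nnsfun.
Variable h : {nnsfun T2 >-> R}.
Definition nnsfun_comp : T1 -> R := h \o Phi.
Let mcomp : measurable_fun setT nnsfun_comp.
Proof. by apply: measurableT_comp. Qed.
HB.instance Definition _ := isMeasurableFun.Build _ _ _ _ nnsfun_comp mcomp.
Let fcomp : finite_set (range nnsfun_comp).
Proof.
apply: (@sub_finite_set _ _ (range h)); last exact: fimfunP.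
by move=> _ [x _ <-]; exists (Phi x).
Qed.
HB.instance Definition _ := FiniteImage.Build _ _ nnsfun_comp fcomp.
Let ncomp x : (0 <= nnsfun_comp x)%R.
Proof. exact: fun_ge0. Qed.
HB.instance Definition _ := isNonNegFun.Build _ _ nnsfun_comp ncomp.
Definition comp_nnsfun : {nnsfun T1 >-> R} := nnsfun_comp.

(** The level sets of [h \o Phi] are the preimages of those of [h]. *)
Lemma sintegral_comp_nnsfun : sintegral mu1 comp_nnsfun = k%:E * sintegral mu2 h.
Proof.
rewrite !sintegralET ge0_mule_fsumr; last exact: nnsfun_mulemu_ge0.
apply: eq_fsbigr => x _.
by rewrite -[X in mu1 X]/(Phi @^-1` (h @^-1` [set x])) muPhi// !muleA [_%:E * x%:E]muleC.
Qed.
End comp_nnsfun.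

Lemma nnint_comp_ge f (c : R) : (0 <= c)%R -> (0 < c * k)%R ->
  (c * k)%:E * nnint mu2 f <= nnint mu1 (fun x => c%:E * f (Phi x)).
Proof.
move=> c0 ck0; rewrite muleC -lee_pdivlMr//; apply: ge_ereal_sup => _ [h /= hf <-].
rewrite lee_pdivlMr// muleC; apply: ereal_sup_ubound.
exists (scale_nnsfun (comp_nnsfun h) c0) => /=.
  by move=> x; rewrite EFinM; apply: lee_wpmul2l; [rewrite lee_fin//|exact: hf].
by rewrite sintegralrM sintegral_comp_nnsfun muleA -EFinM.
Qed.
End oneway.

(** An isomorphism of measurable spaces under which preimages have [k] times
    the measure. *)
Record scaled_iso (mu1 : {measure set T1 -> \bar R})
    (mu2 : {measure set T2 -> \bar R}) (Phi : T1 -> T2) (Psi : T2 -> T1) (k : R)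
    : Prop := ScaledIso {
  iso_measurable : measurable_fun setT Phi;
  iso_measurable_inv : measurable_fun setT Psi;
  iso_cancel : cancel Phi Psi;
  iso_cancel_inv : cancel Psi Phi;
  iso_scale_gt0 : (0 < k)%R;
  iso_scaleE : forall A, measurable A -> mu1 (Phi @^-1` A) = k%:E * mu2 A }.

End iso.

Lemma scaled_iso_sym d1 d2 (T1 : measurableType d1) (T2 : measurableType d2)
    (R : realType) (mu1 : {measure set T1 -> \bar R})
    (mu2 : {measure set T2 -> \bar R}) Phi Psi k :
  scaled_iso mu1 mu2 Phi Psi k -> scaled_iso mu2 mu1 Psi Phi k^-1.
Proof.
case=> mPhi mPsi PhiK PsiK k0 muPhi; split=> //; first by rewrite invr_gt0.
move=> A mA.
have := muPhi (Psi @^-1` A); rewrite -comp_preimage (_ : Psi \o Phi = id); last first.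
  exact/funext.
rewrite preimage_id => ->; last by rewrite -[X in measurable X]setTI; exact: mPsi.
by rewrite muleA -EFinM mulVf ?gt_eqF// mul1e.
Qed.

Section iso_theory.
Context d1 d2 (T1 : measurableType d1) (T2 : measurableType d2) (R : realType).
Variables (mu1 : {measure set T1 -> \bar R}) (mu2 : {measure set T2 -> \bar R}).
Variables (Phi : T1 -> T2) (Psi : T2 -> T1) (k : R).
Hypothesis iso : scaled_iso mu1 mu2 Phi Psi k.

Let k0 : 0 < k. Proof. exact: iso_scale_gt0 iso. Qed.

Lemma iso_preimageK (A : set T2) : Psi @^-1` (Phi @^-1` A) = A.
Proof. by apply/seteqP; split=> x /=; rewrite (iso_cancel_inv iso). Qed.

Lemma iso_preimage_measurable A : measurable A -> measurable (Phi @^-1` A).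
Proof. by move=> mA; rewrite -[X in measurable X]setTI; exact: (iso_measurable iso). Qed.

Lemma iso_preimage_measurableP A : measurable (Phi @^-1` A) -> measurable A.
Proof.
move=> mA; rewrite -(iso_preimageK A) -[X in measurable X]setTI.
exact: (iso_measurable_inv iso).
Qed.

Lemma iso_measurable_fun d (T : measurableType d) D (f : T2 -> T) :
  measurable_fun D f -> measurable_fun (Phi @^-1` D) (f \o Phi).
Proof.
move=> mf /iso_preimage_measurableP mD Y mY.
exact: (iso_preimage_measurable (mf mD Y mY)).
Qed.

Lemma iso_ae (P : T2 -> Prop) :
  {ae mu2, forall y, P y} -> {ae mu1, forall x, P (Phi x)}.
Proof.
move=> [A [mA A0 PA]]; exists (Phi @^-1` A); split.
- exact: iso_preimage_measurable.
- by rewrite (iso_scaleE iso)// A0 mule0.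
- by move=> x Px; exact: PA.
Qed.

Local Open Scope ereal_scope.

(** Simple functions below the integrand are carried both ways, which gives the
    two inequalities without measurability of [f]. *)
Lemma nnint_iso (f : T2 -> \bar R) (c : R) : (0 < c)%R ->
  nnint mu1 (fun x => c%:E * f (Phi x)) = (c * k)%:E * nnint mu2 f.
Proof.
move=> c0; apply/eqP; rewrite eq_le; apply/andP; split; last first.
  apply: (nnint_comp_ge (iso_measurable iso)).
  - exact: iso_scaleE iso.
  - exact: ltW.
  - exact: mulr_gt0.
have isoV := scaled_iso_sym iso.
rewrite -lee_pdivrMl ?mulr_gt0// invfM.
rewrite [X in _ <= nnint mu2 X](_ : f = fun y => c^-1%:E * (c%:E * f (Phi (Psi y)))); last first.
  apply/funext => y; rewrite (iso_cancel_inv iso) muleA -EFinM mulVf ?mul1e//.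
  by rewrite gt_eqF.
apply: (nnint_comp_ge (iso_measurable isoV) _ (fun x => c%:E * f (Phi x))).
- exact: iso_scaleE isoV.
- by rewrite invr_ge0 ltW.
- by rewrite mulr_gt0// invr_gt0.
Qed.

(** The factor [c] lets the values be rescaled together with the measure. When
    both the positive and the negative part are infinite, the difference is
    [-oo] on both sides. *)
Lemma integral_iso_scale D (f : T2 -> \bar R) (c : R) : (0 < c)%R ->
  \int[mu1]_(x in Phi @^-1` D) (c%:E * f (Phi x)) =
  (c * k)%:E * \int[mu2]_(y in D) f y.
Proof.
move=> c0; rewrite !integral_nnint.
have -> : (fun x => c%:E * f (Phi x)) \_ (Phi @^-1` D) =
          (fun x => c%:E * (f \_ D) (Phi x)).
  apply/funext => x; rewrite /patch.
  have -> : (x \in Phi @^-1` D) = (Phi x \in D) by apply/idP/idP; rewrite !inE.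
  by case: ifPn => // _; rewrite mule0.
rewrite (ge0_funeposM _ (ltW c0)) (ge0_funenegM _ (ltW c0)).
transitivity ((c * k)%:E * nnint mu2 ((f \_ D)^\+) -
              (c * k)%:E * nnint mu2 ((f \_ D)^\-)).
  congr (_ - _).
    by rewrite -nnint_iso//; congr nnint; apply/funext => x; rewrite !funeposE.
  by rewrite -nnint_iso//; congr nnint; apply/funext => x; rewrite !funenegE.
have := nnint_ge0 mu2 (funepos_ge0 (f \_ D)).
have := nnint_ge0 mu2 (funeneg_ge0 (f \_ D)).
have ck0 : (0 < c * k)%R by exact: mulr_gt0.
move: (nnint mu2 _) (nnint mu2 _) => [b| |] // [a| |] // _ _.
- by rewrite muleBr.
- by rewrite muleBr.
- by rewrite gt0_muley ?lte_fin// addeNy -EFinM/= gt0_muleNy ?lte_fin.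
- by rewrite gt0_muley ?lte_fin// gt0_muleNy ?lte_fin.
Qed.

Lemma integral_iso D (f : T2 -> \bar R) :
  \int[mu1]_(x in Phi @^-1` D) f (Phi x) = k%:E * \int[mu2]_(y in D) f y.
Proof.
have := integral_iso_scale D f ltr01; rewrite mul1r => <-.
by apply: eq_integral => x _; rewrite mul1e.
Qed.

Lemma Rintegral_iso_scale D (f : T2 -> R) (c : R) : (0 < c)%R ->
  (\int[mu1]_(x in Phi @^-1` D) (c * f (Phi x)) =
  c * k * \int[mu2]_(y in D) f y)%R.
Proof.
move=> c0; rewrite /Rintegral.
under eq_integral do rewrite EFinM.
rewrite (integral_iso_scale D (EFin \o f) c0)/=.
case: (integral _ _ _) => [s//||].
  by rewrite gt0_muley ?lte_fin ?mulr_gt0//= mulr0.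
by rewrite gt0_muleNy ?lte_fin ?mulr_gt0//= mulr0.
Qed.

Lemma Rintegral_iso D (f : T2 -> R) :
  (\int[mu1]_(x in Phi @^-1` D) f (Phi x) = k * \int[mu2]_(y in D) f y)%R.
Proof.
have := Rintegral_iso_scale D f ltr01; rewrite mul1r => <-.
by apply: eq_Rintegral => x _; rewrite mul1r.
Qed.

Lemma iso_square_integrable D f :
  square_integrable mu2 D f -> square_integrable mu1 (Phi @^-1` D) (f \o Phi).
Proof.
move=> [mf f2]; split; first exact: iso_measurable_fun.
rewrite (integral_iso D (fun y => (f y ^+ 2)%:E)).
rewrite lte_mul_pinfty ?lee_fin//; exact: ltW.
Qed.

Lemma iso_cvg_L2 D u f : cvg_L2 mu2 D u f ->
  cvg_L2 mu1 (Phi @^-1` D) (fun j => u j \o Phi) (f \o Phi).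
Proof.
rewrite /cvg_L2 => uf.
under eq_fun do rewrite (integral_iso D (fun y => ((u _ y - f y) ^+ 2)%:E)).
by rewrite -(mule0 k%:E); apply: cvgeZl.
Qed.

End iso_theory.

Lemma scaled_iso_id d (T : measurableType d) (R : realType)
    (mu : {measure set T -> \bar R}) : scaled_iso mu mu id id 1.
Proof.
by split=> // A mA; rewrite preimage_id mul1e.
Qed.

(** The identity is an isomorphism with [k = 1]. *)
Lemma ge0_integralZl_nonmeas d (T : measurableType d) (R : realType)
    (mu : {measure set T -> \bar R}) D (f : T -> \bar R) (c : R) : 0 < c ->
  (\int[mu]_(x in D) (c%:E * f x) = c%:E * \int[mu]_(x in D) f x)%E.
Proof.
by move=> c0; have := integral_iso_scale (scaled_iso_id mu) D f c0; rewrite mulr1.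
Qed.

(** * Square integrable functions *)

Section L2.
Context d (T : measurableType d) (R : realType) (mu : {measure set T -> \bar R}).
Variables (A : set T) (mA : measurable A).
Implicit Types f g h : T -> R.

Lemma measurable_lin f h (a b : R) : measurable_fun A f -> measurable_fun A h ->
  measurable_fun A (fun x => a * f x + b * h x).
Proof.
move=> mf mh; apply: measurable_funD; apply: measurable_funM => //;
  exact: measurable_cst.
Qed.

Lemma sqr_lin_le (a b x y : R) :
  (a * x + b * y) ^+ 2 <= 2 * a ^+ 2 * x ^+ 2 + 2 * b ^+ 2 * y ^+ 2.
Proof.
rewrite -subr_ge0 (_ : _ - _ = (a * x - b * y) ^+ 2) ?sqr_ge0//.
by rewrite !expr2; ring.
Qed.

Local Open Scope ereal_scope.

Lemma integral_sqr_lin_le f h (a b : R) :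
  measurable_fun A f -> measurable_fun A h ->
  \int[mu]_(x in A) ((a * f x + b * h x) ^+ 2)%:E <=
  (2 * a ^+ 2)%:E * \int[mu]_(x in A) (f x ^+ 2)%:E +
  (2 * b ^+ 2)%:E * \int[mu]_(x in A) (h x ^+ 2)%:E.
Proof.
move=> mf mh.
have sq0 (u : T -> R) x : A x -> 0 <= (u x ^+ 2)%:E by rewrite lee_fin sqr_ge0.
have c0 (c : R) : (0 <= 2 * c ^+ 2)%R by rewrite mulr_ge0// sqr_ge0.
have msq (u : T -> R) : measurable_fun A u -> measurable_fun A (fun x => (u x ^+ 2)%:E).
  by move=> mu0; apply/measurable_EFinP; exact: measurable_funX.
rewrite -(ge0_integralZl_EFin mu mA (sq0 f) (msq f mf) (c0 a)).
rewrite -(ge0_integralZl_EFin mu mA (sq0 h) (msq h mh) (c0 b)).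
rewrite -ge0_integralD//; last 4 first.
- by move=> x _; rewrite -EFinM lee_fin mulr_ge0// sqr_ge0.
- by apply: measurable_funeM; exact: msq.
- by move=> x _; rewrite -EFinM lee_fin mulr_ge0// sqr_ge0.
- by apply: measurable_funeM; exact: msq.
apply: ge0_le_integral_nonmeas => x _; rewrite lee_fin ?sqr_ge0//.
exact: sqr_lin_le.
Qed.

Lemma square_integrable_lin f h (a b : R) :
  square_integrable mu A f -> square_integrable mu A h ->
  square_integrable mu A (fun x => a * f x + b * h x)%R.
Proof.
move=> [mf f2] [mh h2]; split; first exact: measurable_lin.
apply: (le_lt_trans (integral_sqr_lin_le a b mf mh)).
have c0 (c : R) : (0 <= 2 * c ^+ 2)%R by rewrite mulr_ge0// sqr_ge0.
by rewrite lte_add_pinfty// lte_mul_pinfty// ?lee_fin.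
Qed.

(** [|f h| <= f^2 + h^2]. *)
Lemma square_integrable_mul f h :
  square_integrable mu A f -> square_integrable mu A h ->
  mu.-integrable A (EFin \o (fun x => f x * h x)%R).
Proof.
move=> [mf f2] [mh h2].
have mfh : measurable_fun A (fun x => f x * h x)%R by exact: measurable_funM.
apply/integrableP; split; first exact/measurable_EFinP.
have sq0 (u : T -> R) x : A x -> 0 <= (u x ^+ 2)%:E by rewrite lee_fin sqr_ge0.
have msq (u : T -> R) : measurable_fun A u -> measurable_fun A (fun x => (u x ^+ 2)%:E).
  by move=> mu0; apply/measurable_EFinP; exact: measurable_funX.
apply: (@le_lt_trans _ _
  (\int[mu]_(x in A) ((f x ^+ 2)%:E + (h x ^+ 2)%:E))); last first.
  rewrite ge0_integralD; [exact: lte_add_pinfty|by []|exact: sq0|exact: msq|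
    exact: sq0|exact: msq].
apply: ge0_le_integral_nonmeas => x _ //=; rewrite lee_fin.
rewrite normrM -(real_normK (num_real (f x))) -(real_normK (num_real (h x))).
have := sqr_ge0 (`|f x| - `|h x|)%R; have := normr_ge0 (f x); have := normr_ge0 (h x).
by move: (`|f x|)%R (`|h x|)%R => s t; nra.
Qed.

Lemma bounded_square_integrable f (M : R) : mu A < +oo -> measurable_fun A f ->
  (forall x, A x -> `|f x| <= M)%R -> square_integrable mu A f.
Proof.
move=> A_fin mf fM; split => //.
apply: (@le_lt_trans _ _ (\int[mu]_(x in A) (M ^+ 2)%:E)); last first.
  by rewrite integral_cst// lte_mul_pinfty// lee_fin sqr_ge0.
apply: ge0_le_integral_nonmeas => x Ax; rewrite lee_fin ?sqr_ge0//.
by rewrite -(real_normK (num_real (f x))) lerXn2r ?nnegrE// ?fM// (le_trans _ (fM _ Ax)).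
Qed.


Lemma square_integrable_integrable f : mu A < +oo -> square_integrable mu A f ->
  mu.-integrable A (EFin \o f).
Proof.
move=> A_fin f2.
have one2 : square_integrable mu A (cst 1%R).
  by apply: (@bounded_square_integrable _ 1) => // x _; rewrite normr1.
have := square_integrable_mul f2 one2.
by apply: eq_integrable => // x _ /=; rewrite mulr1.
Qed.

Lemma cvg_L2_lin (u v : nat -> T -> R) f h (a b : R) :
  (forall k, measurable_fun A (fun x => u k x - f x)%R) ->
  (forall k, measurable_fun A (fun x => v k x - h x)%R) ->
  cvg_L2 mu A u f -> cvg_L2 mu A v h ->
  cvg_L2 mu A (fun k x => a * u k x + b * v k x)%R (fun x => a * f x + b * h x)%R.
Proof.
move=> mu_ mv uf vh; rewrite /cvg_L2.
apply: (@squeeze_cvge _ _ _ R (fun=> 0) _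
  (fun k => (2 * a ^+ 2)%:E * \int[mu]_(x in A) ((u k x - f x) ^+ 2)%:E +
            (2 * b ^+ 2)%:E * \int[mu]_(x in A) ((v k x - h x) ^+ 2)%:E)).
- apply: nearW => k; apply/andP; split.
    by apply: integral_ge0 => x _; rewrite lee_fin sqr_ge0.
  apply: le_trans (integral_sqr_lin_le a b (mu_ k) (mv k)).
  apply: ge0_le_integral_nonmeas => x _; rewrite lee_fin ?sqr_ge0//.
  by rewrite le_eqVlt; apply/orP; left; apply/eqP; congr (_ ^+ 2)%R; ring.
- exact: cvg_cst.
- rewrite [X in _ --> X](_ : 0 = (2 * a ^+ 2)%:E * 0 + (2 * b ^+ 2)%:E * 0); last first.
    by rewrite !mule0 adde0.
  by apply: cvgeD; [rewrite !mule0|exact: cvgeZl|exact: cvgeZl].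
Qed.

(** For the conductivity, which is bounded only almost everywhere. *)
Lemma ae_bounded_mul_integrable (g f : T -> R) (M : R) :
  measurable_fun A g -> {ae mu, forall x, A x -> (`|g x| <= M)%R} ->
  mu.-integrable A (EFin \o f) -> mu.-integrable A (EFin \o (fun x => g x * f x)%R).
Proof.
move=> mg gM /integrableP[mf f1].
have mf' : measurable_fun A f by exact/measurable_EFinP.
apply/integrableP; split; first by apply/measurable_EFinP; exact: measurable_funM.
have [M0|M0] := leP 0%R M; last first.
  rewrite (@ae_eq_integral _ _ _ mu A (cst 0))//.
  - by rewrite integral0.
  - by do 2 apply: measurableT_comp => //; exact: measurable_funM.
  - apply: filterS gM => x gM /gM; move=> /(le_lt_trans)/(_ M0).
    by rewrite normr_lt0.
apply: (@le_lt_trans _ _ (\int[mu]_(x in A) (M%:E * `|(f x)%:E|))).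
  apply: ae_ge0_le_integral => //.
  - by do 2 apply: measurableT_comp => //; exact: measurable_funM.
  - by move=> x _; rewrite mule_ge0.
  - by apply: measurable_funeM; apply: measurableT_comp.
  apply: filterS gM => x gM /gM {}gM /=.
  by rewrite lee_fin normrM ler_wpM2r.
rewrite ge0_integralZl_EFin//; last by apply: measurableT_comp.
by rewrite lte_mul_pinfty ?lee_fin.
Qed.

End L2.

(** * Similarities of the plane and Lebesgue measure *)

Section similarity.
Context {R : realType}.
Implicit Types a x y z v w : (R * R)%type.

(** Multiplication of complex numbers, on pairs of reals. *)
Definition rmul a x : R * R := (a.1 * x.1 - a.2 * x.2, a.2 * x.1 + a.1 * x.2).

Definition sim a z x : R * R := rmul a x + z.

Definition cinv a : R * R := (a.1 / dot a a, - a.2 / dot a a).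

(** The inverse of [sim a z], again of the form [sim]: each statement on
    similarities thus also applies to the inverse. *)
Definition simV a z : R * R -> R * R := sim (cinv a) (- rmul (cinv a) z).

Lemma dot_neq0 a : a != 0 -> dot a a != 0.
Proof.
move: a => [a1 a2]; apply: contra => /=; rewrite /dot/= -!expr2.
rewrite paddr_eq0 ?sqr_ge0// !sqrf_eq0 => /andP[/eqP-> /eqP->].
by [].
Qed.

Lemma dot_ge0 x : 0 <= dot x x.
Proof. by rewrite /dot -!expr2 addr_ge0// sqr_ge0. Qed.

Lemma dot_gt0 a : a != 0 -> 0 < dot a a.
Proof. by move=> a0; rewrite lt_neqAle eq_sym dot_neq0//= dot_ge0. Qed.

Lemma sqr_enorm x : enorm x ^+ 2 = dot x x.
Proof. by rewrite sqr_sqrtr// dot_ge0. Qed.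

Lemma enorm_gt0 a : a != 0 -> 0 < enorm a.
Proof. by move=> a0; rewrite sqrtr_gt0 dot_gt0. Qed.

Lemma enorm_ge0 x : 0 <= enorm x.
Proof. exact: sqrtr_ge0. Qed.

Lemma simK a z : a != 0 -> cancel (sim a z) (simV a z).
Proof.
move=> /dot_neq0; move: a z => [a1 a2] [z1 z2] a0 [x1 x2].
rewrite /simV /sim /rmul /cinv /dot/= in a0 *.
by congr pair; rewrite /=; field.
Qed.

Lemma simVK a z : a != 0 -> cancel (simV a z) (sim a z).
Proof.
move=> /dot_neq0; move: a z => [a1 a2] [z1 z2] a0 [x1 x2].
rewrite /simV /sim /rmul /cinv /dot/= in a0 *.
by congr pair; rewrite /=; field.
Qed.

Lemma cinv_neq0 a : a != 0 -> cinv a != 0.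
Proof.
move=> /[dup] a0 /dot_neq0 d0; apply: contra a0; move: a d0 => [a1 a2] d0.
rewrite /cinv xpair_eqE/= !mulf_eq0 invr_eq0 oppr_eq0 (negbTE d0) !orbF.
by move=> /andP[/eqP-> /eqP->].
Qed.

Lemma sim_sub a z x y : sim a z x - sim a z y = rmul a (x - y).
Proof.
by rewrite /sim /rmul; congr pair => /=; ring.
Qed.

Lemma dot_rmul a v w : dot (rmul a v) (rmul a w) = dot a a * dot v w.
Proof. by rewrite /dot /rmul/=; ring. Qed.

Lemma enorm_rmul a v : enorm (rmul a v) = enorm a * enorm v.
Proof. by rewrite /enorm dot_rmul sqrtrM// dot_ge0. Qed.

End similarity.

(** The image of a measure packed with its measure structure, which depends on
    the measurability of [f]. *)
Definition image_measure d d' (T1 : measurableType d) (T2 : measurableType d')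
    (R : realType) (mu : {measure set T1 -> \bar R}) (f : T1 -> T2)
    (mf : measurable_fun setT f) : {measure set T2 -> \bar R} :=
  @measure_function_pushforward__canonical__measure_function_Measure
    _ _ _ _ _ mu f mf.

Section lebesgue_plane.
Context {R : realType}.
Local Notation mu := (@lebesgue_measure R).

(** Both sides are measures of the set, up to the factor [|al|], and they agree
    on intervals. *)
Lemma lebesgue_measure_affine (al be : R) (A : set (measurableTypeR R)) :
  al != 0 -> measurable A ->
  mu ((fun y : measurableTypeR R => al * y + be : measurableTypeR R) @^-1` A) =
  (`|al|^-1%:E * mu A)%E.
Proof.
move=> al0 mA; pose f (y : measurableTypeR R) : measurableTypeR R := al * y + be.
have mf : measurable_fun setT f.
  by apply: measurable_funD => //; exact: measurable_funM.
have nal0 : 0 < `|al| by rewrite normr_gt0.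
pose nu : {measure set (measurableTypeR R) -> \bar R} :=
    mscale (NngNum (ltW nal0)) (image_measure mu mf).
have munu : forall X, measurable X -> mu X = nu X.
  apply: lebesgue_measure_unique => X [[s t]] _ <-.
  rewrite /nu/= /mscale/= /pushforward.
  have [al_gt0|al_lt0|/eqP] := ltgtP al 0; last by rewrite (negbTE al0).
    rewrite (_ : f @^-1` _ = `[(t - be) / al, (s - be) / al[%classic); last first.
      apply/seteqP; split=> y; rewrite /= /f !in_itv/= => /andP[h1 h2]; apply/andP.
        by rewrite ler_ndivrMr// ltr_ndivlMr// ![y * _]mulrC; split; lra.
      by move: h1 h2; rewrite ler_ndivrMr// ltr_ndivlMr// ![y * _]mulrC; split; lra.
    rewrite !lebesgue_measure_itv/= !lte_fin ltr_ndivlMr// mulfVK// ltrD2r.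
    case: ifPn => _; last by rewrite mule0.
    rewrite -!EFinD -EFinM ltr0_norm//; congr EFin; field.
    by rewrite lt_eqF.
  rewrite (_ : f @^-1` _ = `](s - be) / al, (t - be) / al]%classic); last first.
    apply/seteqP; split=> y; rewrite /= /f !in_itv/= => /andP[h1 h2]; apply/andP.
      by rewrite ler_pdivlMr// ltr_pdivrMr// ![y * _]mulrC; split; lra.
    by move: h1 h2; rewrite ler_pdivlMr// ltr_pdivrMr// ![y * _]mulrC; split; lra.
  rewrite !lebesgue_measure_itv/= !lte_fin ltr_pdivrMr// mulfVK// ltrD2r.
  case: ifPn => _; last by rewrite mule0.
  rewrite -!EFinD -EFinM gtr0_norm//; congr EFin; field.
  by rewrite gt_eqF.
rewrite (munu A mA) /nu/= /mscale/= /pushforward muleA -EFinM mulVf ?gt_eqF//.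
by rewrite mul1e.
Qed.

Local Notation plane := (measurableTypeR R * measurableTypeR R)%type.

Definition scales (f : plane -> plane) (k : R) := measurable_fun setT f /\
  forall A, measurable A -> lebesgue2 (f @^-1` A) = (k%:E * lebesgue2 A)%E.

Lemma scales_comp f g k l : scales f k -> scales g l -> scales (g \o f) (k * l).
Proof.
move=> [mf kf] [mg lg]; split; first exact: measurableT_comp.
move=> A mA; rewrite comp_preimage kf ?lg ?muleA//.
by rewrite -[X in measurable X]setTI; exact: mg.
Qed.

Definition gshear (al be ga : R) (x : plane) : plane := (x.1, al * x.2 + be * x.1 + ga).
Definition swapm (x : plane) : plane := (x.2, x.1).

(** On each vertical line the map is affine of slope [al]. *)
Lemma gshear_scales al be ga : al != 0 -> scales (gshear al be ga) (`|al|^-1).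
Proof.
move=> al0; split.
  apply: measurable_fun_pair; first exact: measurable_fst.
  by apply: measurable_funD => //; apply: measurable_funD => //; apply: measurable_funM.
move=> A mA; rewrite /lebesgue2/= /product_measure1/=.
rewrite -ge0_integralZl_nonmeas; last by rewrite invr_gt0 normr_gt0.
apply: eq_integral => x _ /=.
rewrite -(lebesgue_measure_affine (be * x + ga))//; last exact: measurable_xsection.
congr (mu _); apply/seteqP; split => y; rewrite /xsection/= !inE /gshear/= => h;
  by rewrite addrA in h *.
Qed.

Lemma swapm_scales : scales swapm 1.
Proof.
have ms : measurable_fun setT swapm.
  by apply: measurable_fun_pair; [exact: measurable_snd|exact: measurable_fst].
split=> // A mA; rewrite mul1e.
apply/esym; apply: (product_measure_unique (m' := image_measure lebesgue2 ms)) => //.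
move=> A1 A2 mA1 mA2; rewrite /= /pushforward.
rewrite (_ : _ @^-1` _ = A2 `*` A1); last first.
  by apply/seteqP; split=> -[x y] /= [].
by rewrite /lebesgue2 product_measure1E// muleC.
Qed.

(** When the real part of [a] is not zero, multiplication by [a] is the
    composite of a triangular map acting on the first coordinate and of one
    acting on the second. Otherwise [a = a2 i] is the product of [1 + i] and
    [a2 (1 + i) / 2], to which this applies. *)
Lemma sim_scales a z : a != 0 -> scales (sim a z) (dot a a)^-1.
Proof.
have fst_neq0 (b y : R * R) : b.1 != 0 -> scales (sim b y) (dot b b)^-1.
  move: b y => [b1 b2] [y1 y2]/= b0.
  have d0 : b1 * b1 + b2 * b2 != 0.
    by apply: (@dot_neq0 _ (b1, b2)); rewrite xpair_eqE negb_and b0.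
  have c0 : (b1 * b1 + b2 * b2) / b1 != 0 by rewrite mulf_neq0// invr_eq0.
  have := scales_comp (scales_comp (scales_comp swapm_scales
    (gshear_scales (- b2) y1 b0)) swapm_scales)
    (gshear_scales (b2 / b1) (y2 - b2 * y1 / b1) c0).
  rewrite (_ : _ \o _ = sim (b1, b2) (y1, y2)); last first.
    apply/funext => -[x1 x2]; rewrite /= /swapm /gshear /sim /rmul/=.
    by congr pair; rewrite /=; [ring|field].
  rewrite !mul1r mulr1 -invfM -normrM mulrC divfK// ger0_norm//.
  exact: (@dot_ge0 _ (b1, b2)).
have [a1|/fst_neq0//] := eqVneq a.1 0.
move: a a1 => [_ a2]/= -> a0.
have {}a0 : a2 != 0 by apply: contra a0 => /eqP ->.
have := scales_comp (fst_neq0 (1, 1) 0 (oner_neq0 _)) (fst_neq0 (a2 / 2, a2 / 2) z _).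
rewrite (_ : _ \o _ = sim (0, a2) z); last first.
  by apply/funext => -[x1 x2]; rewrite /= /sim /rmul/=; congr pair => /=; field.
rewrite -invfM (_ : dot _ _ * _ = dot (0, a2) (0, a2)); last first.
  by rewrite /dot/=; field.
by apply; rewrite /= mulf_neq0.
Qed.

Lemma lebesgue2_iso a z : a != 0 ->
  scaled_iso (@lebesgue2 R) (@lebesgue2 R) (sim a z) (simV a z) (dot a a)^-1.
Proof.
move=> a0; have [ms ks] := sim_scales z a0.
have [mV _] := sim_scales (- rmul (cinv a) z) (cinv_neq0 a0).
split=> //; [exact: simK|exact: simVK|by rewrite invr_gt0 dot_gt0].
Qed.

End lebesgue_plane.

(** * Hausdorff measure of similar sets *)

Section enorm_theory.
Context {R : realType}.
Implicit Types u v x y z : (R * R)%type.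

Lemma dot_le_enorm u v : dot u v <= enorm u * enorm v.
Proof.
apply: le_trans (ler_norm _) _.
rewrite -sqrtrM ?dot_ge0// -sqrtr_sqr ler_wsqrtr//.
rewrite -subr_ge0 (_ : _ - _ = (u.1 * v.2 - u.2 * v.1) ^+ 2) ?sqr_ge0//.
by rewrite /dot; ring.
Qed.

Lemma ler_enormD u v : enorm (u + v) <= enorm u + enorm v.
Proof.
rewrite -[leRHS]ger0_norm ?addr_ge0 ?enorm_ge0// -sqrtr_sqr ler_wsqrtr//.
rewrite (_ : dot (u + v) _ = enorm u ^+ 2 + dot u v *+ 2 + enorm v ^+ 2); last first.
  by rewrite !sqr_enorm /dot/=; ring.
by rewrite sqrrD lerD2r lerD2l lerMn2r dot_le_enorm orbT.
Qed.

Lemma enormN u : enorm (- u) = enorm u.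
Proof. by rewrite /enorm /dot/= !mulrNN. Qed.

Lemma enormB u v : enorm (u - v) = enorm (v - u).
Proof. by rewrite -enormN opprB. Qed.

Lemma normr1_le_enorm u : `|u.1| <= enorm u.
Proof. by rewrite -sqrtr_sqr ler_wsqrtr// /dot expr2 lerDl -expr2 sqr_ge0. Qed.

Lemma normr2_le_enorm u : `|u.2| <= enorm u.
Proof. by rewrite -sqrtr_sqr ler_wsqrtr// /dot expr2 lerDr -expr2 sqr_ge0. Qed.

Lemma enorm_le u : enorm u <= `|u.1| + `|u.2|.
Proof.
rewrite -[leRHS]ger0_norm ?addr_ge0// -sqrtr_sqr ler_wsqrtr// /dot -!expr2 sqrrD.
by rewrite !real_normK ?num_real// lerD2r lerDl mulrn_wge0// mulr_ge0.
Qed.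

(** The topology is that of the sup norm, which is at most the Euclidean norm.
    *)
Lemma closed_enorm (C : set (R * R)) x : closed C -> ~ C x ->
  exists2 e, 0 < e & forall y, C y -> e <= enorm (x - y).
Proof.
move=> cC Cx; have : nbhs x (~` C) by apply: open_nbhs_nbhs; split => //; exact: closed_openC.
move=> /nbhs_ballP[e /= e0 xe]; exists e => // y Cy; rewrite leNgt; apply/negP => xy.
by apply: (xe y) Cy; split; rewrite /ball/=;
  apply: le_lt_trans xy; [exact: (normr1_le_enorm (x - y))|exact: (normr2_le_enorm (x - y))].
Qed.

Lemma enorm_cinv (a : R * R) : a != 0 -> enorm (cinv a) = (enorm a)^-1.
Proof.
move=> a0; rewrite /enorm -sqrtrV ?dot_ge0//; congr Num.sqrt.
have := dot_neq0 a0; rewrite /cinv /dot/= => d0; by field.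
Qed.

End enorm_theory.

Section hausdorff_theory.
Context {R : realType}.
Implicit Types (A C X P Q U : set (R * R)) (a x y z : (R * R)%type) (d e : R).
Local Open Scope ereal_scope.

Lemma ediam_ub A x y : A x -> A y -> (enorm (x - y))%:E <= ediam A.
Proof. by move=> Ax Ay; apply: ereal_sup_ubound; right; exists (x, y). Qed.

Lemma ediam_ge0 A : 0 <= ediam A.
Proof. by apply: ereal_sup_ubound; left. Qed.

Lemma gauge_ge0 d A : 0 <= gauge d A.
Proof. by rewrite /gauge; case: ifP => // _; exact: ediam_ge0. Qed.

Lemma gauge_set0 d : (0 < d)%R -> gauge d (set0 : set (R * R)) = 0.
Proof.
move=> d0; rewrite /gauge (_ : ediam _ = 0); first by rewrite lee_fin ltW.
by rewrite /ediam set0X image_set0 setU0 ereal_sup1.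
Qed.

Lemma hausdorff1_delta_le d A (U : (set (R * R))^nat) :
  A `<=` \bigcup_k U k -> hausdorff1_delta d A <= \sum_(k <oo) gauge d (U k).
Proof. by move=> AU; apply: ereal_inf_lbound; exists U. Qed.

Lemma hausdorff1_delta_le_hausdorff1 d A : (0 < d)%R ->
  hausdorff1_delta d A <= hausdorff1 A.
Proof. by move=> d0; apply: ereal_sup_ubound; exists d. Qed.

Lemma le_hausdorff1_delta d e A : (d <= e)%R ->
  hausdorff1_delta e A <= hausdorff1_delta d A.
Proof.
move=> de; apply: le_ereal_inf_tmp => _ [U AU <-].
apply: le_trans (hausdorff1_delta_le e AU) _.
apply: lee_nneseries => k _; first by move=> _; exact: gauge_ge0.
rewrite /gauge; case: (leP (ediam (U k)) d%:E) => [Ud|_]; last by rewrite leey.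
by rewrite ifT// (le_trans Ud)// lee_fin.
Qed.

Section image.
Variables (a z : R * R) (a0 : a != 0%R).
Let c := enorm a.
Let c0 : (0 < c)%R. Proof. exact: enorm_gt0. Qed.

Lemma ediam_sim_le A : ediam (sim a z @^-1` A) <= c^-1%:E * ediam A.
Proof.
apply: ge_ereal_sup => _ [->|[[x y] /= [Ax Ay] <-]].
  by rewrite mule_ge0 ?ediam_ge0// lee_fin invr_ge0 ltW.
rewrite lee_pdivlMl// -EFinM -enorm_rmul -(sim_sub a z).
exact: ediam_ub.
Qed.

(** The preimage of a set of diameter at most [|a| d] has diameter at most [d];
    for larger sets the right-hand side is infinite. *)
Lemma gauge_sim_le d A :
  gauge d (sim a z @^-1` A) <= c^-1%:E * gauge (c * d)%R A.
Proof.
rewrite {2}/gauge; case: ifPn => Ad; last first.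
  by rewrite gt0_muley ?leey// lte_fin invr_gt0.
apply: le_trans (ediam_sim_le A); rewrite /gauge ifT//.
apply: le_trans (ediam_sim_le A) _.
by rewrite lee_pdivrMl// -EFinM.
Qed.

Lemma hausdorff1_sim_le A : hausdorff1 (sim a z @^-1` A) <= c^-1%:E * hausdorff1 A.
Proof.
apply: ge_ereal_sup => _ [d /= d0 <-].
have cd0 : (0 < c * d)%R by rewrite mulr_gt0.
apply: (@le_trans _ _ (c^-1%:E * hausdorff1_delta (c * d) A)); last first.
  apply: lee_wpmul2l; first by rewrite lee_fin invr_ge0 ltW.
  exact: hausdorff1_delta_le_hausdorff1.
rewrite lee_pdivlMl//; apply: le_ereal_inf_tmp => _ [U AU <-].
rewrite -lee_pdivlMl// -nneseriesZl; last by move=> k _; exact: gauge_ge0.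
apply: le_trans (hausdorff1_delta_le d (U := fun k => sim a z @^-1` U k) _) _.
  by move=> x /AU[k _ ?]; exists k.
apply: lee_nneseries => k _; first by move=> _; exact: gauge_ge0.
exact: gauge_sim_le.
Qed.
End image.

Lemma sim_preimageK a z A : a != 0%R -> simV a z @^-1` (sim a z @^-1` A) = A.
Proof. by move=> a0; apply/seteqP; split => x /=; rewrite simVK. Qed.

(** Two applications of the inequality, to the similarity and to its inverse.
    *)
Lemma hausdorff1_sim a z A : a != 0%R ->
  hausdorff1 (sim a z @^-1` A) = (enorm a)^-1%:E * hausdorff1 A.
Proof.
move=> a0; apply/eqP; rewrite eq_le hausdorff1_sim_le//=.
rewrite lee_pdivrMl ?enorm_gt0//.
have := hausdorff1_sim_le (- rmul (cinv a) z)%R (cinv_neq0 a0) (sim a z @^-1` A).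
by rewrite (sim_preimageK z A a0) enorm_cinv// invrK.
Qed.

Lemma hausdorff1_ge0 A : 0 <= hausdorff1 A.
Proof. exact: (outer_measure_ge0 (@outer_arclength R)). Qed.

(** Every test set is a preimage, and the outer measure of preimages is scaled
    by a constant. *)
Lemma caratheodory_sim a z A : a != 0%R -> caratheodory_measurable hausdorff1 A ->
  caratheodory_measurable hausdorff1 (sim a z @^-1` A).
Proof.
move=> a0 cA X.
have -> : X = sim a z @^-1` (simV a z @^-1` X).
  by apply/seteqP; split => x /=; rewrite simK.
move: (simV a z @^-1` X) => Y.
change (hausdorff1 (sim a z @^-1` Y) = hausdorff1 (sim a z @^-1` (Y `&` A)) +
  hausdorff1 (sim a z @^-1` (Y `&` ~` A))).
rewrite (hausdorff1_sim z Y a0) (hausdorff1_sim z _ a0) (hausdorff1_sim z _ a0).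
rewrite (cA Y) ge0_muleDr//; exact: hausdorff1_ge0.
Qed.

Lemma arclength_iso a z : a != 0%R ->
  scaled_iso (@arclength R) (@arclength R) (sim a z) (simV a z) (enorm a)^-1.
Proof.
move=> a0; split.
- by move=> _ A mA; rewrite setTI; exact: caratheodory_sim.
- by move=> _ A mA; rewrite setTI; apply: caratheodory_sim => //; exact: cinv_neq0.
- exact: simK.
- exact: simVK.
- by rewrite invr_gt0 enorm_gt0.
- by move=> A _; exact: hausdorff1_sim.
Qed.

End hausdorff_theory.

(** * Closed sets are measurable for the arc length *)

Section caratheodory_criterion.
Context {R : realType}.
Implicit Types (A C X P Q U : set (R * R)) (d e : R).
Local Open Scope ereal_scope.
Local Notation H1 := (@hausdorff1 R).

Lemma ereal_sup2_le (S T : set (\bar R)) (X : \bar R) : S !=set0 -> T !=set0 ->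
  (forall s, S s -> 0 <= s) -> (forall t, T t -> 0 <= t) ->
  (forall s t, S s -> T t -> s + t <= X) ->
  ereal_sup S + ereal_sup T <= X.
Proof.
move=> [s0 Ss0] [t0 Tt0] S0 T0 STX.
have [->|Xoo] := eqVneq X +oo; first exact: leey.
have X0 : 0 <= X by apply: le_trans (STX _ _ Ss0 Tt0); apply: adde_ge0; [exact: S0|exact: T0].
have Xfin : X \is a fin_num by rewrite ge0_fin_numE// ltey.
have fin (u : \bar R) : 0 <= u -> u <= X -> u \is a fin_num.
  by move=> u0 uX; rewrite ge0_fin_numE// (le_lt_trans uX)// ltey.
have Tle t : T t -> t <= X.
  by move=> Tt; apply: le_trans (STX _ _ Ss0 Tt); apply: leeDr; exact: S0.
have Sle : ereal_sup S <= X.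
  by apply: ge_ereal_sup => s Ss; apply: le_trans (STX _ _ Ss Tt0); apply: leeDl; exact: T0.
have Sfin : ereal_sup S \is a fin_num.
  apply: fin => //; apply: le_trans (S0 _ Ss0) _; exact: ereal_sup_ubound.
rewrite addeC -leeBrDr//; apply: ge_ereal_sup => t Tt; rewrite leeBrDr// addeC.
have tfin : t \is a fin_num by apply: fin; [exact: T0|exact: Tle].
rewrite -(leeBrDr _ _ tfin); apply: ge_ereal_sup => s Ss.
by rewrite (leeBrDr _ _ tfin); exact: STX.
Qed.

(** A set of diameter less than [e] meets only one of [P] and [Q], so a cover
    of the union splits into a cover of each. *)
Lemma hausdorff1_delta_separated P Q d e : (0 < d)%R -> (d < e)%R ->
  (forall p q, P p -> Q q -> (e <= enorm (p - q))%R) ->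
  hausdorff1_delta d P + hausdorff1_delta d Q <= hausdorff1_delta d (P `|` Q).
Proof.
move=> d0 de PQ; apply: le_ereal_inf_tmp => _ [U PQU <-].
pose V A k := if `[< U k `&` A !=set0 >] then U k else set0.
have cover A : A `<=` P `|` Q -> A `<=` \bigcup_k V A k.
  move=> APQ x Ax; have [k _ Ux] := PQU x (APQ x Ax).
  by exists k => //; rewrite /V asboolT//; exists x.
have PU := hausdorff1_delta_le d (cover P (@subsetUl _ _ _)).
have QU := hausdorff1_delta_le d (cover Q (@subsetUr _ _ _)).
apply: le_trans (leeD PU QU) _.
rewrite -nneseriesD; [|by move=> *; exact: gauge_ge0|by move=> *; exact: gauge_ge0].
apply: lee_nneseries => k _; first by move=> _; apply: adde_ge0; exact: gauge_ge0.
rewrite /V; case: asboolP => [[p [Up Pp]]|_]; last first.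
  by rewrite gauge_set0// add0e; case: ifP => // _; rewrite gauge_set0// gauge_ge0.
case: asboolP => [[q [Uq Qq]]|_]; last by rewrite gauge_set0// adde0.
suff -> : gauge d (U k) = +oo by rewrite leey.
rewrite /gauge ifF//; apply/negbTE; rewrite -ltNge.
apply: (@lt_le_trans _ _ e%:E); first by rewrite lte_fin.
by apply: le_trans (ediam_ub Up Uq); rewrite lee_fin PQ.
Qed.

Lemma hausdorff1_separated P Q e : (0 < e)%R ->
  (forall p q, P p -> Q q -> (e <= enorm (p - q))%R) ->
  H1 P + H1 Q <= H1 (P `|` Q).
Proof.
move=> e0 PQ.
have delta0 d A : (0 < d)%R -> 0 <= hausdorff1_delta d A.
  move=> d0; apply: le_ereal_inf_tmp => _ [U _ <-].
  by apply: nneseries_ge0 => k _ _; exact: gauge_ge0.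
apply: ereal_sup2_le.
- by exists (hausdorff1_delta 1 P), 1%R => //=; exact: ltr01.
- by exists (hausdorff1_delta 1 Q), 1%R => //=; exact: ltr01.
- by move=> _ [d /= d0 <-]; exact: delta0.
- by move=> _ [d /= d0 <-]; exact: delta0.
move=> _ _ [s /= s0 <-] [t /= t0 <-].
pose d := (Num.min (Num.min s t) (e / 2))%R.
have d0 : (0 < d)%R by rewrite !lt_min s0 t0 divr_gt0.
have de : (d < e)%R by rewrite /d gt_min; apply/orP; right; lra.
apply: le_trans (hausdorff1_delta_le_hausdorff1 _ d0).
apply: le_trans (hausdorff1_delta_separated d0 de PQ).
apply: leeD; apply: le_hausdorff1_delta.
- by rewrite /d !ge_min lexx.
- by rewrite /d !ge_min lexx orbT.
Qed.

Section closed.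
Variables (C X : set (R * R)).
Hypotheses (cC : closed C) (Xfin : H1 X < +oo).

Let E n := [set x | X x /\ forall y, C y -> (n.+1%:R^-1 <= enorm (x - y))%R].
Let Rg n := E n.+1 `\` E n.

Let EX n : E n `<=` X. Proof. by move=> x []. Qed.

Let E_homo n m : (n <= m)%N -> E n `<=` E m.
Proof.
move=> nm x [Xx Cx]; split=> // y /Cx; apply: le_trans.
by rewrite lef_pV2 ?posrE// ler_nat ltnS.
Qed.

Let gap n : (0 < n.+1%:R^-1 - n.+2%:R^-1 :> R)%R.
Proof. by rewrite subr_gt0 ltf_pV2 ?posrE// ltr_nat. Qed.

Let E_separated n p q : E n p -> X q -> ~ E n.+1 q ->
  (n.+1%:R^-1 - n.+2%:R^-1 <= enorm (p - q))%R.
Proof.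
move=> [Xp Ep] Xq Eq.
have [y Cy qy] : exists2 y, C y & (enorm (q - y) < n.+2%:R^-1)%R.
  apply: contrapT => qC; apply: Eq; split=> // y Cy; rewrite leNgt.
  by apply/negP => qy; apply: qC; exists y.
have := ler_enormD (p - q)%R (q - y)%R; rewrite addrA subrK => pqy.
rewrite lerBlDr; apply: le_trans (Ep y Cy) _; apply: le_trans pqy _.
by rewrite lerD2l ltW.
Qed.

Let le_H1 A B : A `<=` B -> H1 A <= H1 B.
Proof. exact: (le_outer_measure (@outer_arclength R)). Qed.

Let sum_rings n : exists a b, [/\ a <= H1 (E n.+1), b <= H1 (E n) &
  \sum_(k < n.+1) H1 (Rg k) = a + b].
Proof.
(* [a] and [b] are the sums over the two parities, the last ring being in [a]. *)
elim: n => [|n [a [b [aE bE abE]]]].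
  exists (H1 (Rg 0)), 0; split; [by apply: le_H1 => x []|exact: hausdorff1_ge0|].
  by rewrite big_ord_recr/= big_ord0 add0e adde0.
exists (b + H1 (Rg n.+1)), a; split => //; last first.
  by rewrite big_ord_recr/= abE [RHS]addeC addeA.
apply: le_trans (leeD2r _ bE) _.
apply: le_trans (hausdorff1_separated (gap n) _) _.
  by move=> p q Ep [Eq /(E_separated Ep)]; apply; exact: EX Eq.
apply: le_H1 => x [|[]]//; apply: E_homo; exact: leq_trans (leqnSn _) (leqnSn _).
Qed.

Let rings_summable : \sum_(k <oo) H1 (Rg k) < +oo.
Proof.
apply: (@le_lt_trans _ _ (H1 X + H1 X)); last by rewrite lte_add_pinfty.
apply: lime_le; first by apply: is_cvg_nneseries => k _ _; exact: hausdorff1_ge0.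
apply: nearW => -[|n].
  by rewrite big_geq//; apply: adde_ge0; exact: hausdorff1_ge0.
rewrite big_mkord; have [a [b [aE bE ->]]] := sum_rings n.
apply: leeD; [apply: le_trans aE _|apply: le_trans bE _]; apply: le_H1; exact: EX.
Qed.

Let setD_E : X `\` C `<=` \bigcup_n E n.
Proof.
move=> x [Xx Cx]; have [e e0 eC] := closed_enorm cC Cx.
have := near_infty_natSinv_lt (PosNum e0) => -[N _ Ne].
exists N => //; split => // y /eC; apply: le_trans.
by apply: ltW; exact: (Ne N (leqnn _)).
Qed.

Let setD_rings N : X `\` C `<=` E N `|` \bigcup_(k in [set k | (N <= k)%N]) Rg k.
Proof.
move=> x /setD_E[n _]; elim: n => [Ex|n IH Ex].
  by left; exact: E_homo Ex.
have [/IH//|Enx] := pselect (E n x).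
have [nN|Nn] := leqP n.+1 N; first by left; exact: E_homo Ex.
by right; exists n.
Qed.

(** Caratheodory's criterion for metric outer measures. [E n] is the part of
    [X] at distance at least 1/(n+1) from [C]; it is separated from [C], so [X
    `&` C] and [E n] have together at most the measure of [X]. The rest of [X
    `\` C] lies in the rings [Rg k], [k >= n]; rings of the same parity are
    separated from each other, so the sum of all their measures is at most
    twice that of [X] and its tails vanish. *)
Lemma caratheodory_closed_le : H1 (X `&` C) + H1 (X `&` ~` C) <= H1 X.
Proof.
have tail0 : (\sum_(N <= k <oo) H1 (Rg k)) @[N --> \oo] --> 0.
  by apply: nneseries_tail_cvg => // k _; exact: hausdorff1_ge0.
have EN N : H1 (X `&` C) + H1 (E N) <= H1 X.
  apply: le_trans (hausdorff1_separated (e := N.+1%:R^-1) _ _) _.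
  - by rewrite invr_gt0.
  - by move=> p q [_ Cp] [_ /(_ _ Cp)]; rewrite enormB.
  - by apply: le_H1 => x [[]|/EX].
have XC_fin : H1 (X `&` C) \is a fin_num.
  rewrite ge0_fin_numE ?hausdorff1_ge0//; apply: le_lt_trans Xfin.
  by apply: le_H1 => x [].
have step N : H1 (X `&` C) + H1 (X `&` ~` C) <= H1 X + \sum_(N <= k <oo) H1 (Rg k).
  apply: le_trans (leeD2r _ (EN N)); rewrite -addeA; apply: leeD => //.
  apply: le_trans (le_H1 (setD_rings N)) _.
  apply: le_trans (outer_measureU2 (@outer_arclength R) _ _) _.
  apply: leeD => //.
  have := outer_measure_sigma_subadditive_tail (@outer_arclength R) N Rg.
  apply: le_trans; apply: le_H1 => x [k /= Nk Rk]; exists k => //=.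
  by apply/negP; rewrite -leqNgt.
rewrite -[leRHS]adde0.
have cvgX : H1 X + (\sum_(N <= k <oo) H1 (Rg k)) @[N --> \oo] --> H1 X + 0.
  apply: cvgeD => //; last exact: cvg_cst.
  by rewrite fin_num_adde_defl.
rewrite -(cvg_lim _ cvgX)//; apply: lime_ge; first by apply/cvg_ex; eexists; exact: cvgX.
exact: nearW.
Qed.

End closed.

Lemma closed_caratheodory C : closed C -> caratheodory_measurable H1 C.
Proof.
move=> cC; apply: (@le_caratheodory_measurable _ _ (@outer_arclength R)) => X.
have [Xfin|] := ltP (H1 X) +oo; first exact: caratheodory_closed_le.
by rewrite leye_eq => /eqP XE; rewrite [leRHS]XE leey.
Qed.

End caratheodory_criterion.

(** * Topology and measurability in the plane *)

Section plane_topology.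
Context {R : realType}.
Implicit Types (A C D : set (R * R)) (a x z : (R * R)%type) (f : R * R -> R).

Lemma continuous_closure_preimage (T U : topologicalType) (g : T -> U) (A : set U) :
  continuous g -> closure (g @^-1` A) `<=` g @^-1` closure A.
Proof.
by move=> cg x Ax B /cg gB; have [y [Ay By]] := Ax _ gB; exists (g y).
Qed.

Lemma sim_continuous a z : continuous (sim a z).
Proof.
move=> x; rewrite /sim /rmul.
have c1 : (fun y : R * R => y.1) y @[y --> x] --> x.1 by exact: cvg_fst.
have c2 : (fun y : R * R => y.2) y @[y --> x] --> x.2 by exact: cvg_snd.
have h1 : a.1 * y.1 - a.2 * y.2 + z.1 @[y --> x] --> a.1 * x.1 - a.2 * x.2 + z.1.
  by apply: cvgD; [apply: cvgB; apply: cvgMr|exact: cvg_cst].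
have h2 : a.2 * y.1 + a.1 * y.2 + z.2 @[y --> x] --> a.2 * x.1 + a.1 * x.2 + z.2.
  by apply: cvgD; [apply: cvgD; apply: cvgMr|exact: cvg_cst].
exact: (cvg_pair h1 h2).
Qed.

Lemma closure_sim a z A : a != 0 ->
  closure (sim a z @^-1` A) = sim a z @^-1` closure A.
Proof.
move=> a0; apply/seteqP; split.
  by apply: continuous_closure_preimage; exact: sim_continuous.
move=> x /= Ax; rewrite -(simK z a0 x); move: (sim a z x) Ax => y Ay.
have := @continuous_closure_preimage _ _ (simV a z) (sim a z @^-1` A).
by rewrite (sim_preimageK z A a0); apply => //; exact: sim_continuous.
Qed.

Lemma interior_sim a z A : a != 0 ->
  (sim a z @^-1` A)° = sim a z @^-1` A°.
Proof.
move=> a0; apply/seteqP; split => x; last exact: sim_continuous.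
move=> xA.
have cV : simV a z y @[y --> sim a z x] --> x.
  by rewrite -[X in _ --> X](simK z a0 x); exact: sim_continuous.
have : nbhs (sim a z x) (simV a z @^-1` (sim a z @^-1` A)) := cV _ xA.
by rewrite (sim_preimageK z A a0).
Qed.

Lemma frontier_sim a z A : a != 0 ->
  frontier (sim a z @^-1` A) = sim a z @^-1` frontier A.
Proof. by move=> a0; rewrite /frontier closure_sim// interior_sim. Qed.

Lemma frontier_closed A : closed (frontier A).
Proof.
rewrite /frontier setDE; apply: closedI; first exact: closed_closure.
by apply: open_closedC; exact: open_interior.
Qed.

(** An open set is the countable union of the squares with rational centre and
    side 2/(n+1) that it contains. *)
Lemma open_plane_measurable A : open A ->
  measurable (A : set (measurableTypeR R * measurableTypeR R)).
Proof.
move=> oA.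
pose ball2 (p q : rat) (n : nat) : set (R * R) :=
  ball (ratr p : R) (n.+1%:R^-1 : R) `*` ball (ratr q : R) (n.+1%:R^-1 : R).
pose G p q n := if `[< ball2 p q n `<=` A >] then ball2 p q n else set0.
rewrite (_ : A = \bigcup_p \bigcup_q \bigcup_n G p q n); last first.
  apply/seteqP; split => [x Ax|x [p _ [q _ [n _]]]]; last first.
    by rewrite /G; case: asboolP => // h /h.
  have /nbhs_ballP[e /= e0 xe] : nbhs x A by exact: open_nbhs_nbhs.
  have e20 : 0 < e / 2 by rewrite divr_gt0.
  have [N _ Ne] := near_infty_natSinv_lt (PosNum e20).
  have {}Ne : N.+1%:R^-1 < e / 2 := Ne N (leqnn _).
  have N0 : 0 < N.+1%:R^-1 :> R by rewrite invr_gt0.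
  have tri (s t u : R) : `|s - t| < N.+1%:R^-1 -> `|s - u| < N.+1%:R^-1 ->
      `|t - u| < e.
    move: (N.+1%:R^-1) Ne => dl de; have := ler_distD s t u; rewrite (distrC t s).
    by lra.
  have near_rat (t : R) : exists p : rat, `|ratr p - t| < N.+1%:R^-1.
    have [|p] := @rat_in_itvoo R (t - N.+1%:R^-1) (t + N.+1%:R^-1).
      by rewrite ltrD2l (lt_trans _ N0)// oppr_lt0.
    by rewrite in_itv/= => pt; exists p; rewrite ltr_distl.
  have [p px] := near_rat x.1; have [q qx] := near_rat x.2.
  exists p => //; exists q => //; exists N => //; rewrite /G asboolT//.
  move=> y [/= py qy]; apply: xe; rewrite /ball/= in py qy *; split; rewrite /ball/=.
    exact: tri px py.
  exact: tri qx qy.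
apply: bigcupT_measurable_rat => p; apply: bigcupT_measurable_rat => q.
apply: bigcupT_measurable => n; rewrite /G; case: asboolP => // _.
by apply: measurableX; apply: open_measurable; exact: ball_open.
Qed.

Lemma continuous_plane_measurable (f : R * R -> R) : continuous f ->
  measurable_fun (setT : set (measurableTypeR R * measurableTypeR R)) f.
Proof.
move=> /continuousP cf _; apply: (measurability _ (RGenOpens.measurableE R)) => //.
move=> _ [_ [a [b ->] <-]]; rewrite setTI; apply: open_plane_measurable.
by apply: cf; exact: interval_open.
Qed.

Lemma closed_arclength_measurable C : closed C ->
  measurable (C : set (caratheodory_type (@outer_arclength R))).
Proof. exact: closed_caratheodory. Qed.

(** The preimage of an open interval is the difference of two closed sets. *)
Lemma arclength_measurable_fun C f : closed C ->
  (forall K : set R, closed K -> closed (C `&` f @^-1` K)) ->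
  measurable_fun (C : set (caratheodory_type (@outer_arclength R))) f.
Proof.
move=> cC fK mC; apply: (measurability _ (RGenOpens.measurableE R)) => //.
move=> _ [_ [a [b ->] <-]].
rewrite (_ : _ `&` _ = C `\` (C `&` f @^-1` ~` `]a, b[%classic)); last first.
  apply/seteqP; split => x /= [Cx fx]; split=> //; first by case.
  by apply: contrapT => nfx; apply: fx.
apply: measurableD => //.
apply: (@closed_arclength_measurable (C `&` f @^-1` (~` `]a, b[%classic))).
by apply: fK; apply: open_closedC; exact: interval_open.
Qed.

Lemma continuous_arclength_measurable C f : closed C -> continuous f ->
  measurable_fun (C : set (caratheodory_type (@outer_arclength R))) f.
Proof.
move=> cC /continuous_closedP cf; apply: arclength_measurable_fun => // K cK.
by apply: closedI => //; exact: cf.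
Qed.

(** Squares are products of compact intervals, hence compact and of finite
    measure. *)
Definition box (M : R) : set (R * R) := `[- M, M]%classic `*` `[- M, M]%classic.

Lemma box_compact M : compact (box M).
Proof. by apply: compact_setX; exact: segment_compact. Qed.

Lemma box_closed M : closed (box M).
Proof. by apply: compact_closed; [exact: norm_hausdorff|exact: box_compact]. Qed.

Lemma box_lebesgue_fin M : (lebesgue2 (box M) < +oo)%E.
Proof.
have mI : measurable (`[- M, M]%classic : set (measurableTypeR R)).
  exact: measurable_itv.
have -> : lebesgue2 (box M) =
    mule (lebesgue_measure (`[- M, M]%classic : set (measurableTypeR R)))
      (lebesgue_measure (`[- M, M]%classic : set (measurableTypeR R))).
  exact: (@product_measure1E _ _ _ _ R lebesgue_measure lebesgue_measure _ _ mI mI).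
by rewrite !lebesgue_measure_itv/=; case: ifPn => _; rewrite ?mule0// -EFinB -EFinM ltry.
Qed.

Lemma bounded_box A : bounded_set A -> exists M, A `<=` box M.
Proof.
move=> /pinfty_ex_gt0[M M0 AM]; exists M => x /AM xM.
have : Num.max `|x.1| `|x.2| <= M by exact: xM.
by rewrite ge_max => /andP[x1 x2]; split; rewrite /= in_itv/= -ler_norml.
Qed.

Lemma continuous_bounded_on_box f M : continuous f ->
  exists K, forall x, box M x -> `|f x| <= K.
Proof.
move=> cf.
have /compact_bounded/pinfty_ex_gt0[K K0 fK] : compact (f @` box M).
  by apply: continuous_compact; [exact: continuous_subspaceT|exact: box_compact].
by exists K => x Ax; apply: fK; exists x.
Qed.

End plane_topology.

(** * Functions of class C1 and directional derivatives *)

Section calculus.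
Context {R : realType}.
Implicit Types (a x y z v w : (R * R)%type) (f h : R * R -> R).

Definition C1 f := class_C 1 f.

Lemma C1_continuous f : C1 f -> continuous f. Proof. by case. Qed.

Lemma C1_derivable f : C1 f -> forall x v, derivable f x v.
Proof. by case=> _ Df x v; have [/(_ x)] := Df v. Qed.

Lemma C1_derive_continuous f : C1 f -> forall v, continuous ('D_v f).
Proof. by case=> _ Df v; have [_ []] := Df v. Qed.

Lemma smooth_C1 f : smooth f -> C1 f. Proof. exact. Qed.

Lemma smooth_continuous f : smooth f -> continuous f.
Proof. by move/smooth_C1/C1_continuous. Qed.

(** A similarity maps lines to lines, so difference quotients along [v] become
    difference quotients along [rmul a v]. *)
Lemma sim_line a z x v (t : R) : sim a z (t *: v + x) = t *: rmul a v + sim a z x.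
Proof. by rewrite /sim /rmul; congr pair; rewrite /= /GRing.scale/=; ring. Qed.

Lemma quotient_sim f a z x v :
  (fun t : R => t^-1 *: (((f \o sim a z) \o shift x) (t *: v) - (f \o sim a z) x)) =
  (fun t : R => t^-1 *: ((f \o shift (sim a z x)) (t *: rmul a v) - f (sim a z x))).
Proof. by apply/funext => t; rewrite /= sim_line. Qed.

Lemma derivable_sim f a z x v :
  derivable f (sim a z x) (rmul a v) -> derivable (f \o sim a z) x v.
Proof. by rewrite /derivable quotient_sim. Qed.

Lemma derive_sim_at f a z v x :
  'D_v (f \o sim a z) x = 'D_(rmul a v) f (sim a z x).
Proof. by rewrite /derive quotient_sim. Qed.

Lemma derive_sim f a z v : 'D_v (f \o sim a z) = 'D_(rmul a v) f \o sim a z.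
Proof. by apply/funext => x; exact: derive_sim_at. Qed.

Lemma class_C_sim k f a z : class_C k f -> class_C k (f \o sim a z).
Proof.
elim: k f => [|k IH] f [cf Df]; split => //; try by
  move=> x; apply: continuous_comp; [exact: sim_continuous|exact: cf].
move=> v; rewrite derive_sim; have [df cD] := Df (rmul a v).
by split; [move=> x; exact: derivable_sim|exact: IH].
Qed.

Lemma smooth_sim f a z : smooth f -> smooth (f \o sim a z).
Proof. by move=> sf k; exact: class_C_sim. Qed.

Lemma class_C_lin k f h (s t : R) : class_C k f -> class_C k h ->
  class_C k (fun x => s * f x + t * h x).
Proof.
elim: k f h => [|k IH] f h [cf Df] [ch Dh].
  by split => // x; apply: cvgD; apply: cvgMr; [exact: cf|exact: ch].
split; first by move=> x; apply: cvgD; apply: cvgMr; [exact: cf|exact: ch].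
move=> v; have [df cDf] := Df v; have [dh cDh] := Dh v.
have E : (fun x => s * f x + t * h x) = (s \*: f + t \*: h) :> (R * R -> R).
  by [].
have is_lin x : is_derive x v (s \*: f + t \*: h) (s *: 'D_v f x + t *: 'D_v h x).
  apply: is_deriveD; apply: is_deriveZ; exact: derivableP.
rewrite E (_ : 'D_v _ = fun x => s * 'D_v f x + t * 'D_v h x); last first.
  by apply/funext => x; exact: derive_val.
by split; [move=> x; exact: ex_derive|exact: IH].
Qed.

Lemma smooth_lin f h (s t : R) : smooth f -> smooth h ->
  smooth (fun x => s * f x + t * h x).
Proof. by move=> sf sh k; exact: class_C_lin. Qed.

Lemma is_derive_line f x v (t : R) : derivable f (t *: v + x) v ->
  is_derive t 1 (fun s : R => f (s *: v + x)) ('D_v f (t *: v + x)).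
Proof.
move=> df.
have E : (fun s : R => s^-1 *: (((fun s : R => f (s *: v + x)) \o shift t) (s *: 1) -
     f (t *: v + x))) =
  (fun s : R => s^-1 *: ((f \o shift (t *: v + x)) (s *: v) - f (t *: v + x))).
  apply/funext => s /=; congr (_ *: (f _ - _)).
  by rewrite -[s *: 1]/(s * 1) mulr1 scalerDl addrA.
by split; rewrite /derivable /derive E.
Qed.

(** The chain rule for the restriction of [f] to a line. *)
Lemma deriveZ_dir f x v (c : R) : C1 f -> 'D_(c *: v) f x = c * 'D_v f x.
Proof.
move=> C1f.
have df y w : derivable f y w by exact: C1_derivable.
have d3 : is_derive (0 : R) (1 : R) (c \*: id) (c *: 1).
  by apply: is_deriveZ; exact: is_derive_id.
have d2 := is_derive_line (df (((c \*: id) 0 : R) *: v + x) v).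
have d1 := is_derive_line (df (0 *: (c *: v) + x) (c *: v)).
have := is_derive1_comp d2 d3.
have -> : (fun s : R => f (s *: v + x)) \o (c \*: id) =
          (fun s : R => f (s *: (c *: v) + x)).
  by apply/funext => s /=; rewrite scalerA mulrC.
move=> d4; have := @derive_val _ _ _ _ _ _ _ d4; rewrite (@derive_val _ _ _ _ _ _ _ d1) /=.
by rewrite -[c *: 1]/(c * 1) -[c *: 0]/(c * 0) mulr0 mulr1 !scale0r !add0r mulrC.
Qed.

(** The mean value theorem on the line through [x] directed by [v]. *)
Lemma mean_value f x v (t : R) : C1 f -> t != 0 ->
  exists2 c : R, `|c| <= `|t| & t^-1 *: (f (t *: v + x) - f x) = 'D_v f (c *: v + x).
Proof.
move=> C1f t0.
have dg (s : R) : is_derive s 1 (fun s : R => f (s *: v + x)) ('D_v f (s *: v + x)).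
  by apply: is_derive_line; exact: C1_derivable.
have cg (u w : R) : {within `[u, w], continuous (fun s : R => f (s *: v + x))}.
  apply: derivable_within_continuous => s _; exact: (@ex_derive _ _ _ _ _ _ _ (dg s)).
have fx : f x = f (0 *: v + x) by rewrite scale0r add0r.
have [tn|tp|/eqP] := ltgtP t 0; last by rewrite (negbTE t0).
  have [c] := MVT tn (fun s _ => dg s) (cg t 0).
  rewrite in_itv/= sub0r => /andP[tc c0] E; exists c.
    by rewrite !ltr0_norm// lerN2 ltW.
  by rewrite fx -opprB E mulrN opprK [_ * t]mulrC; exact: mulKf.
have [c] := MVT tp (fun s _ => dg s) (cg 0 t).
rewrite in_itv/= subr0 => /andP[c0 ct] E; exists c.
  by rewrite !gtr0_norm// ltW.
by rewrite fx E [_ * t]mulrC; exact: mulKf.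
Qed.

(** The increment along [v + w] is the increment along [v] plus an increment
    along [w] from a nearby point; the mean value theorem and the continuity of
    the derivative along [w] handle the latter. Linearity in the direction is
    what fails for functions that only have directional derivatives. *)
Lemma deriveD_dir f x v w : C1 f -> 'D_(v + w) f x = 'D_v f x + 'D_w f x.
Proof.
move=> C1f.
suff : (fun t : R => t^-1 *: ((f \o shift x) (t *: (v + w)) - f x)) t
    @[t --> 0^'] --> 'D_v f x + 'D_w f x by move=> /cvg_lim; apply.
rewrite (_ : (fun t : R => _) = (fun t : R =>
    t^-1 *: (f (t *: v + x) - f x) +
    t^-1 *: (f (t *: w + (t *: v + x)) - f (t *: v + x)))); last first.
  apply/funext => t /=; rewrite -scalerDr [X in _ = _ *: X]addrC addrA subrK.
  by congr (_ *: (f _ - _)); rewrite scalerDr [RHS]addrCA addrA.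
apply: cvgD; first exact: (C1_derivable C1f).
apply/cvgrPdist_lt => e e0.
have /cvgrPdist_lt/(_ _ e0)/nbhs_ballP[d /= d0 xd] := @C1_derive_continuous _ C1f w x.
(* The displacements [c w + t v] with [|c| <= |t|] have norm below [|t| M]. *)
pose M := `|v.1| + `|v.2| + `|w.1| + `|w.2| + 1.
have M0 : 0 < M by rewrite ltr_wpDl// !addr_ge0.
have dM : 0 < d / M by rewrite divr_gt0.
near=> t.
have t0 : t != 0 by near: t; exact: nbhs_dnbhs_neq.
have td : `|t| < d / M.
  near: t; apply: dnbhs0_lt; exact: dM.
have [c ct ->] := mean_value (t *: v + x) w C1f t0.
apply: xd.
have {}td : `|t| * M < d by rewrite -ltr_pdivlMr.
have small (p q r : R) : `|p| + `|q| < M -> `|r - (c * q + (t * p + r))| < d.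
  move=> pq; apply: le_lt_trans td.
  rewrite (_ : r - _ = - (c * q + t * p)); last by ring.
  rewrite normrN (le_trans (ler_normD _ _))// !normrM.
  have : `|c| * `|q| <= `|t| * `|q| by rewrite ler_wpM2r.
  have : `|t| * (`|p| + `|q|) <= `|t| * M by rewrite ler_wpM2l// ltW.
  by rewrite mulrDr; lra.
have n0 := (normr_ge0 v.1, normr_ge0 v.2, normr_ge0 w.1, normr_ge0 w.2).
by split; rewrite /ball/=; apply: small; rewrite /M; move: n0 => [[[]]]; lra.
Unshelve. all: by end_near. Qed.

Lemma derive_grad f x v : C1 f -> 'D_v f x = dot (grad f x) v.
Proof.
move=> C1f; have -> : v = v.1 *: (1, 0) + v.2 *: (0, 1).
  by rewrite [LHS]surjective_pairing; congr pair;
    rewrite /= -?[_ *: _]/(_ * _) ?mulr1 ?mulr0 ?addr0 ?add0r.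
rewrite deriveD_dir// !deriveZ_dir// /dot /grad/=.
by rewrite -?[_ *: _]/(_ * _); ring.
Qed.

(** Complex conjugation, on pairs; multiplication by the conjugate of [a] is
    the transpose of multiplication by [a]. *)
Definition rconj a : R * R := (a.1, - a.2).

Lemma dot_rconj a v w : dot (rmul (rconj a) v) w = dot v (rmul a w).
Proof. by rewrite /dot /rmul /rconj/=; ring. Qed.

(** The derivative along [v] of the composite is the derivative along [rmul a
    v], and the gradient is obtained by transposition. *)
Lemma grad_sim f a z x : C1 f ->
  grad (f \o sim a z) x = rmul (rconj a) (grad f (sim a z x)).
Proof.
move=> C1f; rewrite {1}/grad !derive_sim_at !derive_grad//.
rewrite -!dot_rconj; move: (rmul _ _) => u.
by rewrite [RHS]surjective_pairing /dot/= !mulr1 !mulr0 addr0 add0r.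
Qed.

Lemma grad_lin f h (s t : R) x : C1 f -> C1 h ->
  grad (fun x => s * f x + t * h x) x =
  (s * (grad f x).1 + t * (grad h x).1, s * (grad f x).2 + t * (grad h x).2).
Proof.
move=> C1f C1h.
have is_lin v : is_derive x v (s \*: f + t \*: h) (s *: 'D_v f x + t *: 'D_v h x).
  by apply: is_deriveD; apply: is_deriveZ; apply: derivableP; exact: C1_derivable.
by rewrite /grad; congr pair; exact: derive_val.
Qed.

End calculus.

(** * The unit normal *)

Section unit_normal.
Context {R : realType}.
Implicit Types (D : set (R * R)) (a x y z v w : (R * R)%type) (f h rho : R * R -> R).

Definition normalize v : R * R := (enorm v)^-1 *: v.

Lemma dotC v w : dot v w = dot w v.
Proof. by rewrite /dot mulrC [v.2 * _]mulrC. Qed.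

Lemma dotZl (c : R) v w : dot (c *: v) w = c * dot v w.
Proof. by rewrite /dot /= /GRing.scale/= mulrDr !mulrA. Qed.

Lemma dotZr (c : R) v w : dot v (c *: w) = c * dot v w.
Proof. by rewrite dotC dotZl dotC. Qed.

Lemma dotBr u v w : dot u (v - w) = dot u v - dot u w.
Proof. by rewrite /dot/=; ring. Qed.

Lemma enormZ (c : R) v : enorm (c *: v) = `|c| * enorm v.
Proof. by rewrite /enorm dotZl dotZr mulrA -expr2 sqrtrM ?sqr_ge0// sqrtr_sqr. Qed.

Lemma enorm_normalize v : v != 0 -> enorm (normalize v) = 1.
Proof.
move=> /enorm_gt0 v0; rewrite /normalize enormZ ger0_norm ?invr_ge0 ?ltW//.
by rewrite mulVf// gt_eqF.
Qed.

Lemma unit_dot_lt1 v w : enorm v = 1 -> enorm w = 1 -> v != w -> dot v w < 1.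
Proof.
move=> v1 w1 vw; have : v - w != 0 by rewrite subr_eq0.
move=> /dot_gt0; rewrite (_ : dot (v - w) _ = enorm v ^+ 2 + enorm w ^+ 2 - 2 * dot v w).
  by rewrite v1 w1; lra.
by rewrite !sqr_enorm /dot/=; ring.
Qed.

Lemma line_cvg x v : (t *: v + x) @[t --> (0 : R)] --> x.
Proof.
have h1 : t * v.1 + x.1 @[t --> (0 : R)] --> 0 * v.1 + x.1.
  by apply: cvgD; [apply: cvgMl|exact: cvg_cst].
have h2 : t * v.2 + x.2 @[t --> (0 : R)] --> 0 * v.2 + x.2.
  by apply: cvgD; [apply: cvgMl|exact: cvg_cst].
rewrite [X in _ --> X](_ : x = (0 * v.1 + x.1, 0 * v.2 + x.2)); last first.
  by rewrite !mul0r !add0r -surjective_pairing.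
exact: (cvg_pair h1 h2).
Qed.

(** The sign [s] allows one statement for both signs of the derivative. *)
Lemma derive_sign_right f x v (s : R) : derivable f x v -> f x = 0 ->
  0 < s * 'D_v f x -> \forall t \near 0^'+, 0 < s * f (t *: v + x).
Proof.
move=> df fx0 sD.
have cq : s * (t^-1 *: (f (t *: v + x) - f x)) @[t --> 0^'] --> s * 'D_v f x.
  by apply: cvgMr; exact: df.
have := cvg_dnbhs_at_right cq => /cvgr_gt/(_ _ sD).
apply: filter_app; near=> t.
have t0 : 0 < t by near: t; exact: nbhs_right_gt.
rewrite fx0 subr0 -[_ *: _]/(_ * _) mulrCA pmulr_rgt0// invr_gt0.
Unshelve. all: by end_near. Qed.

Lemma defining_function_C1 D x rho : defining_function D x rho -> C1 rho.
Proof. by case=> /smooth_C1. Qed.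

(** If the normals [n1] and [n2] differ, then along [v = n2 - n1] the first
    defining function decreases and the second increases, so the points of the
    ray near [x] are both in [D] and outside [D]. *)
Lemma defining_function_normal_unique D x rho1 rho2 :
  defining_function D x rho1 -> defining_function D x rho2 ->
  normalize (grad rho1 x) = normalize (grad rho2 x).
Proof.
move=> d1 d2; apply/eqP; apply: contrapT => /negP.
have [C1 C2] := (defining_function_C1 d1, defining_function_C1 d2).
case: d1 => _ r1 g1 D1; case: d2 => _ r2 g2 D2.
set n1 := normalize _; set n2 := normalize _ => n12.
have n12_lt := unit_dot_lt1 (enorm_normalize g1) (enorm_normalize g2) n12.
(* Inner product with [n1] negative, with [n2] positive. *)
pose v := n2 - n1.
have gE rho : grad rho x != 0 -> grad rho x = enorm (grad rho x) *: normalize (grad rho x).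
  move=> g0; rewrite /normalize scalerA mulfV ?scale1r// gt_eqF//.
  exact: enorm_gt0.
have nn u : grad u x != 0 -> dot (normalize (grad u x)) (normalize (grad u x)) = 1.
  by move=> /enorm_normalize g; rewrite -sqr_enorm g expr1n.
have neg1 : 0 < -1 * 'D_v rho1 x.
  rewrite derive_grad// gE// dotZl -/n1 /v dotBr (nn _ g1) mulN1r oppr_gt0.
  by rewrite pmulr_rlt0 ?enorm_gt0// subr_lt0.
have pos2 : 0 < 1 * 'D_v rho2 x.
  rewrite derive_grad// gE// dotZl -/n2 /v dotBr (nn _ g2) mul1r.
  by rewrite pmulr_rgt0 ?enorm_gt0// subr_gt0 dotC.
have near_line (P : R * R -> Prop) : (\forall y \near x, P y) ->
    \forall t \near (0 : R)^'+, P (t *: v + x).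
  move=> Px; have c := @cvg_at_right_filter _ _ (fun t : R => t *: v + x) _ _ (@line_cvg x v).
  exact: (c _ Px).
have : \forall t \near (0 : R)^'+, False.
  near=> t.
  have h1 : 0 < -1 * rho1 (t *: v + x).
    by near: t; apply: derive_sign_right => //; exact: C1_derivable.
  have h2 : 0 < 1 * rho2 (t *: v + x).
    by near: t; apply: derive_sign_right => //; exact: C1_derivable.
  have e1 : D (t *: v + x) <-> rho1 (t *: v + x) < 0 by near: t; exact: (near_line _ D1).
  have e2 : D (t *: v + x) <-> rho2 (t *: v + x) < 0 by near: t; exact: (near_line _ D2).
  have /e1/e2 : rho1 (t *: v + x) < 0 by move: h1; lra.
  by move: h2; lra.
by move/filter_ex => [].
Unshelve. all: by end_near. Qed.

Lemma unit_normalE D x rho : defining_function D x rho ->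
  unit_normal D x = normalize (grad rho x).
Proof.
move=> d; rewrite /unit_normal; case: xgetP => [n -> [rho' d' ->]|/(_ (normalize (grad rho x)))[]].
  exact: defining_function_normal_unique d' d.
by exists rho.
Qed.

Lemma unit_normal0 D x : (forall rho, ~ defining_function D x rho) ->
  unit_normal D x = 0.
Proof.
by move=> nd; rewrite /unit_normal; case: xgetP => // n _ [rho /nd].
Qed.

Lemma enorm_unit_normal_le D x : enorm (unit_normal D x) <= 1.
Proof.
have [[rho d]|/forallNP nd] := pselect (exists rho, defining_function D x rho).
  by rewrite (unit_normalE d) enorm_normalize//; case: d.
by rewrite unit_normal0// /enorm /dot/= mulr0 addr0 sqrtr0.
Qed.

Lemma rmul_rconj a v : rmul a (rmul (rconj a) v) = dot a a *: v.
Proof. by rewrite /rmul /rconj /dot; congr pair; rewrite /= /GRing.scale/=; ring. Qed.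

Lemma enorm_rconj a : enorm (rconj a) = enorm a.
Proof. by rewrite /enorm /dot/= mulrNN. Qed.

Lemma rconj_neq0 a : a != 0 -> rconj a != 0.
Proof.
move=> a0; apply/eqP => ra; have := enorm_gt0 a0.
by rewrite -enorm_rconj ra /enorm /dot/= mulr0 addr0 sqrtr0 ltxx.
Qed.

Lemma rmulZ a v (c : R) : rmul a (c *: v) = c *: rmul a v.
Proof. by rewrite /rmul; congr pair; rewrite /= /GRing.scale/=; ring. Qed.

Lemma rmul_neq0 a v : a != 0 -> v != 0 -> rmul a v != 0.
Proof.
move=> a0 v0; apply/eqP => av; have : 0 < enorm (rmul a v).
  by rewrite enorm_rmul mulr_gt0// enorm_gt0.
by rewrite av /enorm /dot/= mulr0 addr0 sqrtr0 ltxx.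
Qed.

Lemma defining_function_sim a z D x rho : a != 0 ->
  defining_function D (sim a z x) rho ->
  defining_function (sim a z @^-1` D) x (rho \o sim a z).
Proof.
move=> a0 d; have C1r := defining_function_C1 d; case: d => sr r0 gr Dr; split.
- exact: smooth_sim.
- exact: r0.
- by rewrite grad_sim// rmul_neq0// rconj_neq0.
- exact: (@sim_continuous _ a z x _ Dr).
Qed.

(** A defining function of [D] composed with the similarity is a defining
    function of the preimage. Where there is none, both normals are the default
    value 0. *)
Lemma unit_normal_sim a z D x : a != 0 ->
  rmul a (unit_normal (sim a z @^-1` D) x) = enorm a *: unit_normal D (sim a z x).
Proof.
move=> a0.
have [[rho d]|/forallNP nd] :=
    pselect (exists rho, defining_function D (sim a z x) rho).
  rewrite (unit_normalE d) (unit_normalE (defining_function_sim a0 d)).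
  have C1r := defining_function_C1 d.
  rewrite grad_sim// /normalize rmulZ rmul_rconj !scalerA enorm_rmul enorm_rconj.
  congr (_ *: _); rewrite -sqr_enorm.
  have := enorm_gt0 a0; have : 0 < enorm (grad rho (sim a z x)).
    by apply: enorm_gt0; case: d.
  by move=> /gt_eqF g0 /gt_eqF a00; field; rewrite a00 g0.
rewrite !unit_normal0//.
  by rewrite scaler0 /rmul/= !mulr0 subr0 addr0.
move=> rho d; apply: (nd (rho \o simV a z)).
have := @defining_function_sim (cinv a) (- rmul (cinv a) z) (sim a z @^-1` D) (sim a z x) rho.
rewrite -/(simV a z) (sim_preimageK z D a0).
rewrite simK//; apply => //.
exact: cinv_neq0.
Qed.

Lemma normal_derivative_sim a z D h x : a != 0 -> C1 h ->
  normal_derivative (sim a z @^-1` D) (h \o sim a z) x =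
  enorm a * normal_derivative D h (sim a z x).
Proof.
move=> a0 C1h; rewrite /normal_derivative grad_sim// dot_rconj unit_normal_sim//.
by rewrite dotZr.
Qed.

(** Where the defining function is negative the point is interior, where it is
    positive the point is exterior. *)
Lemma frontier_defining_eq0 D x rho : (\forall y \near x, D y <-> rho y < 0) ->
  {for x, continuous rho} -> frontier D x -> rho x = 0.
Proof.
move=> Dr cr [cD iD]; apply/eqP; rewrite eq_le; apply/andP; split; rewrite leNgt; apply/negP => r0.
  have : \forall y \near x, ~ D y.
    near=> y; have yD : D y <-> rho y < 0 by near: y.
    have y0 : 0 < rho y by near: y; exact: (cvgr_gt _ cr).
    by move=> /yD; rewrite ltNge ltW.
  by move=> /cD[y []].
apply: iD; rewrite /interior/=.
near=> y; have yD : D y <-> rho y < 0 by near: y.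
by apply/yD; near: y; exact: (cvgr_lt _ cr).
Unshelve. all: by end_near. Qed.

Lemma enorm_continuous (T : topologicalType) (g : T -> R * R) (t : T) :
  {for t, continuous (fun s => (g s).1)} -> {for t, continuous (fun s => (g s).2)} ->
  {for t, continuous (fun s => enorm (g s))}.
Proof.
move=> c1 c2; rewrite /enorm /dot.
apply: (@continuous_comp _ _ _ (fun s => (g s).1 * (g s).1 + (g s).2 * (g s).2)).
  by apply: continuousD; apply: continuousM.
exact: sqrt_continuous.
Qed.

Definition smooth_boundary D :=
  forall x, frontier D x -> exists rho, defining_function D x rho.

(** A defining function at a boundary point is also one at all nearby boundary
    points, so the unit normal is there the normalized gradient of a single
    function. *)
Lemma normal_derivative_local D h x : smooth_boundary D -> C1 h -> frontier D x ->
  exists psi : R * R -> R, [/\ {for x, continuous psi},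
    psi x = normal_derivative D h x &
    \forall y \near x, frontier D y -> normal_derivative D h y = psi y].
Proof.
move=> sD C1h Dx; have [rho d] := sD x Dx.
have C1r := defining_function_C1 d.
pose psi y := dot (grad h y) (normalize (grad rho y)).
have psiE y : defining_function D y rho -> normal_derivative D h y = psi y.
  by move=> dy; rewrite /normal_derivative (unit_normalE dy).
have cg f : C1 f -> {for x, continuous (fun y => (grad f y).1)} /\
                    {for x, continuous (fun y => (grad f y).2)}.
  by move=> C1f; split; exact: C1_derive_continuous.
have [[h1 h2] [r1 r2]] := (cg _ C1h, cg _ C1r).
have ce := enorm_continuous r1 r2.
case: (d) => sr r0 gr Dr.
have e0 := enorm_gt0 gr.
exists psi; split; last 2 first.
- by rewrite psiE.
- have Drr := nbhs_interior Dr.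
  near=> y => Dy; apply: psiE.
  have yD : \forall z \near y, D z <-> rho z < 0 by near: y; exact: Drr.
  split => //.
    by apply: frontier_defining_eq0 yD _ Dy; exact: smooth_continuous.
  have : 0 < enorm (grad rho y) by near: y; exact: (cvgr_gt _ ce).
  by apply: contraTneq => ->; rewrite /enorm /dot/= mulr0 addr0 sqrtr0 ltxx.
have -> : psi = (fun y => (enorm (grad rho y))^-1 *
    ((grad h y).1 * (grad rho y).1 + (grad h y).2 * (grad rho y).2)).
  by apply/funext => y; rewrite /psi /normalize dotZr.
apply: (@continuousM _ _ (fun y => (enorm (grad rho y))^-1)
  (fun y => (grad h y).1 * (grad rho y).1 + (grad h y).2 * (grad rho y).2)).
  by apply: (@continuousV _ _ (fun y => enorm (grad rho y))); rewrite // gt_eqF.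
have m1 : {for x, continuous (fun y => (grad h y).1 * (grad rho y).1)}.
  exact: (@cvgM _ _ _ _ (fun y => (grad h y).1) (fun y => (grad rho y).1) _ _ h1 r1).
have m2 : {for x, continuous (fun y => (grad h y).2 * (grad rho y).2)}.
  exact: (@cvgM _ _ _ _ (fun y => (grad h y).2) (fun y => (grad rho y).2) _ _ h2 r2).
exact: cvgD m1 m2.
Unshelve. all: by end_near. Qed.

(** The normal derivative is continuous along the boundary, so it pulls closed
    sets back to closed sets. *)
Lemma normal_derivative_measurable D h : smooth_boundary D -> C1 h ->
  measurable_fun (frontier D : set (caratheodory_type (@outer_arclength R)))
    (normal_derivative D h).
Proof.
move=> sD C1h; apply: arclength_measurable_fun; first exact: frontier_closed.
move=> K cK x Kx.
have Dx : frontier D x.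
  by apply: frontier_closed => B /Kx[y [[Dy _] By]]; exists y.
split=> //; have [psi [cpsi psix near_psi]] := normal_derivative_local sD C1h Dx.
apply: cK => B; rewrite -psix => /cpsi pB.
have [y [[Dy Ky] [py By]]] := Kx _ (filterI near_psi pB).
by exists (psi y); split => //; rewrite -py.
Qed.

Lemma normal_derivative_bound D h x :
  `|normal_derivative D h x| <= enorm (grad h x).
Proof.
rewrite /normal_derivative; have n1 := enorm_unit_normal_le D x.
have h0 := enorm_ge0 (grad h x).
have le1 u : enorm u <= 1 -> dot (grad h x) u <= enorm (grad h x).
  move=> u1; apply: le_trans (dot_le_enorm _ _) _.
  by rewrite ler_piMr.
rewrite ler_norml le1// andbT lerNl -mulN1r -dotZr scaleN1r; apply: le1.
by rewrite enormN.
Qed.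

End unit_normal.

(** * Boundary function spaces of similar domains *)

Section transport_boundary.
Context {R : realType}.
Implicit Types (a z : (R * R)%type) (D : set (R * R)) (f h : R * R -> R)
  (g : @functional R).

Lemma comp_simK a z (T : Type) (f : R * R -> T) : a != 0 ->
  (f \o sim a z) \o simV a z = f.
Proof. by move=> a0; apply/funext => x /=; rewrite simVK. Qed.

Lemma comp_simVK a z (T : Type) (f : R * R -> T) : a != 0 ->
  (f \o simV a z) \o sim a z = f.
Proof. by move=> a0; apply/funext => x /=; rewrite simK. Qed.

Lemma eq_boundary_sim a z D f h : a != 0 -> eq_boundary D f h ->
  eq_boundary (sim a z @^-1` D) (f \o sim a z) (h \o sim a z).
Proof.
move=> a0 fh; rewrite /eq_boundary frontier_sim//.
exact: (iso_ae (arclength_iso z a0) fh).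
Qed.

Lemma boundary_integral_sim a z D (F : R * R -> \bar R) : a != 0 ->
  (\int[arclength]_(x in frontier (sim a z @^-1` D)) F (sim a z x) =
   (enorm a)^-1%:E * \int[arclength]_(x in frontier D) F x)%E.
Proof.
by move=> a0; rewrite frontier_sim//; exact: (integral_iso (arclength_iso z a0)).
Qed.

(** The kernel 1/|x - y|^2 contributes the square of the factor |a| and each of
    the two integrals its inverse. *)
Lemma gagliardo2_sim a z D f : a != 0 ->
  gagliardo2 (sim a z @^-1` D) (f \o sim a z) = gagliardo2 D f.
Proof.
move=> a0; have c0 := enorm_gt0 a0.
rewrite /gagliardo2.
pose F (x y : R * R) := ((f x - f y) ^+ 2 / enorm (x - y) ^+ 2)%:E.
have E x y : (((f \o sim a z) x - (f \o sim a z) y) ^+ 2 / enorm (x - y) ^+ 2)%:E =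
    ((enorm a ^+ 2)%:E * F (sim a z x) (sim a z y))%E.
  rewrite /F sim_sub enorm_rmul -EFinM; congr EFin.
  by rewrite exprMn (invfM (enorm a ^+ 2)) [RHS]mulrCA mulVKf// sqrf_eq0 gt_eqF.
transitivity (\int[arclength]_(x in frontier (sim a z @^-1` D))
    ((enorm a)%:E * \int[arclength]_(y in frontier D) F (sim a z x) y))%E.
  apply: eq_integral => x _.
  under eq_integral do rewrite E.
  rewrite ge0_integralZl_nonmeas ?exprn_gt0// boundary_integral_sim//.
  rewrite muleA -EFinM; congr (_%:E * _)%E; field.
  by rewrite gt_eqF.
rewrite ge0_integralZl_nonmeas//.
rewrite (boundary_integral_sim z D (fun x => \int[arclength]_(y in frontier D) F x y)%E)//.
by rewrite muleA -EFinM mulfV ?gt_eqF// mul1e.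
Qed.

Lemma square_integrable_boundary_sim a z D f : a != 0 ->
  square_integrable arclength (frontier D) f ->
  square_integrable arclength (frontier (sim a z @^-1` D)) (f \o sim a z).
Proof.
move=> a0 f2; rewrite frontier_sim//.
exact: (iso_square_integrable (arclength_iso z a0)).
Qed.

Lemma Hhalf_sim a z D f : a != 0 -> Hhalf D f -> Hhalf (sim a z @^-1` D) (f \o sim a z).
Proof.
move=> a0 [f2 gf]; split; first exact: square_integrable_boundary_sim.
by rewrite gagliardo2_sim.
Qed.

Lemma Hhalf_simP a z D f : a != 0 ->
  Hhalf (sim a z @^-1` D) (f \o sim a z) <-> Hhalf D f.
Proof.
move=> a0; split; last exact: Hhalf_sim.
move=> /(@Hhalf_sim (cinv a) (- rmul (cinv a) z) _ _ (cinv_neq0 a0)).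
by rewrite -/(simV a z) (comp_simK z f a0) (sim_preimageK z D a0).
Qed.

Lemma Hhalf0_sim a z D f : a != 0 -> Hhalf0 D f ->
  Hhalf0 (sim a z @^-1` D) (f \o sim a z).
Proof.
move=> a0 [Hf f0]; split; first exact: Hhalf_sim.
rewrite frontier_sim// (Rintegral_iso (arclength_iso z a0)).
by rewrite f0 mulr0.
Qed.

Lemma gagliardo2_ge0 D f : (0 <= gagliardo2 D f)%E.
Proof.
apply: integral_ge0 => x _; apply: integral_ge0 => y _.
by rewrite lee_fin divr_ge0// sqr_ge0.
Qed.

(** The seminorm is invariant and the square of the L2 norm is divided by
    [|a|]. *)
Lemma Hhalf_norm_sim_le a z D f : a != 0 -> Hhalf D f ->
  Hhalf_norm (sim a z @^-1` D) (f \o sim a z) <=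
  Num.sqrt (1 + (enorm a)^-1) * Hhalf_norm D f.
Proof.
move=> a0 [[_ f2] gf]; have c0 := enorm_gt0 a0.
have ci0 : 0 < (enorm a)^-1 by rewrite invr_gt0.
rewrite -sqrtrM; last by rewrite addr_ge0// ltW.
apply: ler_wsqrtr; rewrite gagliardo2_sim//.
rewrite (boundary_integral_sim z D (fun x => (f x ^+ 2)%:E))//.
have I0 : (0 <= \int[arclength]_(x in frontier D) (f x ^+ 2)%:E)%E.
  by apply: integral_ge0 => x _; rewrite lee_fin sqr_ge0.
have G0 := gagliardo2_ge0 D f.
move: I0 G0 f2 gf; move: (integral _ _ _) (gagliardo2 _ _) => [I| |]// [G| |]//.
rewrite !lee_fin => I0 G0 _ _.
change ((enorm a)^-1 * I + G <= (1 + (enorm a)^-1) * (I + G)).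
rewrite -subr_ge0 (_ : _ - _ = I + (enorm a)^-1 * G); last by ring.
by rewrite addr_ge0// mulr_ge0// ltW.
Qed.

(** The transport of a functional from the boundary of the preimage to that of
    the domain. *)
Definition push a z g : functional := fun f => g (f \o sim a z).

Lemma push_Hmhalf a z D g : a != 0 -> Hmhalf (sim a z @^-1` D) g ->
  Hmhalf D (push a z g).
Proof.
move=> a0 [g0 glin [C gC]]; split.
- by move=> f Hf; apply: g0; apply: contra_not Hf => /Hhalf_simP; exact.
- move=> s f h Hf Hh; exact: (glin s _ _ (Hhalf_sim z a0 Hf) (Hhalf_sim z a0 Hh)).
- exists (`|C| * Num.sqrt (1 + (enorm a)^-1)) => f Hf.
  apply: le_trans (gC _ (Hhalf_sim z a0 Hf)) _.
  rewrite -mulrA; apply: le_trans (ler_wpM2r (sqrtr_ge0 _) (ler_norm C)) _.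
  by rewrite ler_wpM2l// Hhalf_norm_sim_le.
Qed.

Lemma push_Hmhalf0 a z D g : a != 0 -> Hmhalf0 (sim a z @^-1` D) g ->
  Hmhalf0 D (push a z g).
Proof. by move=> a0 [Hg g1]; split; [exact: push_Hmhalf|exact: g1]. Qed.

Definition pull a z g : functional := fun f => g (f \o simV a z).

Lemma pushK a z g : a != 0 -> pull a z (push a z g) = g.
Proof. by move=> a0; apply/funext => f; rewrite /pull /push (comp_simVK z f a0). Qed.

Lemma pullK a z g : a != 0 -> push a z (pull a z g) = g.
Proof. by move=> a0; apply/funext => f; rewrite /pull /push (comp_simK z f a0). Qed.

Lemma pull_Hmhalf0 a z D g : a != 0 -> Hmhalf0 D g ->
  Hmhalf0 (sim a z @^-1` D) (pull a z g).
Proof.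
move=> a0 Hg; apply: (push_Hmhalf0 (cinv_neq0 a0)).
by rewrite -/(simV a z) (sim_preimageK z D a0).
Qed.

Lemma push_Hmhalf0P a z D g : a != 0 ->
  Hmhalf0 D (push a z g) -> Hmhalf0 (sim a z @^-1` D) g.
Proof. by move=> a0 /(pull_Hmhalf0 z a0); rewrite pushK. Qed.

End transport_boundary.

(** * The Neumann problem in similar domains *)

Section transport_interior.
Context {R : realType}.
Implicit Types (a z : (R * R)%type) (D : set (R * R)) (f h v w gamma : R * R -> R)
  (G H : R * R -> R * R) (g : @functional R).

Definition pull_grad a z G : R * R -> R * R := fun x => rmul (rconj a) (G (sim a z x)).

Lemma rmul_rconj1 a (w : R * R) : (rmul (rconj a) w).1 = a.1 * w.1 + a.2 * w.2.
Proof. by rewrite /rmul /rconj/=; ring. Qed.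

Lemma rmul_rconj2 a (w : R * R) : (rmul (rconj a) w).2 = - a.2 * w.1 + a.1 * w.2.
Proof. by []. Qed.

Lemma sim_preimage_measurable a z D : a != 0 ->
  measurable (D : set (measurableTypeR R * measurableTypeR R)) ->
  measurable (sim a z @^-1` D : set (measurableTypeR R * measurableTypeR R)).
Proof. by move=> a0; exact: (iso_preimage_measurable (lebesgue2_iso z a0)). Qed.

Lemma test_function_sim a z D phi : a != 0 -> test_function D phi ->
  test_function (sim a z @^-1` D) (phi \o sim a z).
Proof.
move=> a0 [sphi [K [cK KD phi0]]]; split; first exact: smooth_sim.
exists (sim a z @^-1` K); split.
- rewrite (_ : sim a z @^-1` K = simV a z @` K).
    apply: continuous_compact => //; apply: continuous_subspaceT.
    exact: sim_continuous.
  apply/seteqP; split => [x Kx|_ [x Kx <-]]; last by rewrite /= simVK.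
  by exists (sim a z x) => //; rewrite simK.
- by move=> x /KD.
- by move=> x /phi0.
Qed.

(** Test functions are carried by the inverse similarity, and the derivative
    along [e] becomes the derivative along [rmul a e]. *)
Lemma weak_gradient_sim a z D v G : a != 0 -> weak_gradient D v G ->
  weak_gradient (sim a z @^-1` D) (v \o sim a z) (pull_grad a z G).
Proof.
move=> a0 vG phi e phi_test; have iso := lebesgue2_iso z a0.
pose psi := phi \o simV a z.
have phiE : phi = psi \o sim a z by rewrite /psi (comp_simVK z phi a0).
have psi_test : test_function D psi.
  have := @test_function_sim (cinv a) (- rmul (cinv a) z) _ phi (cinv_neq0 a0) phi_test.
  by rewrite -/(simV a z) (sim_preimageK z D a0).
have := vG psi (rmul a e) psi_test.
move=> /(congr1 ( *%R (dot a a)^-1)); rewrite mulrN.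
rewrite -!(Rintegral_iso iso) => E.
transitivity (\int[lebesgue2]_(x in sim a z @^-1` D)
    (v (sim a z x) * 'D_(rmul a e) psi (sim a z x))).
  by apply: eq_Rintegral => x _; rewrite phiE derive_sim_at.
rewrite E; congr (- _); apply: eq_Rintegral => x _.
by rewrite phiE /pull_grad dot_rconj.
Qed.

Lemma sobolev1_sim a z D v G : a != 0 ->
  measurable (D : set (measurableTypeR R * measurableTypeR R)) ->
  sobolev1 D v G -> sobolev1 (sim a z @^-1` D) (v \o sim a z) (pull_grad a z G).
Proof.
move=> a0 mD [v2 G1 G2 vG]; have iso := lebesgue2_iso z a0.
have mD' := sim_preimage_measurable z a0 mD.
have {}G1 := iso_square_integrable iso G1.
have {}G2 := iso_square_integrable iso G2.
split; last exact: weak_gradient_sim.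
- exact: (iso_square_integrable iso v2).
- rewrite (_ : (fun x => _) = (fun x =>
    a.1 * (G (sim a z x)).1 + a.2 * (G (sim a z x)).2)); last first.
    by apply/funext => x; rewrite rmul_rconj1.
  exact: (square_integrable_lin mD' a.1 a.2 G1 G2).
- exact: (square_integrable_lin mD' (- a.2) a.1 G1 G2).
Qed.

Lemma C1_grad1_measurable f : C1 f ->
  measurable_fun (setT : set (measurableTypeR R * measurableTypeR R))
    (fun x => (grad f x).1).
Proof. by move=> C1f; apply: continuous_plane_measurable; exact: C1_derive_continuous. Qed.

Lemma C1_grad2_measurable f : C1 f ->
  measurable_fun (setT : set (measurableTypeR R * measurableTypeR R))
    (fun x => (grad f x).2).
Proof. by move=> C1f; apply: continuous_plane_measurable; exact: C1_derive_continuous. Qed.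

(** The approximating functions are composed with the similarity; their
    gradients are linear combinations of the old components, and so converge in
    L2. *)
Lemma is_trace_sim a z D v G f : a != 0 ->
  measurable (D : set (measurableTypeR R * measurableTypeR R)) ->
  sobolev1 D v G -> is_trace D v G f ->
  is_trace (sim a z @^-1` D) (v \o sim a z) (pull_grad a z G) (f \o sim a z).
Proof.
move=> a0 mD [_ [mG1 _] [mG2 _] _] [f2 [w [sw wv w1 w2 wf]]].
have iso := lebesgue2_iso z a0.
have mD' := sim_preimage_measurable z a0 mD.
split; first exact: square_integrable_boundary_sim.
have gw k x : grad (w k \o sim a z) x = rmul (rconj a) (grad (w k) (sim a z x)).
  by apply: grad_sim; exact: smooth_C1.
have md1 k : measurable_fun (D : set (measurableTypeR R * measurableTypeR R))
    (fun x => (grad (w k) x).1 - (G x).1).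
  apply: measurable_funB => //.
  by apply: measurable_funTS; apply: C1_grad1_measurable; exact: smooth_C1.
have md2 k : measurable_fun (D : set (measurableTypeR R * measurableTypeR R))
    (fun x => (grad (w k) x).2 - (G x).2).
  apply: measurable_funB => //.
  by apply: measurable_funTS; apply: C1_grad2_measurable; exact: smooth_C1.
have {}md1 k := iso_measurable_fun iso (md1 k).
have {}md2 k := iso_measurable_fun iso (md2 k).
have {}w1 := iso_cvg_L2 iso w1.
have {}w2 := iso_cvg_L2 iso w2.
exists (fun k => w k \o sim a z); split.
- by move=> k; exact: smooth_sim.
- exact: (iso_cvg_L2 iso wv).
- have := cvg_L2_lin mD' a.1 a.2 md1 md2 w1 w2.
  rewrite (_ : (fun k x => (grad (w k \o sim a z) x).1) = (fun k x =>
    a.1 * (grad (w k) (sim a z x)).1 + a.2 * (grad (w k) (sim a z x)).2)); last first.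
    by apply/funext => k; apply/funext => x; rewrite gw rmul_rconj1.
  rewrite (_ : (fun x => (pull_grad a z G x).1) = (fun x =>
    a.1 * (G (sim a z x)).1 + a.2 * (G (sim a z x)).2)) //.
  by apply/funext => x; rewrite /pull_grad rmul_rconj1.
- have := cvg_L2_lin mD' (- a.2) a.1 md1 md2 w1 w2.
  rewrite (_ : (fun k x => (grad (w k \o sim a z) x).2) = (fun k x =>
    - a.2 * (grad (w k) (sim a z x)).1 + a.1 * (grad (w k) (sim a z x)).2)) //.
  by apply/funext => k; apply/funext => x; rewrite gw rmul_rconj2.
- by rewrite frontier_sim//; exact: (iso_cvg_L2 (arclength_iso z a0) wf).
Qed.

Lemma rconj_cinv a (w : R * R) : rmul (rconj (cinv a)) w = (dot a a)^-1 *: rmul a w.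
Proof.
rewrite /rmul /rconj /cinv/=; congr pair; rewrite /= /GRing.scale/=; ring.
Qed.

(** Each of the two gradients contributes a factor [|a|], and the measure its
    inverse square. *)
Lemma is_NtD_sim a z D gamma g f : a != 0 -> open D ->
  is_NtD gamma D (push a z g) f ->
  is_NtD (gamma \o sim a z) (sim a z @^-1` D) g (f \o sim a z).
Proof.
move=> a0 oD [Hf [v [G [vG vf weak]]]]; split; first exact: Hhalf0_sim.
have mD := open_plane_measurable oD; have iso := lebesgue2_iso z a0.
have mD' := sim_preimage_measurable z a0 mD.
exists (v \o sim a z), (pull_grad a z G); split.
- exact: sobolev1_sim.
- exact: is_trace_sim vG vf.
move=> w H h wH wh.
(* The test function is carried by the inverse similarity. *)
pose H' := pull_grad (cinv a) (- rmul (cinv a) z) H.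
have wH' : sobolev1 D (w \o simV a z) H'.
  have := @sobolev1_sim (cinv a) (- rmul (cinv a) z) _ w H (cinv_neq0 a0) mD' wH.
  by rewrite -/(simV a z) (sim_preimageK z D a0).
have wh' : is_trace D (w \o simV a z) H' (h \o simV a z).
  have := @is_trace_sim (cinv a) (- rmul (cinv a) z) _ w H h (cinv_neq0 a0) mD' wH wh.
  by rewrite -/(simV a z) (sim_preimageK z D a0).
have := weak _ _ _ wH' wh'; rewrite /push (comp_simVK z h a0) => <-.
have := Rintegral_iso_scale iso D (fun y => gamma y * dot (G y) (H' y)) (dot_gt0 a0).
rewrite mulfV ?dot_neq0// mul1r => <-.
apply: eq_Rintegral => x _.
rewrite /pull_grad dot_rconj /H' /pull_grad -/(simV a z) simK// rconj_cinv dotZr.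
by rewrite /= [RHS]mulrCA; congr (_ * _); rewrite mulVKf// dot_neq0.
Qed.

End transport_interior.

(** * The Neumann-to-Dirichlet map and its inverse *)

Lemma ae_mono d (T : measurableType d) (R : realType)
    (mu : {measure set T -> \bar R}) (P Q : T -> Prop) :
  (forall x, P x -> Q x) -> {ae mu, forall x, P x} -> {ae mu, forall x, Q x}.
Proof. by move=> PQ; apply: filterS. Qed.

Lemma ae_mono2 d (T : measurableType d) (R : realType)
    (mu : {measure set T -> \bar R}) (P Q S : T -> Prop) :
  (forall x, P x -> Q x -> S x) ->
  {ae mu, forall x, P x} -> {ae mu, forall x, Q x} -> {ae mu, forall x, S x}.
Proof. by move=> PQS; apply: filterS2. Qed.

Section operators.
Context {R : realType}.
Implicit Types (D : set (R * R)) (f h gamma : R * R -> R) (g : @functional R).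

Lemma eq_boundary_refl D f : eq_boundary D f f.
Proof. by apply: aeW. Qed.

Lemma eq_boundary_sym D f h : eq_boundary D f h -> eq_boundary D h f.
Proof. by apply: ae_mono => x fh Dx; rewrite fh. Qed.

Lemma eq_boundary_trans D f1 f2 f3 :
  eq_boundary D f1 f2 -> eq_boundary D f2 f3 -> eq_boundary D f1 f3.
Proof. by apply: ae_mono2 => x f12 f23 Dx; rewrite f12// f23. Qed.

Lemma eq_boundary_lin D f1 f2 h1 h2 (s t : R) :
  eq_boundary D f1 f2 -> eq_boundary D h1 h2 ->
  eq_boundary D (fun x => s * f1 x + t * h1 x) (fun x => s * f2 x + t * h2 x).
Proof. by apply: ae_mono2 => x f12 h12 Dx; rewrite f12// h12. Qed.

Lemma eq_boundary_sub D f1 f2 h1 h2 : eq_boundary D f1 f2 -> eq_boundary D h1 h2 ->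
  eq_boundary D (fun x => f1 x - h1 x) (fun x => f2 x - h2 x).
Proof. by apply: ae_mono2 => x f12 h12 Dx; rewrite f12// h12. Qed.

Lemma Hmhalf0_zero D : Hmhalf0 D (fun=> 0 : R).
Proof.
split => //; split => //.
- by move=> *; rewrite mulr0 addr0.
- by exists 0 => f _; rewrite normr0 mul0r.
Qed.


Lemma NtD_spec D gamma g : NtD_well_posed gamma D -> Hmhalf0 D g ->
  is_NtD gamma D g (NtD gamma D g).
Proof.
move=> wp /wp[f fg _]; rewrite /NtD.
by case: xgetP => [h -> //|/(_ f)].
Qed.

Lemma NtD_unique D gamma g f1 f2 : NtD_well_posed gamma D -> Hmhalf0 D g ->
  is_NtD gamma D g f1 -> is_NtD gamma D g f2 -> eq_boundary D f1 f2.
Proof.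
move=> wp /wp[f _ fu] /fu f1f /fu /eq_boundary_sym; exact: eq_boundary_trans.
Qed.

Definition NtD1_bijective D := forall f, Hhalf0 D f ->
  exists! g, Hmhalf0 D g /\ eq_boundary D (NtD (fun=> 1) D g) f.

(** Uniqueness of the preimage of [NtD g1], which lies in the trace space
    because [g1] is an admissible datum; [f] itself may be any function. *)
Lemma NtD1_injective D f g1 g2 : NtD_well_posed (fun=> 1) D -> NtD1_bijective D ->
  Hmhalf0 D g1 -> eq_boundary D (NtD (fun=> 1) D g1) f ->
  Hmhalf0 D g2 -> eq_boundary D (NtD (fun=> 1) D g2) f -> g1 = g2.
Proof.
move=> wp bij Hg1 g1f Hg2 g2f.
have [Hh _] := NtD_spec wp Hg1.
have [g [_ gu]] := bij _ Hh.
rewrite -(gu g1); last by split => //; exact: eq_boundary_refl.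
apply: gu; split => //; apply: eq_boundary_trans g2f _; exact: eq_boundary_sym.
Qed.

Lemma NtD1_inv_eq D f g : NtD_well_posed (fun=> 1) D -> NtD1_bijective D ->
  Hmhalf0 D g -> eq_boundary D (NtD (fun=> 1) D g) f -> NtD1_inv D f = g.
Proof.
move=> wp bij Hg gf; rewrite /NtD1_inv.
case: xgetP => [g' -> [Hg' g'f]|/(_ g)[]//].
exact: (NtD1_injective wp bij Hg' g'f Hg gf).
Qed.

Lemma NtD1_inv_none D f :
  (forall g, Hmhalf0 D g -> ~ eq_boundary D (NtD (fun=> 1) D g) f) ->
  NtD1_inv D f = (fun=> 0).
Proof.
by move=> none; rewrite /NtD1_inv; case: xgetP => // g _ [Hg /none]; case.
Qed.

Lemma NtD1_inv_Hmhalf0 D f : Hmhalf0 D (NtD1_inv D f).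
Proof.
by rewrite /NtD1_inv; case: xgetP => [g _ []//|_]; exact: Hmhalf0_zero.
Qed.

Lemma T_op_Hmhalf0 D gamma g : Hmhalf0 D (T_op gamma D g).
Proof. exact: NtD1_inv_Hmhalf0. Qed.

Lemma well_posed_NtD1 D gamma : well_posed gamma D -> NtD_well_posed (fun=> 1) D.
Proof. by case=> -[]. Qed.

Lemma well_posed_NtD D gamma : well_posed gamma D -> NtD_well_posed gamma D.
Proof. by case=> -[]. Qed.

Lemma well_posed_bijective D gamma : well_posed gamma D -> NtD1_bijective D.
Proof. by case. Qed.

Lemma A_inv_eq D gamma g phi : well_posed gamma D -> Hmhalf0 D g ->
  Hmhalf0 D phi -> A_op gamma D phi = g -> A_inv gamma D g = phi.
Proof.
move=> [_ _ _ Abij _] Hg Hphi Aphi; have [psi [_ psiu]] := Abij _ Hg.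
apply: xget_unique => [|y [Hy Ay]]; first by split.
exact: (etrans (esym (psiu y (conj Hy Ay))) (psiu phi (conj Hphi Aphi))).
Qed.

Lemma A_inv_spec D gamma g : well_posed gamma D -> Hmhalf0 D g ->
  Hmhalf0 D (A_inv gamma D g) /\ A_op gamma D (A_inv gamma D g) = g.
Proof.
move=> wp Hg; have [_ _ _ Abij _] := wp; have [psi [[Hpsi Apsi] _]] := Abij _ Hg.
by rewrite (A_inv_eq wp Hg Hpsi Apsi).
Qed.

Section transport.
Variables (a z : R * R) (D : set (R * R)) (gamma : R * R -> R).
Hypotheses (a0 : a != 0) (oD : open D).
Let B := sim a z @^-1` D.
Let sigma := gamma \o sim a z.

Lemma NtD_push g : NtD_well_posed gamma D -> NtD_well_posed sigma B ->
  Hmhalf0 B g ->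
  eq_boundary B (NtD gamma D (push a z g) \o sim a z) (NtD sigma B g).
Proof.
move=> wpD wpB Hg.
have fD := is_NtD_sim a0 oD (NtD_spec wpD (push_Hmhalf0 a0 Hg)).
exact: (NtD_unique wpB Hg fD (NtD_spec wpB Hg)).
Qed.

Hypotheses (wpD1 : NtD_well_posed (fun=> 1) D) (wpB1 : NtD_well_posed (fun=> 1) B).
Hypotheses (bijD : NtD1_bijective D) (bijB : NtD1_bijective B).

Let NtD1_push g : Hmhalf0 B g ->
  eq_boundary B (NtD (fun=> 1) D (push a z g) \o sim a z) (NtD (fun=> 1) B g).
Proof.
move=> Hg; have fD := is_NtD_sim a0 oD (NtD_spec wpD1 (push_Hmhalf0 a0 Hg)).
exact: (NtD_unique wpB1 Hg fD (NtD_spec wpB1 Hg)).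
Qed.

Lemma eq_boundary_simP f h : eq_boundary B (f \o sim a z) (h \o sim a z) ->
  eq_boundary D f h.
Proof.
have := @eq_boundary_sim _ (cinv a) (- rmul (cinv a) z) B (f \o sim a z) (h \o sim a z)
  (cinv_neq0 a0).
by rewrite -/(simV a z) (comp_simK z f a0) (comp_simK z h a0) (sim_preimageK z D a0).
Qed.

(** If [f] is not in the range of the Neumann-to-Dirichlet map then both sides
    are the default value 0, and otherwise the two preimages correspond by
    injectivity. *)
Lemma NtD1_inv_push f f0 : eq_boundary B (f \o sim a z) f0 ->
  NtD1_inv D f = push a z (NtD1_inv B f0).
Proof.
move=> ff0.
have [[g [Hg gf]]|none] := pselect (exists g, Hmhalf0 B g /\
    eq_boundary B (NtD (fun=> 1) B g) f0).
  rewrite (NtD1_inv_eq wpB1 bijB Hg gf).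
  apply: (NtD1_inv_eq wpD1 bijD); first exact: push_Hmhalf0.
  apply: eq_boundary_simP; apply: eq_boundary_trans (NtD1_push Hg) _.
  by apply: eq_boundary_trans gf _; exact: eq_boundary_sym.
have -> : NtD1_inv B f0 = (fun=> 0).
  by apply: NtD1_inv_none => g Hg gf; apply: none; exists g.
apply: NtD1_inv_none => g Hg gf; apply: none; exists (pull a z g).
have Hpg := pull_Hmhalf0 z a0 Hg; split; first exact: Hpg.
have := NtD1_push Hpg; rewrite (pullK z g a0) => /eq_boundary_sym e1.
apply: eq_boundary_trans e1 _.
exact: eq_boundary_trans (eq_boundary_sim z a0 gf) ff0.
Qed.

Hypotheses (wpD : NtD_well_posed gamma D) (wpB : NtD_well_posed sigma B).

Lemma T_op_push g : Hmhalf0 B g ->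
  T_op gamma D (push a z g) = push a z (T_op sigma B g).
Proof.
move=> Hg; apply: NtD1_inv_push.
exact: eq_boundary_sub (NtD1_push Hg) (NtD_push wpD wpB Hg).
Qed.

End transport.

End operators.

(** * Polarization tensors of similar domains *)

Section transport_cgpt.
Context {R : realType}.
Implicit Types (a z : (R * R)%type) (D : set (R * R)) (f h k gamma : R * R -> R)
  (g phi : @functional R).

(** This special case of linearity holds on boundaries of any length, as it
    needs no measurability of the inner integral. *)
Lemma Hhalf_scale D f (s : R) : 0 < s -> Hhalf D f -> Hhalf D (fun x => s * f x).
Proof.
move=> s0 [[mf f2] gf]; have s20 : 0 < s ^+ 2 by rewrite exprn_gt0.
split; first split.
- by apply: measurable_funM => //; exact: measurable_cst.
- under eq_integral do rewrite exprMn EFinM.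
  by rewrite ge0_integralZl_nonmeas// lte_mul_pinfty// lee_fin ltW.
- rewrite (_ : gagliardo2 D _ = (s ^+ 2)%:E * gagliardo2 D f)%E.
    by rewrite lte_mul_pinfty ?gagliardo2_ge0// lee_fin ltW.
  rewrite /gagliardo2 -ge0_integralZl_nonmeas//; apply: eq_integral => x _.
  rewrite -ge0_integralZl_nonmeas//; apply: eq_integral => y _.
  by rewrite -EFinM; congr EFin; rewrite -mulrBr exprMn -[LHS]mulrA.
Qed.

Lemma Hmhalf_homogeneous D g (s : R) f : 0 < s -> Hmhalf D g ->
  g (fun x => s * f x) = s * g f.
Proof.
move=> s0 [g0 glin _].
have [Hf|nHf] := pselect (Hhalf D f).
  (* [s f = (s - 1) f + f] *)
  have := glin (s - 1) f f Hf Hf.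
  rewrite (_ : (fun x => _) = (fun x => s * f x)); last by apply/funext => x; ring.
  by move=> ->; ring.
rewrite (g0 _ nHf) mulr0; apply: g0; apply: contra_not nHf => Hsf.
have si0 : 0 < s^-1 by rewrite invr_gt0.
have := Hhalf_scale si0 Hsf.
rewrite (_ : (fun x => s^-1 * (s * f x)) = f)//.
by apply/funext => x; rewrite mulKf// gt_eqF.
Qed.

Section transport.
Variables (a z : R * R) (D : set (R * R)).
Hypotheses (a0 : a != 0) (oD : open D).
Let B := sim a z @^-1` D.
Let c0 : 0 < enorm a. Proof. exact: enorm_gt0. Qed.

(** The factor [enorm a] compensates the scaling of arc length. *)
Lemma of_fun_push k kB : (forall x, kB x = enorm a * k (sim a z x)) ->
  of_fun D k = push a z (of_fun B kB).
Proof.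
move=> kE; apply/funext => f; rewrite /push /of_fun.
have -> : `[< Hhalf B (f \o sim a z) >] = `[< Hhalf D f >].
  exact: asbool_equiv_eq (Hhalf_simP z D f a0).
case: ifPn => // _; rewrite /B frontier_sim//.
have := Rintegral_iso_scale (arclength_iso z a0) (frontier D) (fun x => k x * f x) c0.
rewrite mulfV ?gt_eqF// mul1r => <-.
by apply: eq_Rintegral => x _; rewrite kE mulrA.
Qed.

(** The kernel of K^* is homogeneous of degree -1. *)
Lemma Kstar_fun_push g x : Hmhalf B g ->
  Kstar_fun B g x = enorm a * Kstar_fun D (push a z g) (sim a z x).
Proof.
move=> Hg; rewrite /Kstar_fun mulrCA; congr (_ * _).
rewrite /push -(Hmhalf_homogeneous _ c0 Hg); congr (g _); apply/funext => y /=.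
have nE : unit_normal D (sim a z x) = (enorm a)^-1 *: rmul a (unit_normal B x).
  by rewrite unit_normal_sim// scalerA mulVf ?scale1r// gt_eqF.
rewrite nE sim_sub dotZr dot_rmul enorm_rmul -sqr_enorm.
rewrite exprMn (invfM (enorm a ^+ 2)).
move: (dot _ _) ((enorm (x - y) ^+ 2)^-1) => s t; field.
by rewrite gt_eqF.
Qed.

Lemma Kstar_push g : Hmhalf B g -> Kstar D (push a z g) = push a z (Kstar B g).
Proof.
by move=> Hg; apply: of_fun_push => x; exact: Kstar_fun_push.
Qed.

Lemma of_fun_normal_derivative_push h : C1 h ->
  of_fun D (normal_derivative D h) =
  push a z (of_fun B (normal_derivative B (h \o sim a z))).
Proof. by move=> C1h; apply: of_fun_push => x; exact: normal_derivative_sim. Qed.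

Variable gamma : R * R -> R.
Let sigma := gamma \o sim a z.
Hypotheses (wpD : well_posed gamma D) (wpB : well_posed sigma B).

Lemma well_posed_T_op_push g : Hmhalf0 B g ->
  T_op gamma D (push a z g) = push a z (T_op sigma B g).
Proof.
apply: (T_op_push a0 oD).
- exact: well_posed_NtD1 wpD.
- exact: well_posed_NtD1 wpB.
- exact: well_posed_bijective wpD.
- exact: well_posed_bijective wpB.
- exact: well_posed_NtD wpD.
- exact: well_posed_NtD wpB.
Qed.

Lemma A_op_push g : Hmhalf0 B g ->
  A_op gamma D (push a z g) = push a z (A_op sigma B g).
Proof.
move=> Hg; have HT := T_op_Hmhalf0 B sigma g.
rewrite /A_op (well_posed_T_op_push Hg).
by have [HT' _] := HT; rewrite (Kstar_push HT').
Qed.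

Lemma A_inv_push g : Hmhalf0 B g ->
  A_inv gamma D (push a z g) = push a z (A_inv sigma B g).
Proof.
move=> Hg; have [HA AA] := A_inv_spec wpB Hg.
apply: (A_inv_eq wpD).
- exact: (push_Hmhalf0 a0 Hg).
- exact: (push_Hmhalf0 a0 HA).
- by rewrite (A_op_push HA) AA.
Qed.

(** The composite with the similarity takes the place of the harmonic
    polynomials, on both sides of the form. *)
Lemma cgpt_sim (p q : parity) (m n : nat) : C1 (@Defs.harmonic R q n) ->
  (0 < n)%N ->
  let qn := of_fun B (normal_derivative B (@Defs.harmonic R q n \o sim a z)) in
  Hmhalf0 B qn /\
  cgpt gamma D p q m n = T_op sigma B (A_inv sigma B qn) (@Defs.harmonic R p m \o sim a z).
Proof.
move=> C1h n0 qn; have E := of_fun_normal_derivative_push C1h.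
have Hq : Hmhalf0 B qn.
  have [_ _ _ _ /(_ q n n0)] := wpD; rewrite E.
  exact: push_Hmhalf0P.
split=> //; rewrite /cgpt asboolT// E -/qn.
rewrite (A_inv_push Hq); have [HA _] := A_inv_spec wpB Hq.
by rewrite (well_posed_T_op_push HA).
Qed.

End transport.
End transport_cgpt.

(** * Linearity of the fractional space on a boundary of finite length *)

Section double_integral.
Context d (T : measurableType d) (R : realType) (mu : {measure set T -> \bar R}).
Variables (A : set T) (mA : measurable A) (A_fin : (mu A < +oo)%E).
Variables (K : T * T -> R) (mK : measurable_fun setT K).
Implicit Types f h : T -> R.

Let nu : {finite_measure set T -> \bar R} := mfrestr mA A_fin.

(** The function whose square is integrated in the seminorm, cut off outside
    [A]; it is linear in [f]. *)
Definition weighted_difference f (p : T * T) : R :=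
  ((f \_ A) p.1 - (f \_ A) p.2) * K p * (\1_A p.1 * \1_A p.2).

Lemma weighted_difference_measurable f : measurable_fun A f ->
  measurable_fun setT (weighted_difference f).
Proof.
move=> mf.
have mfA : measurable_fun setT (f \_ A).
  exact: (proj1 (measurable_restrictT f mA) mf).
have m1 (u : T -> R) : measurable_fun setT u ->
    measurable_fun setT (fun p : T * T => u p.1).
  by move=> mu'; apply: (measurableT_comp mu'); exact: measurable_fst.
have m2 (u : T -> R) : measurable_fun setT u ->
    measurable_fun setT (fun p : T * T => u p.2).
  by move=> mu'; apply: (measurableT_comp mu'); exact: measurable_snd.
apply: measurable_funM; last first.
  by apply: measurable_funM; [apply: m1|apply: m2]; exact: measurable_indic.
apply: measurable_funM => //; apply: measurable_funB; [exact: m1|exact: m2].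
Qed.

Lemma integral_restr (g : T -> \bar R) :
  (\int[mu]_(x in A) g x = \int[nu]_(x in A) g x)%E.
Proof.
apply: eq_measure_integral => X mX XA.
by rewrite /nu /= /mfrestr /mrestr setIidl.
Qed.

(** Tonelli's theorem turns the iterated integral into the square of an L2 norm
    on the product, where linear combinations are harmless. *)
Lemma double_integralE f : measurable_fun A f ->
  (\int[mu]_(x in A) \int[mu]_(y in A) (((f x - f y) * K (x, y)) ^+ 2)%:E =
   \int[nu \x nu]_p (weighted_difference f p ^+ 2)%:E)%E.
Proof.
move=> mf; rewrite fubini_tonelli1; last 2 first.
- apply/measurable_EFinP; apply: measurable_funX.
  exact: weighted_difference_measurable.
- by move=> p; rewrite lee_fin sqr_ge0.
rewrite integral_restr [LHS]integral_mkcond; apply: eq_integral => x _.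
rewrite /fubini_F /patch; case: ifPn => xA; last first.
  apply/esym; apply: integral0_eq => y _.
  by rewrite /weighted_difference indicE (negbTE xA) mul0r mulr0 expr0n.
rewrite integral_restr [LHS]integral_mkcond; apply: eq_integral => y _.
rewrite /weighted_difference /patch/= xA !indicE xA mul1r.
by case: ifPn => yA; rewrite ?mulr1// mulr0 expr0n.
Qed.

Lemma double_integral_lin_lty f h (a b : R) : measurable_fun A f -> measurable_fun A h ->
  (\int[mu]_(x in A) \int[mu]_(y in A) (((f x - f y) * K (x, y)) ^+ 2)%:E < +oo ->
   \int[mu]_(x in A) \int[mu]_(y in A) (((h x - h y) * K (x, y)) ^+ 2)%:E < +oo ->
   \int[mu]_(x in A) \int[mu]_(y in A)
     (((a * f x + b * h x - (a * f y + b * h y)) * K (x, y)) ^+ 2)%:E < +oo)%E.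
Proof.
move=> mf mh.
rewrite (double_integralE mf) (double_integralE mh).
rewrite (double_integralE (measurable_lin a b mf mh)) => f2 h2.
have [] := @square_integrable_lin _ _ _ (nu \x nu)%E setT measurableT
  (weighted_difference f) (weighted_difference h) a b.
- by split => //; exact: weighted_difference_measurable.
- by split => //; exact: weighted_difference_measurable.
move=> _; apply: le_lt_trans.
rewrite le_eqVlt; apply/orP; left; apply/eqP; apply: eq_integral => p _.
congr ((_ ^+ 2)%:E); rewrite /weighted_difference /patch !indicE.
by case: ifPn => _; case: ifPn => _ /=; rewrite ?mulr0 ?mul0r ?mulr0 ?addr0 //; ring.
Qed.

End double_integral.

Section finite_length.
Context {R : realType}.
Implicit Types (B : set (R * R)) (f h : R * R -> R) (g : @functional R).
Local Notation arcT := (caratheodory_type (@outer_arclength R)).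

(** The inverse is written as the real power of exponent -1, which is known to
    be measurable and has the same value at 0. *)
Lemma arclength_norm_measurable :
  measurable_fun (setT : set (arcT * arcT)) (fun p => (enorm (p.1 - p.2))^-1 : R).
Proof.
have mc (f : R * R -> R) : continuous f -> measurable_fun (setT : set arcT) f.
  by move=> cf; apply: continuous_arclength_measurable => //; exact: closedT.
have m1 : measurable_fun (setT : set arcT) (fun x : R * R => x.1).
  by apply: mc => x; exact: cvg_fst.
have m2 : measurable_fun (setT : set arcT) (fun x : R * R => x.2).
  by apply: mc => x; exact: cvg_snd.
have mf (u : R * R -> R) : measurable_fun (setT : set arcT) u ->
    measurable_fun (setT : set (arcT * arcT)) (fun p => u p.1 - u p.2).
  move=> mu; apply: measurable_funB.
    by apply: (measurableT_comp mu); exact: measurable_fst.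
  by apply: (measurableT_comp mu); exact: measurable_snd.
rewrite (_ : (fun p : arcT * arcT => _) = (fun p : arcT * arcT =>
    (Num.sqrt ((p.1.1 - p.2.1) * (p.1.1 - p.2.1) +
               (p.1.2 - p.2.2) * (p.1.2 - p.2.2))) `^ (-1))); last first.
  by apply/funext => p; rewrite powR_inv1 ?sqrtr_ge0.
have msq : measurable_fun (setT : set R) (@Num.sqrt R).
  by apply: continuous_measurable_fun; exact: sqrt_continuous.
apply: (measurableT_comp (measurable_powR (-1))).
apply: (measurableT_comp msq).
by apply: measurable_funD; apply: measurable_funM;
  [exact: mf m1|exact: mf m1|exact: mf m2|exact: mf m2].
Qed.

Lemma gagliardo2E B f : gagliardo2 B f =
  (\int[arclength]_(x in frontier B) \int[arclength]_(y in frontier B)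
     (((f x - f y) * (enorm (x - y))^-1) ^+ 2)%:E)%E.
Proof.
rewrite /gagliardo2; apply: eq_integral => x _; apply: eq_integral => y _.
by rewrite exprMn exprVn.
Qed.

Lemma frontier_measurable B : measurable (frontier B : set arcT).
Proof. by apply: closed_arclength_measurable; exact: frontier_closed. Qed.

Definition finite_length B := (arclength (frontier B) < +oo)%E.

Lemma Hhalf_lin B f h (a b : R) : finite_length B -> Hhalf B f -> Hhalf B h ->
  Hhalf B (fun x => a * f x + b * h x).
Proof.
move=> lB [f2 gf] [h2 gh]; have mF := frontier_measurable B.
split; first exact: square_integrable_lin.
rewrite gagliardo2E in gf; rewrite gagliardo2E in gh; rewrite gagliardo2E.
case: f2 h2 => mf _ [mh _].
exact: (double_integral_lin_lty mF lB arclength_norm_measurable a b mf mh gf gh).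
Qed.

Lemma Hhalf0_lin B f h (a b : R) : finite_length B -> Hhalf0 B f -> Hhalf0 B h ->
  Hhalf0 B (fun x => a * f x + b * h x).
Proof.
move=> lB [Hf f0] [Hh h0]; split; first exact: Hhalf_lin.
have mF := frontier_measurable B.
have fi : arclength.-integrable (frontier B) (EFin \o f).
  by apply: square_integrable_integrable => //; case: Hf.
have hi : arclength.-integrable (frontier B) (EFin \o h).
  by apply: square_integrable_integrable => //; case: Hh.
rewrite (@RintegralD _ _ _ arclength _ (fun x => a * f x) (fun x => b * h x))//.
- by rewrite !RintegralZl// f0 h0 !mulr0 addr0.
- exact: (integrableZl mF a fi).
- exact: (integrableZl mF b hi).
Qed.

End finite_length.

(** * Finiteness of the length of the boundary *)

Section length.
Context {R : realType}.
Implicit Types (B : set (R * R)) (f h : R * R -> R) (g : @functional R).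
Local Notation arcT := (caratheodory_type (@outer_arclength R)).

Lemma frontier_box B M : B `<=` box M -> frontier B `<=` box M.
Proof.
move=> BM x [Bx _]; apply: (@box_closed R M) => C /Bx[y [/BM yM Cy]].
by exists y.
Qed.

Lemma box_enorm_le M (x y : R * R) : box M x -> box M y -> enorm (x - y) <= 4 * M.
Proof.
move=> [/= ] + + [/=]; rewrite !in_itv/= => /andP[? ?] /andP[? ?] /andP[? ?] /andP[? ?].
apply: le_trans (enorm_le _) _ => /=.
have : `|x.1 - y.1| <= 2 * M by rewrite ler_norml; apply/andP; split; lra.
have : `|x.2 - y.2| <= 2 * M by rewrite ler_norml; apply/andP; split; lra.
by lra.
Qed.

(** If [f x != 0] then [f x ^+ 2 <= 2 (f x - f y) ^+ 2 + 2 f y ^+ 2] has an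
    infinite integral in [y], and so has the quotient by the bounded function
    [|x - y| ^+ 2]. The points [x] of this kind form a null set, since the
    double integral is finite. *)
Lemma infinite_length_Hhalf_ae0 B f : bounded_set B ->
  arclength (frontier B) = +oo%E -> Hhalf B f ->
  exists N : set arcT, [/\ measurable N, arclength N = 0 &
    forall x, frontier B x -> ~ N x -> f x = 0].
Proof.
move=> /bounded_box[M BM] Boo [[mf f2] gf].
have mF := frontier_measurable B.
pose N : set arcT := frontier B `&` f @^-1` [set~ 0].
have mN : measurable N by apply: mf => //; exact: measurableC.
exists N; split => //; last first.
  by move=> x Fx Nx; apply: contrapT => fx; apply: Nx.
have inner_oo x : N x -> (\int[arclength]_(y in frontier B)
    ((f x - f y) ^+ 2 / enorm (x - y) ^+ 2)%:E = +oo)%E.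
  move=> [Fx fx0].
  have md : measurable_fun (frontier B : set arcT) (fun y => f x - f y).
    by apply: measurable_funB => //; exact: measurable_cst.
  have := integral_sqr_lin_le (@arclength R) mF 1 1 md mf.
  rewrite expr1n mulr1.
  have -> : (\int[@arclength R]_(y in frontier B)
      ((1 * (f x - f y) + 1 * f y) ^+ 2)%:E = +oo)%E.
    transitivity (\int[@arclength R]_(y in frontier B) cst (f x ^+ 2)%:E y)%E.
      by apply: eq_integral => y _; rewrite !mul1r subrK.
    rewrite integral_cst// [X in (_ * X)%E]Boo gt0_muley// lte_fin.
    by rewrite lt_neqAle sqr_ge0 andbT eq_sym sqrf_eq0; apply/eqP.
  rewrite leye_eq => /eqP E.
  have Ioo : (\int[arclength]_(y in frontier B) ((f x - f y) ^+ 2)%:E)%E = +oo%E.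
    apply: contrapT => /eqP; rewrite -ltey => lt.
    move: E => /eqP; rewrite eq_le leNgt => /andP[_]; rewrite leNgt => /negP; apply.
    by rewrite lte_add_pinfty// lte_mul_pinfty.
  have M0 : 0 < (`|4 * M| + 1) ^+ 2 by rewrite exprn_gt0// ltr_wpDl.
  apply/eqP; rewrite -leye_eq.
  have <- : ((((`|4 * M| + 1) ^+ 2)^-1)%:E * \int[arclength]_(y in frontier B)
      ((f x - f y) ^+ 2)%:E)%E = +oo%E.
    by rewrite Ioo gt0_muley// lte_fin invr_gt0.
  rewrite -ge0_integralZl_nonmeas ?invr_gt0//.
  apply: ge0_le_integral_nonmeas => y Fy.
    by rewrite -EFinM lee_fin mulr_ge0 ?sqr_ge0// invr_ge0 ltW.
  rewrite -EFinM lee_fin [leRHS]mulrC.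
  have [->|xy] := eqVneq x y; first by rewrite !subrr expr0n/= !mulr0.
  rewrite ler_wpM2r ?sqr_ge0//.
  have e0 : 0 < enorm (x - y) by rewrite enorm_gt0// subr_eq0.
  rewrite lef_pV2 ?posrE ?exprn_gt0//.
  rewrite lerXn2r ?nnegrE ?addr_ge0//; first exact: ltW.
  have := box_enorm_le (frontier_box BM Fx) (frontier_box BM Fy).
  by move=> /le_trans; apply; rewrite (le_trans (ler_norm _))// lerDl.
apply: contrapT => /eqP N0; move: gf; apply/negP; rewrite -leNgt.
have Npos : (0 < arclength N)%E by rewrite lt_neqAle eq_sym N0 measure_ge0.
have <- : (\int[@arclength R]_(x in N) cst +oo%E x = +oo)%E.
  by rewrite integral_cst// gt0_mulye.
rewrite -(setIidr (_ : N `<=` frontier B)); last by move=> x [].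
rewrite integral_mkcondr; apply: ge0_le_integral_nonmeas => x Fx.
  by rewrite /patch; case: ifPn => _; [exact: leey|exact: lexx].
rewrite /patch; case: ifPn => [/set_mem Nx|_]; first by rewrite inner_oo// leey.
by apply: integral_ge0 => y _; rewrite lee_fin divr_ge0// sqr_ge0.
Qed.

(** Functions that vanish almost everywhere have norm 0, so continuity makes
    the functional vanish on H^(1/2); outside that space it vanishes by
    definition. *)
Lemma infinite_length_functional0 B g f : bounded_set B ->
  arclength (frontier B) = +oo%E -> Hmhalf B g -> g f = 0.
Proof.
move=> bB Boo [g0 _ [C gC]].
have [Hf|/g0//] := pselect (Hhalf B f).
have [N [mN N0 fN]] := infinite_length_Hhalf_ae0 bB Boo Hf.
have norm0 : Hhalf_norm B f = 0.
  rewrite /Hhalf_norm (ge0_integral_eq0_off mN N0)//; first last.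
  - by move=> x Fx Nx; rewrite fN// expr0n.
  - by move=> x _; rewrite lee_fin sqr_ge0.
  rewrite add0e /gagliardo2 (ge0_integral_eq0_off mN N0) ?sqrtr0//.
    move=> x _; apply: integral_ge0 => y _.
    by rewrite lee_fin divr_ge0// sqr_ge0.
  move=> x Fx Nx; rewrite (ge0_integral_eq0_off mN N0)//.
    by move=> y _; rewrite lee_fin divr_ge0// sqr_ge0.
  by move=> y Fy Ny; rewrite !fN// subrr expr0n mul0r.
apply/eqP; rewrite -normr_le0; apply: le_trans (gC f Hf) _.
by rewrite norm0 mulr0.
Qed.

Lemma finite_length_of_functional B g f : bounded_set B -> Hmhalf B g ->
  g f != 0 -> finite_length B.
Proof.
move=> bB Hg gf; rewrite /finite_length ltey; apply/eqP => Boo.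
by move: gf; rewrite (infinite_length_functional0 f bB Boo Hg) eqxx.
Qed.

(** The mean value theorem gives an intermediate point [c (x - y) + y] with
    [|c| <= 1], which lies in the square of triple size. *)
Lemma C1_lipschitz_on_box h M : C1 h -> exists2 K, 0 <= K &
  forall x y, box M x -> box M y -> `|h x - h y| <= K * enorm (x - y).
Proof.
move=> C1h.
have [K1 hK1] := continuous_bounded_on_box (3 * M)
  (@C1_derive_continuous _ _ C1h (1, 0)).
have [K2 hK2] := continuous_bounded_on_box (3 * M)
  (@C1_derive_continuous _ _ C1h (0, 1)).
exists (`|K1| + `|K2|); first by rewrite addr_ge0.
move=> x y Mx My.
have [c] := mean_value y (x - y) C1h (oner_neq0 R); rewrite normr1 => c1.
rewrite invr1 !scale1r subrK derive_grad// => ->.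
have Mc : box (3 * M) (c *: (x - y) + y).
  have seg (s t : R) : `[- M, M]%classic s -> `[- M, M]%classic t ->
      `[- (3 * M), 3 * M]%classic (c * (s - t) + t).
    rewrite /= !in_itv/= => /andP[? ?] /andP[? ?].
    have : `|c * (s - t)| <= 2 * M.
      have st : `|s - t| <= 2 * M by rewrite ler_norml; apply/andP; split; lra.
      by rewrite normrM (le_trans _ st)// ler_piMl.
    by rewrite ler_norml => /andP[? ?]; apply/andP; split; lra.
  by case: Mx My => x1 x2 [y1 y2]; split; exact: seg.
apply: le_trans (_ : enorm (grad h (c *: (x - y) + y)) * enorm (x - y) <= _).
  rewrite ler_norml dot_le_enorm andbT lerNl.
  by rewrite -mulN1r -dotZr scaleN1r (le_trans (dot_le_enorm _ _))// enormN.
rewrite ler_wpM2r ?enorm_ge0//; apply: le_trans (enorm_le _) _.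
by apply: lerD; [apply: le_trans (hK1 _ Mc) _|apply: le_trans (hK2 _ Mc) _];
  exact: ler_norm.
Qed.

(** The Gagliardo quotient of a Lipschitz function is bounded. *)
Lemma C1_Hhalf B h : bounded_set B -> finite_length B -> C1 h -> Hhalf B h.
Proof.
move=> /bounded_box[M BM] lB C1h.
have mF := frontier_measurable B; have FM := frontier_box BM.
have mh : measurable_fun (frontier B : set arcT) h.
  by apply: continuous_arclength_measurable; [exact: frontier_closed|exact: C1_continuous].
have [b hb] := continuous_bounded_on_box M (C1_continuous C1h).
split; first by apply: (@bounded_square_integrable _ _ _ _ _ mF _ b) => // x /FM /hb.
have [K K0 hK] := C1_lipschitz_on_box M C1h.
apply: (@le_lt_trans _ _ (\int[@arclength R]_(x in frontier B)
  \int[@arclength R]_(y in frontier B) cst (K ^+ 2)%:E y)%E).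
  apply: ge0_le_integral_nonmeas => x Fx.
    by apply: integral_ge0 => y _; rewrite lee_fin divr_ge0// sqr_ge0.
  apply: ge0_le_integral_nonmeas => y Fy; rewrite lee_fin.
    by rewrite divr_ge0// sqr_ge0.
  have [->|xy] := eqVneq x y; first by rewrite !subrr expr0n/= mul0r sqr_ge0.
  have e0 : 0 < enorm (x - y) by rewrite enorm_gt0// subr_eq0.
  rewrite ler_pdivrMr ?exprn_gt0// -exprMn -(real_normK (num_real (h x - h y))).
  by rewrite lerXn2r ?nnegrE ?mulr_ge0 ?enorm_ge0// hK//; exact: FM.
have L0 : (0 <= arclength (frontier B))%E by exact: measure_ge0.
have K2 : (0 <= (K ^+ 2)%:E)%E by rewrite lee_fin sqr_ge0.
have KL : (\int[@arclength R]_(y in frontier B) cst (K ^+ 2)%:E y < +oo)%E.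
  by rewrite integral_cst// lte_mul_pinfty.
have KL0 : (0 <= \int[@arclength R]_(y in frontier B) cst (K ^+ 2)%:E y)%E.
  exact: integral_ge0.
move: KL KL0; set I := integral _ _ _ => KL KL0.
rewrite -[X in integral _ _ X]/(cst I) integral_cst// lte_mul_pinfty//.
by rewrite ge0_fin_numE.
Qed.

End length.

(** * Linearity of the operators *)

Section linearity.
Context {R : realType}.
Implicit Types (f h v w k : R * R -> R) (G H : R * R -> R * R) (g phi : @functional R).
Local Notation plT := (measurableTypeR R * measurableTypeR R)%type.
Local Notation arcT := (caratheodory_type (@outer_arclength R)).

(** Linear combinations of functionals; they are written out because a
    functional carries no module structure here. *)
Definition flin (a b : R) g1 g2 : functional := fun f => a * g1 f + b * g2 f.

Definition glin (a b : R) G1 G2 : R * R -> R * R := fun x =>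
  (a * (G1 x).1 + b * (G2 x).1, a * (G1 x).2 + b * (G2 x).2).

Variables (B : set (R * R)).
Hypotheses (oB : open B) (bB : bounded_set B).

Let mB : measurable (B : set plT). Proof. exact: open_plane_measurable. Qed.

Lemma bounded_lebesgue_fin : (lebesgue2 B < +oo)%E.
Proof.
have [M BM] := bounded_box bB; apply: le_lt_trans (box_lebesgue_fin M).
apply: le_measure; rewrite ?inE//.
by apply: measurableX; exact: measurable_itv.
Qed.

Lemma continuous_square_integrable f : continuous f ->
  square_integrable lebesgue2 B f.
Proof.
move=> cf; have [M BM] := bounded_box bB.
have [b fb] := continuous_bounded_on_box M cf.
apply: (@bounded_square_integrable _ _ _ _ _ mB _ b).
- exact: bounded_lebesgue_fin.
- by apply: measurable_funTS; exact: continuous_plane_measurable.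
- by move=> x /BM; exact: fb.
Qed.

Lemma Rintegral_lin d (T : measurableType d) (mu : {measure set T -> \bar R})
    (A : set T) (F1 F2 : T -> R) (a b : R) : measurable A ->
  mu.-integrable A (EFin \o F1) -> mu.-integrable A (EFin \o F2) ->
  \int[mu]_(x in A) (a * F1 x + b * F2 x) =
  a * \int[mu]_(x in A) F1 x + b * \int[mu]_(x in A) F2 x.
Proof.
move=> mA F1i F2i.
rewrite (@RintegralD _ _ _ mu _ (fun x => a * F1 x) (fun x => b * F2 x))//.
- by rewrite !RintegralZl.
- exact: (integrableZl mA a F1i).
- exact: (integrableZl mA b F2i).
Qed.

Lemma weak_gradient_lin v1 v2 G1 G2 (a b : R) :
  sobolev1 B v1 G1 -> sobolev1 B v2 G2 ->
  weak_gradient B (fun x => a * v1 x + b * v2 x) (glin a b G1 G2).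
Proof.
move=> [v12 G11 G12 w1] [v22 G21 G22 w2] phi e tphi.
have [sphi _] := tphi.
have phi2 := continuous_square_integrable (smooth_continuous sphi).
have dphi2 := continuous_square_integrable
  (@C1_derive_continuous _ _ (smooth_C1 sphi) e).
have e1 := square_integrable_lin mB e.1 e.2 G11 G12.
have e2 := square_integrable_lin mB e.1 e.2 G21 G22.
transitivity (\int[lebesgue2]_(x in B)
    (a * (v1 x * 'D_e phi x) + b * (v2 x * 'D_e phi x))).
  by apply: eq_Rintegral => x _; rewrite mulrDl !mulrA.
rewrite (Rintegral_lin a b mB (square_integrable_mul mB v12 dphi2)
  (square_integrable_mul mB v22 dphi2)) w1// w2//.
rewrite !mulrN -opprD; congr (- _).
transitivity (\int[lebesgue2]_(x in B)
    (a * ((e.1 * (G1 x).1 + e.2 * (G1 x).2) * phi x) +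
     b * ((e.1 * (G2 x).1 + e.2 * (G2 x).2) * phi x))).
  rewrite (Rintegral_lin a b mB (square_integrable_mul mB e1 phi2)
    (square_integrable_mul mB e2 phi2)).
  by congr (_ * _ + _ * _); apply: eq_Rintegral => x _; rewrite /dot; ring.
by apply: eq_Rintegral => x _; rewrite /dot /glin/=; ring.
Qed.

Lemma sobolev1_lin v1 v2 G1 G2 (a b : R) :
  sobolev1 B v1 G1 -> sobolev1 B v2 G2 ->
  sobolev1 B (fun x => a * v1 x + b * v2 x) (glin a b G1 G2).
Proof.
move=> s1 s2; have [v12 G11 G12 w1] := s1; have [v22 G21 G22 w2] := s2.
split; last exact: weak_gradient_lin.
- exact: (square_integrable_lin mB a b v12 v22).
- exact: (square_integrable_lin mB a b G11 G21).
- exact: (square_integrable_lin mB a b G12 G22).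
Qed.

Lemma is_trace_lin v1 v2 G1 G2 f1 f2 (a b : R) :
  sobolev1 B v1 G1 -> sobolev1 B v2 G2 ->
  is_trace B v1 G1 f1 -> is_trace B v2 G2 f2 ->
  is_trace B (fun x => a * v1 x + b * v2 x) (glin a b G1 G2)
    (fun x => a * f1 x + b * f2 x).
Proof.
move=> [[mv1 _] [mG11 _] [mG12 _] _] [[mv2 _] [mG21 _] [mG22 _] _].
move=> [f12 [w1 [sw1 wv1 w11 w12 wf1]]] [f22 [w2 [sw2 wv2 w21 w22 wf2]]].
have mF := frontier_measurable B.
split; first exact: square_integrable_lin.
have mw w (u : R * R -> R) : smooth w -> measurable_fun (B : set plT) u ->
    measurable_fun (B : set plT) (fun x => w x - u x).
  move=> sw mu; apply: measurable_funB => //; apply: measurable_funTS.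
  by apply: continuous_plane_measurable; exact: smooth_continuous.
have mg1 w (u : R * R -> R) : smooth w -> measurable_fun (B : set plT) u ->
    measurable_fun (B : set plT) (fun x => (grad w x).1 - u x).
  move=> sw mu; apply: measurable_funB => //; apply: measurable_funTS.
  by apply: C1_grad1_measurable; exact: smooth_C1.
have mg2 w (u : R * R -> R) : smooth w -> measurable_fun (B : set plT) u ->
    measurable_fun (B : set plT) (fun x => (grad w x).2 - u x).
  move=> sw mu; apply: measurable_funB => //; apply: measurable_funTS.
  by apply: C1_grad2_measurable; exact: smooth_C1.
have mwf w (u : R * R -> R) : smooth w -> measurable_fun (frontier B : set arcT) u ->
    measurable_fun (frontier B : set arcT) (fun x => w x - u x).
  move=> sw mu; apply: measurable_funB => //.
  apply: continuous_arclength_measurable; first exact: frontier_closed.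
  exact: smooth_continuous.
have gE j x : grad (fun x => a * w1 j x + b * w2 j x) x =
    glin a b (grad (w1 j)) (grad (w2 j)) x.
  by apply: grad_lin; exact: smooth_C1.
exists (fun j x => a * w1 j x + b * w2 j x); split.
- by move=> j; exact: smooth_lin.
- apply: (cvg_L2_lin mB a b _ _ wv1 wv2) => j; exact: mw.
- have := cvg_L2_lin mB a b (fun j => mg1 _ _ (sw1 j) mG11)
    (fun j => mg1 _ _ (sw2 j) mG21) w11 w21.
  by congr cvg_L2; apply/funext => j; apply/funext => x; rewrite gE.
- have := cvg_L2_lin mB a b (fun j => mg2 _ _ (sw1 j) mG12)
    (fun j => mg2 _ _ (sw2 j) mG22) w12 w22.
  by congr cvg_L2; apply/funext => j; apply/funext => x; rewrite gE.
- apply: (cvg_L2_lin mF a b _ _ wf1 wf2) => j; apply: mwf => //.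
    by case: f12.
  by case: f22.
Qed.

Hypothesis lB : finite_length B.

(** The weak formulation is linear in the solution and in the datum; the
    integrals may be split because conductivity times a product of two L2
    functions is integrable. *)
Lemma is_NtD_lin (gamma : R * R -> R) (lam : R) g1 g2 f1 f2 (a b : R) :
  measurable_fun (B : set plT) gamma ->
  {ae lebesgue2, forall x : plT, B x -> `|gamma x| <= lam} ->
  is_NtD gamma B g1 f1 -> is_NtD gamma B g2 f2 ->
  is_NtD gamma B (flin a b g1 g2) (fun x => a * f1 x + b * f2 x).
Proof.
move=> mg gb [Hf1 [v1 [G1 [s1 t1 e1]]]] [Hf2 [v2 [G2 [s2 t2 e2]]]].
split; first exact: Hhalf0_lin.
exists (fun x => a * v1 x + b * v2 x), (glin a b G1 G2); split.
- exact: sobolev1_lin.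
- exact: is_trace_lin.
move=> w H h sw tw; rewrite /flin -(e1 _ _ _ sw tw) -(e2 _ _ _ sw tw).
have int_dot v G : sobolev1 B v G ->
    lebesgue2.-integrable B (EFin \o (fun x => gamma x * dot (G x) (H x))).
  move=> [_ G1' G2' _]; case: sw => _ H1 H2 _.
  apply: (ae_bounded_mul_integrable mB mg gb).
  exact: (integrableD mB (square_integrable_mul mB G1' H1) (square_integrable_mul mB G2' H2)).
rewrite -(Rintegral_lin a b mB (int_dot _ _ s1) (int_dot _ _ s2)).
by apply: eq_Rintegral => x _; rewrite /dot /glin/=; ring.
Qed.

Lemma Hmhalf_lin g1 g2 (a b : R) : Hmhalf B g1 -> Hmhalf B g2 ->
  Hmhalf B (flin a b g1 g2).
Proof.
move=> [g10 l1 [C1 b1]] [g20 l2 [C2 b2]]; split.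
- by move=> f Hf; rewrite /flin g10// g20// !mulr0 addr0.
- by move=> s f h Hf Hh; rewrite /flin l1// l2//; ring.
- exists (`|a| * C1 + `|b| * C2) => f Hf; apply: le_trans (ler_normD _ _) _.
  rewrite !normrM mulrDl -!mulrA.
  by apply: lerD; apply: ler_wpM2l => //; [exact: b1|exact: b2].
Qed.

Lemma Hmhalf0_lin g1 g2 (a b : R) : Hmhalf0 B g1 -> Hmhalf0 B g2 ->
  Hmhalf0 B (flin a b g1 g2).
Proof.
move=> [H1 h1] [H2 h2]; split; first exact: Hmhalf_lin.
by rewrite /flin h1 h2 !mulr0 addr0.
Qed.

Variables (sigma : R * R -> R) (lam : R).
Hypotheses (msigma : measurable_fun (B : set plT) sigma)
  (bsigma : {ae lebesgue2, forall x : plT, B x -> `|sigma x| <= lam})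
  (wp : well_posed sigma B).

Lemma NtD_lin g1 g2 (a b : R) : Hmhalf0 B g1 -> Hmhalf0 B g2 ->
  eq_boundary B (NtD sigma B (flin a b g1 g2))
    (fun x => a * NtD sigma B g1 x + b * NtD sigma B g2 x).
Proof.
move=> H1 H2; have wpN := well_posed_NtD wp.
have H12 := Hmhalf0_lin a b H1 H2.
apply: (NtD_unique wpN H12 (NtD_spec wpN H12)).
exact: (is_NtD_lin a b msigma bsigma (NtD_spec wpN H1) (NtD_spec wpN H2)).
Qed.

Lemma NtD1_lin g1 g2 (a b : R) : Hmhalf0 B g1 -> Hmhalf0 B g2 ->
  eq_boundary B (NtD (fun=> 1) B (flin a b g1 g2))
    (fun x => a * NtD (fun=> 1) B g1 x + b * NtD (fun=> 1) B g2 x).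
Proof.
move=> H1 H2; have wpN := well_posed_NtD1 wp.
have H12 := Hmhalf0_lin a b H1 H2.
apply: (NtD_unique wpN H12 (NtD_spec wpN H12)).
apply: (@is_NtD_lin (fun=> 1) 1) (NtD_spec wpN H1) (NtD_spec wpN H2).
- exact: measurable_cst.
- by apply: aeW => x _; rewrite normr1.
Qed.

(** The difference of the two solutions is in the trace space by [Hhalf0_lin],
    and the map for conductivity 1 is onto that space. *)
Lemma T_op_spec g : Hmhalf0 B g ->
  eq_boundary B (NtD (fun=> 1) B (T_op sigma B g))
    (fun x => NtD (fun=> 1) B g x - NtD sigma B g x).
Proof.
move=> Hg; have wpN := well_posed_NtD wp; have wpN1 := well_posed_NtD1 wp.
have bij := well_posed_bijective wp.
have [H1 _] := NtD_spec wpN1 Hg; have [H2 _] := NtD_spec wpN Hg.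
(* Hence there is a datum whose solution is the difference of the traces. *)
have := Hhalf0_lin 1 (-1) lB H1 H2.
rewrite (_ : (fun x => _) = (fun x => NtD (fun=> 1) B g x - NtD sigma B g x)); last first.
  by apply/funext => x; rewrite mul1r mulN1r.
move=> /bij[tau [[Htau tauE] _]].
have -> : T_op sigma B g = tau by exact: (NtD1_inv_eq wpN1 bij Htau tauE).
exact: tauE.
Qed.

(** Both sides have the same image under the Neumann-to-Dirichlet map of
    conductivity 1. *)
Lemma T_op_lin g1 g2 (a b : R) : Hmhalf0 B g1 -> Hmhalf0 B g2 ->
  T_op sigma B (flin a b g1 g2) = flin a b (T_op sigma B g1) (T_op sigma B g2).
Proof.
move=> H1 H2; have HT1 := T_op_Hmhalf0 B sigma g1; have HT2 := T_op_Hmhalf0 B sigma g2.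
apply: (NtD1_inv_eq (well_posed_NtD1 wp) (well_posed_bijective wp)).
  exact: Hmhalf0_lin.
apply: eq_boundary_trans (NtD1_lin a b HT1 HT2) _.
apply: eq_boundary_trans (eq_boundary_lin a b (T_op_spec H1) (T_op_spec H2)) _.
apply: eq_boundary_sym.
apply: eq_boundary_trans (eq_boundary_sub (NtD1_lin a b H1 H2) (NtD_lin a b H1 H2)) _.
rewrite (_ : (fun x => _ - _) = (fun x =>
  a * (NtD (fun=> 1) B g1 x - NtD sigma B g1 x) +
  b * (NtD (fun=> 1) B g2 x - NtD sigma B g2 x))); last first.
  by apply/funext => x; ring.
exact: eq_boundary_refl.
Qed.

Lemma of_fun_lin k1 k2 (a b : R) :
  square_integrable arclength (frontier B) k1 ->
  square_integrable arclength (frontier B) k2 ->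
  of_fun B (fun x => a * k1 x + b * k2 x) = flin a b (of_fun B k1) (of_fun B k2).
Proof.
move=> k12 k22; apply/funext => f; rewrite /flin /of_fun.
case: asboolP => [[f2 _]|_]; last by rewrite !mulr0 addr0.
have mF := frontier_measurable B.
rewrite -(Rintegral_lin a b mF (square_integrable_mul mF k12 f2)
  (square_integrable_mul mF k22 f2)).
by apply: eq_Rintegral => x _; rewrite mulrDl !mulrA.
Qed.

Lemma Kstar_lin g1 g2 (a b : R) : Hmhalf0 B g1 -> Hmhalf0 B g2 ->
  Kstar B (flin a b g1 g2) = flin a b (Kstar B g1) (Kstar B g2).
Proof.
move=> H1 H2; have [_ _ KL _ _] := wp.
rewrite /Kstar -(of_fun_lin a b (KL _ H1) (KL _ H2)); congr (of_fun B).
by apply/funext => x; rewrite /Kstar_fun /flin; ring.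
Qed.

Lemma A_op_lin g1 g2 (a b : R) : Hmhalf0 B g1 -> Hmhalf0 B g2 ->
  A_op sigma B (flin a b g1 g2) = flin a b (A_op sigma B g1) (A_op sigma B g2).
Proof.
move=> H1 H2; apply/funext => f; rewrite /A_op (T_op_lin a b H1 H2).
rewrite (Kstar_lin a b (T_op_Hmhalf0 B sigma g1) (T_op_Hmhalf0 B sigma g2)).
by rewrite /flin; field.
Qed.

Lemma A_inv_lin g1 g2 (a b : R) : Hmhalf0 B g1 -> Hmhalf0 B g2 ->
  A_inv sigma B (flin a b g1 g2) = flin a b (A_inv sigma B g1) (A_inv sigma B g2).
Proof.
move=> H1 H2; have [HA1 A1] := A_inv_spec wp H1; have [HA2 A2] := A_inv_spec wp H2.
apply: (A_inv_eq wp).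
- exact: Hmhalf0_lin.
- exact: Hmhalf0_lin.
- by rewrite (A_op_lin a b HA1 HA2) A1 A2.
Qed.

End linearity.

(** * Harmonic polynomials *)

Section harmonic_polynomials.
Context {R : realType}.
Implicit Types (f h : R * R -> R) (x v a z : (R * R)%type).
Local Notation harm := (@Defs.harmonic R).

Lemma C1_cst (c : R) : C1 (fun=> c).
Proof.
have D0 v : 'D_v (fun=> c : R) = (fun=> 0) :> (R * R -> R).
  by apply/funext => x; exact: derive_cst.
split; first by move=> x; exact: cvg_cst.
move=> v; split; first by move=> x; exact: derivable_cst.
by rewrite D0; split => // x; exact: cvg_cst.
Qed.

Lemma C1_M f h : C1 f -> C1 h -> C1 (fun x => f x * h x).
Proof.
move=> C1f C1h; split.
  by move=> x; apply: cvgM; exact: C1_continuous.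
move=> v; have [df dh] := (C1_derivable C1f, C1_derivable C1h).
split; first by move=> x; exact: (derivableM (df x v) (dh x v)).
have -> : 'D_v (fun x => f x * h x) = fun x => f x * 'D_v h x + h x * 'D_v f x.
  by apply/funext => x; exact: (deriveM (df x v) (dh x v)).
split => // x; apply: cvgD; apply: cvgM;
  by [exact: C1_continuous|exact: C1_derive_continuous].
Qed.

Lemma C1_lin f h (s t : R) : C1 f -> C1 h -> C1 (fun x => s * f x + t * h x).
Proof. exact: class_C_lin. Qed.

(** The difference quotients of a linear form are constant. *)
Lemma C1_coord (p : R * R -> R) : continuous p ->
  (forall t v x, p (t *: v + x) = t * p v + p x) -> C1 p.
Proof.
move=> cp p_lin; split => // v.
have cD x : t^-1 *: ((p \o shift x) (t *: v) - p x) @[t --> 0^'] --> p v.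
  apply: (@cvg_trans _ (p v @[t --> (0 : R)^'])); last exact: cvg_cst.
  apply: near_eq_cvg; near=> t; rewrite /= p_lin addrK.
  have t0 : t != 0 by near: t; exact: nbhs_dnbhs_neq.
  by apply/esym; exact: mulKf.
have DE : 'D_v p = fun=> p v.
  by apply/funext => x; apply: cvg_lim => //; exact: cD.
split; first by move=> x; apply/cvg_ex; exists (p v); exact: cD.
by rewrite DE; split => // x; exact: cvg_cst.
Unshelve. all: by end_near. Qed.

Lemma C1_fst : C1 (fun x : R * R => x.1).
Proof. by apply: C1_coord => // x; exact: cvg_fst. Qed.

Lemma C1_snd : C1 (fun x : R * R => x.2).
Proof. by apply: C1_coord => // x; exact: cvg_snd. Qed.

Lemma harmonic0 : harm Pc 0 = (fun=> 1) /\ harm Ps 0 = (fun=> 0).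
Proof. by split; apply/funext => x; rewrite /Defs.harmonic expr0. Qed.

Lemma harmonicS n :
  harm Pc n.+1 = (fun y => y.1 * harm Pc n y - y.2 * harm Ps n y) /\
  harm Ps n.+1 = (fun y => y.1 * harm Ps n y + y.2 * harm Pc n y).
Proof.
by split; apply/funext => y; rewrite /Defs.harmonic exprS; case: (_ ^+ n).
Qed.

Lemma harmonic_C1 p n : C1 (harm p n).
Proof.
suff [] : C1 (harm Pc n) /\ C1 (harm Ps n) by case: p.
elim: n => [|n [IHc IHs]].
  by have [-> ->] := harmonic0; split; exact: C1_cst.
have [-> ->] := harmonicS n; split.
  rewrite (_ : (fun y => _) = (fun y => 1 * (y.1 * harm Pc n y) + (-1) * (y.2 * harm Ps n y))).
    by apply: C1_lin; apply: C1_M => //; [exact: C1_fst|exact: C1_snd].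
  by apply/funext => y; rewrite mul1r mulN1r.
rewrite (_ : (fun y => _) = (fun y => 1 * (y.1 * harm Ps n y) + 1 * (y.2 * harm Pc n y))).
  by apply: C1_lin; apply: C1_M => //; [exact: C1_fst|exact: C1_snd].
by apply/funext => y; rewrite !mul1r.
Qed.

(** Used for functionals on H^(1/2) and for the response, which are linear only
    on a subspace [S]. *)
Lemma linear_on_sum (S : (R * R -> R) -> Prop) (F : (R * R -> R) -> R) :
  S (fun=> 0) ->
  (forall s t f h, S f -> S h -> S (fun x => s * f x + t * h x) /\
    F (fun x => s * f x + t * h x) = s * F f + t * F h) ->
  forall n (s t : nat -> R) (f h : nat -> R * R -> R),
  (forall k, S (f k)) -> (forall k, S (h k)) ->
  S (fun x => \sum_(k < n) (s k * f k x + t k * h k x)) /\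
  F (fun x => \sum_(k < n) (s k * f k x + t k * h k x)) =
  \sum_(k < n) (s k * F (f k) + t k * F (h k)).
Proof.
move=> S0 lin n s t f h Sf Sh; elim: n => [|n [SIH IH]].
  have E : (fun x : R * R => \sum_(k < 0) (s k * f k x + t k * h k x)) = (fun=> 0).
    by apply/funext => x; rewrite big_ord0.
  rewrite E big_ord0; split => //.
  by have [_] := lin 0 0 _ _ S0 S0; rewrite !mul0r !addr0.
have [S1 F1] := lin (s n) (t n) _ _ (Sf n) (Sh n).
have [S2 F2] := lin 1 1 _ _ SIH S1.
have E : (fun x => \sum_(k < n.+1) (s k * f k x + t k * h k x)) =
    (fun x => 1 * (\sum_(k < n) (s k * f k x + t k * h k x)) +
              1 * (s n * f n x + t n * h n x)).
  by apply/funext => x; rewrite big_ord_recr/= !mul1r.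
by rewrite E F2 IH F1 big_ord_recr/= !mul1r.
Qed.

(** With [scoef]: the coefficients of Re w and of Im w in the real part (for
    [Pc]) or the imaginary part (for [Ps]) of [c w]. *)
Definition ccoef (p : parity) (c : R[i]) : R :=
  if p is Pc then complex.Re c else complex.Im c.
Definition scoef (p : parity) (c : R[i]) : R :=
  if p is Pc then - complex.Im c else complex.Re c.

Lemma ReE (c e : R[i]) : complex.Re (c * e) =
  complex.Re c * complex.Re e - complex.Im c * complex.Im e.
Proof. by case: c e => [? ?] []. Qed.

Lemma ImE (c e : R[i]) : complex.Im (c * e) =
  complex.Re c * complex.Im e + complex.Im c * complex.Re e.
Proof. by case: c e => [? ?] []. Qed.

Lemma Re_sum n (F : nat -> R[i]) :
  complex.Re (\sum_(k < n) F k) = \sum_(k < n) complex.Re (F k).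
Proof.
by elim: n => [|n IH]; rewrite ?big_ord0// !big_ord_recr/= -IH; case: (\sum_(_ < _) _) (F n) => ? ? [].
Qed.

Lemma Im_sum n (F : nat -> R[i]) :
  complex.Im (\sum_(k < n) F k) = \sum_(k < n) complex.Im (F k).
Proof.
by elim: n => [|n IH]; rewrite ?big_ord0// !big_ord_recr/= -IH; case: (\sum_(_ < _) _) (F n) => ? ? [].
Qed.

Lemma cplx_sim a z x : cplx (sim a z x) = cplx a * cplx x + cplx z.
Proof.
apply/eqP; rewrite eq_complex /=; apply/andP; split; apply/eqP; rewrite /sim /rmul/=; ring.
Qed.

(** The coefficient of [y ^ k] in [(a y + z) ^ m]. *)
Definition sim_coef a z (m k : nat) : R[i] := Cmx (cplx z) m k * cplx a ^+ k.

Lemma cplx_sim_expn a z x m :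
  cplx (sim a z x) ^+ m = \sum_(k < m.+1) sim_coef a z m k * cplx x ^+ k.
Proof.
rewrite cplx_sim addrC exprDn; apply: eq_bigr => k _.
rewrite /sim_coef /Cmx -ltnS ltn_ord exprMn -mulr_natl; ring.
Qed.

Lemma harmonic_sim p a z m : harm p m \o sim a z =
  fun x => \sum_(k < m.+1) (ccoef p (sim_coef a z m k) * harm Pc k x +
                            scoef p (sim_coef a z m k) * harm Ps k x).
Proof.
apply/funext => x; rewrite /= /Defs.harmonic; case: p; rewrite cplx_sim_expn.
  rewrite (Re_sum _ (fun k => sim_coef a z m k * cplx x ^+ k)).
  by apply: eq_bigr => k _; rewrite ReE mulNr.
rewrite (Im_sum _ (fun k => sim_coef a z m k * cplx x ^+ k)).
by apply: eq_bigr => k _; rewrite ImE addrC.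
Qed.

End harmonic_polynomials.

Section bilinear.
Context {R : realType}.
Local Notation harm := (@Defs.harmonic R).
Local Notation plT := (measurableTypeR R * measurableTypeR R)%type.
Variables (B : set (R * R)) (sigma : R * R -> R) (lam : R).
Hypotheses (B_domain : smooth_bounded_domain B) (lB : finite_length B).
Hypotheses (msigma : measurable_fun (B : set plT) sigma)
  (bsigma : {ae lebesgue2, forall x : plT, B x -> `|sigma x| <= lam})
  (wp : well_posed sigma B).

Let oB : open B. Proof. by case: B_domain. Qed.
Let bB : bounded_set B. Proof. by case: B_domain. Qed.
Let sB : smooth_boundary B. Proof. by case: B_domain. Qed.

Definition neumann_data (q : R * R -> R) : functional := of_fun B (normal_derivative B q).

(** Functions whose normal derivative is a datum of the Neumann problem. *)
Definition admissible q := C1 q /\ Hmhalf0 B (neumann_data q).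

(** T (I - (I/2 + K^* ) T)^-1 applied to the normal derivative of [q]. *)
Definition response q : functional := T_op sigma B (A_inv sigma B (neumann_data q)).

Lemma normal_derivative_square_integrable q : C1 q ->
  square_integrable arclength (frontier B) (normal_derivative B q).
Proof.
move=> C1q; have mF := frontier_measurable B.
have [M BM] := bounded_box bB.
have [K1 hK1] := continuous_bounded_on_box M (@C1_derive_continuous _ _ C1q (1, 0)).
have [K2 hK2] := continuous_bounded_on_box M (@C1_derive_continuous _ _ C1q (0, 1)).
apply: (@bounded_square_integrable _ _ _ _ _ mF _ (K1 + K2)) => //.
  exact: normal_derivative_measurable.
move=> x /(frontier_box BM) Mx.
apply: le_trans (normal_derivative_bound _ _ _) _.
apply: le_trans (enorm_le _) _.
by apply: lerD; [exact: hK1|exact: hK2].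
Qed.

Lemma neumann_data_lin (s t : R) f h : C1 f -> C1 h ->
  neumann_data (fun x => s * f x + t * h x) =
  flin s t (neumann_data f) (neumann_data h).
Proof.
move=> C1f C1h; rewrite /neumann_data.
rewrite -(of_fun_lin s t (normal_derivative_square_integrable C1f)
  (normal_derivative_square_integrable C1h)); congr (of_fun B).
by apply/funext => x; rewrite /normal_derivative grad_lin// /dot/=; ring.
Qed.

Lemma neumann_data_cst (c : R) : neumann_data (fun=> c) = (fun=> 0).
Proof.
apply/funext => f; rewrite /neumann_data /of_fun; case: asboolP => // _.
rewrite (_ : (fun x => normal_derivative B (fun=> c) x * f x) = fun=> 0).
  by rewrite /Rintegral integral0.
by apply/funext => x; rewrite /normal_derivative /grad !derive_cst /dot/= !mul0r addr0 mul0r.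
Qed.

Lemma admissible_cst (c : R) : admissible (fun=> c).
Proof. by split; [exact: C1_cst|rewrite neumann_data_cst; exact: Hmhalf0_zero]. Qed.

(** For [n = 0] the polynomial is constant and its normal derivative is 0. *)
Lemma admissible_harmonic q n : admissible (harm q n).
Proof.
split; first exact: harmonic_C1.
case: n => [|n].
  by have [hc hs] := @harmonic0 R; case: q; rewrite ?hc ?hs;
    [case: (admissible_cst 1)|case: (admissible_cst 0)].
by have [_ _ _ _ H] := wp; exact: H.
Qed.

Lemma response_lin (s t : R) f h : admissible f -> admissible h ->
  admissible (fun x => s * f x + t * h x) /\
  response (fun x => s * f x + t * h x) = flin s t (response f) (response h).
Proof.
move=> [C1f Hf] [C1h Hh]; have E := neumann_data_lin s t C1f C1h.
split.
  split; first exact: C1_lin.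
  by rewrite E; exact: Hmhalf0_lin.
have [HA1 _] := A_inv_spec wp Hf; have [HA2 _] := A_inv_spec wp Hh.
rewrite /response E (A_inv_lin oB bB lB msigma bsigma wp s t Hf Hh).
exact: (T_op_lin oB bB lB msigma bsigma wp s t HA1 HA2).
Qed.

Lemma response_Hmhalf0 q : Hmhalf0 B (response q).
Proof. exact: T_op_Hmhalf0. Qed.

Lemma response_sum p n (s t : nat -> R) :
  response (fun x => \sum_(l < n) (s l * harm Pc l x + t l * harm Ps l x)) p =
  \sum_(l < n) (s l * response (harm Pc l) p + t l * response (harm Ps l) p).
Proof.
have [] := @linear_on_sum R admissible (fun q => response q p) (admissible_cst 0) _ n s t
  (harm Pc) (harm Ps) (admissible_harmonic Pc) (admissible_harmonic Ps).
  move=> s' t' f h Af Ah; have [A E] := response_lin s' t' Af Ah.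
  by split => //; rewrite E.
by [].
Qed.

Lemma functional_sum g n (s t : nat -> R) : Hmhalf B g ->
  g (fun x => \sum_(k < n) (s k * harm Pc k x + t k * harm Ps k x)) =
  \sum_(k < n) (s k * g (harm Pc k) + t k * g (harm Ps k)).
Proof.
move=> [_ glin _].
have Hh p k : Hhalf B (harm p k) by apply: C1_Hhalf => //; exact: harmonic_C1.
have H0 : Hhalf B (fun=> 0) by apply: C1_Hhalf => //; exact: C1_cst.
have [] := @linear_on_sum R (Hhalf B) g H0 _ n s t (harm Pc) (harm Ps) (Hh Pc) (Hh Ps).
  move=> s' t' f h Hf Hh'.
  split; first exact: Hhalf_lin.
  have g0 : g (fun=> 0) = 0.
    have := glin 1 _ _ H0 H0; rewrite mul1r.
    rewrite (_ : (fun x : R * R => _) = (fun=> 0)); last by apply/funext => x; ring.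
    by lra.
  have Hth : Hhalf B (fun x => t' * h x).
    have := Hhalf_lin t' 0 lB Hh' Hh'; congr Hhalf.
    by apply/funext => x; ring.
  rewrite (glin s' f (fun x => t' * h x))//; congr (_ + _).
  have := glin t' h (fun=> 0) Hh' H0; rewrite g0 addr0 => <-.
  by congr g; apply/funext => x; rewrite addr0.
by [].
Qed.

Lemma cgptE p q k l : cgpt sigma B p q k l = response (harm q l) (harm p k).
Proof. by rewrite /cgpt asboolT. Qed.

Lemma cgpt_l0 p q k : cgpt sigma B p q k 0 = 0.
Proof.
rewrite cgptE; have [hc hs] := @harmonic0 R.
have r0 (c : R) : response (fun=> c) = (fun=> 0).
  have E : response (fun=> c) = response (fun=> 0).
    by rewrite /response !neumann_data_cst.
  rewrite E; have [_] := response_lin 0 0 (admissible_cst 0) (admissible_cst 0).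
  rewrite (_ : (fun x : R * R => _) = (fun=> 0)); last by apply/funext => x; ring.
  by move=> ->; apply/funext => f; rewrite /flin !mul0r addr0.
by case: q; rewrite ?hc ?hs r0.
Qed.

Lemma cgpt_0r p q l : cgpt sigma B p q 0 l = 0.
Proof.
rewrite cgptE; have [hc hs] := @harmonic0 R.
have [Hr r1] := response_Hmhalf0 (harm q l).
case: p; first by rewrite hc.
rewrite hs; have := functional_sum 0 (fun=> 0) (fun=> 0) Hr.
rewrite big_ord0 => r0; rewrite -[RHS]r0; congr (response _ _).
by apply/funext => x; rewrite big_ord0.
Qed.

End bilinear.

(** * Complex polarization tensors and triangular matrices *)

Section complex_cgpt.
Context {R : realType}.
Local Notation plT := (measurableTypeR R * measurableTypeR R)%type.
Variables (a z : R * R) (D : set (R * R)) (gamma : R * R -> R) (lam : R).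
Hypotheses (a0 : a != 0) (oD : open D).
Let B := sim a z @^-1` D.
Let sigma := gamma \o sim a z.
Hypotheses (B_domain : smooth_bounded_domain B) (lB : finite_length B).
Hypotheses (msigma : measurable_fun (B : set plT) sigma)
  (bsigma : {ae lebesgue2, forall x : plT, B x -> `|sigma x| <= lam})
  (wpD : well_posed gamma D) (wpB : well_posed sigma B).

Let w := cgpt sigma B.

(** The term of indices [k] and [l] of the bilinear form on the parts [p] and
    [q] of [c y^k] and [e y^l]. *)
Definition bicoef (p q : parity) (c e : R[i]) (k l : nat) : R :=
  ccoef p c * (ccoef q e * w Pc Pc k l + scoef q e * w Pc Ps k l) +
  scoef p c * (ccoef q e * w Ps Pc k l + scoef q e * w Ps Ps k l).

Lemma cgpt_transform p q m n : (0 < n)%N ->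
  cgpt gamma D p q m n = \sum_(k < m.+1) \sum_(l < n.+1)
    bicoef p q (sim_coef a z m k) (sim_coef a z n l) k l.
Proof.
move=> n0.
have [_ ->] := cgpt_sim a0 oD wpD wpB p m (@harmonic_C1 R q n) n0.
rewrite -/(neumann_data B _) -/(response _ _ _) (harmonic_sim q) (harmonic_sim p).
rewrite (functional_sum B_domain lB m.+1 (fun k => ccoef p (sim_coef a z m k))
  (fun k => scoef p (sim_coef a z m k)) (proj1 (response_Hmhalf0 B sigma _))).
apply: eq_bigr => k _.
rewrite !(response_sum B_domain lB msigma bsigma wpB _ n.+1
  (fun l => ccoef q (sim_coef a z n l)) (fun l => scoef q (sim_coef a z n l))).
rewrite !mulr_sumr -big_split/=; apply: eq_bigr => l _.
by rewrite /bicoef /w !(cgptE wpB).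
Qed.

Lemma complex_sum (F G : nat -> nat -> R) m n :
  ((\sum_(k < m) \sum_(l < n) F k l) +i* (\sum_(k < m) \sum_(l < n) G k l))%C =
  \sum_(k < m) \sum_(l < n) (F k l +i* G k l)%C.
Proof.
apply/eqP; rewrite eq_complex/=; apply/andP; split; apply/eqP.
  rewrite (Re_sum m (fun k => \sum_(l < n) (F k l +i* G k l)%C)).
  by apply: eq_bigr => k _; rewrite (Re_sum n (fun l => (F k l +i* G k l)%C)).
rewrite (Im_sum m (fun k => \sum_(l < n) (F k l +i* G k l)%C)).
by apply: eq_bigr => k _; rewrite (Im_sum n (fun l => (F k l +i* G k l)%C)).
Qed.

Lemma sum2D (F G : nat -> nat -> R) (s : R) m n :
  (\sum_(k < m) \sum_(l < n) F k l) + s * (\sum_(k < m) \sum_(l < n) G k l) =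
  \sum_(k < m) \sum_(l < n) (F k l + s * G k l).
Proof.
rewrite mulr_sumr -big_split/=; apply: eq_bigr => k _.
by rewrite mulr_sumr -big_split.
Qed.

(** The powers of exponent 0 are constant functions, which the form kills on
    both sides. *)
Lemma drop0_sum (F : nat -> nat -> R[i]) m n :
  (forall l, F 0%N l = 0) -> (forall k, F k 0%N = 0) ->
  \sum_(k < m.+1) \sum_(l < n.+1) F k l =
  \sum_(1 <= k < m.+1) \sum_(1 <= l < n.+1) F k l.
Proof.
move=> F0l Fk0; rewrite -(big_mkord xpredT (fun k => \sum_(l < n.+1) F k l)).
rewrite big_ltn// [X in X + _]big1 ?add0r//.
apply: eq_bigr => k _; rewrite -(big_mkord xpredT (fun l => F k l)).
by rewrite big_ltn// Fk0 add0r.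
Qed.

Let w0l p q l : w p q 0 l = 0.
Proof. exact: cgpt_0r. Qed.

Let wk0 p q k : w p q k 0 = 0.
Proof. exact: (cgpt_l0 B_domain lB msigma bsigma wpB). Qed.

Lemma N1_transform m n : (0 < n)%N ->
  N1 gamma D m n = \sum_(1 <= k < m.+1) \sum_(1 <= l < n.+1)
    sim_coef a z m k * N1 sigma B k l * sim_coef a z n l.
Proof.
move=> n0; rewrite -drop0_sum; last 2 first.
- by move=> l; rewrite /N1 -/w !w0l subrr addr0 mulr0 mul0r.
- by move=> k; rewrite /N1 -/w !wk0 subrr addr0 mulr0 mul0r.
pose F p q k l := bicoef p q (sim_coef a z m k) (sim_coef a z n l) k l.
transitivity ((\sum_(k < m.+1) \sum_(l < n.+1) (F Pc Pc k l + -1 * F Ps Ps k l)) +i*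
  (\sum_(k < m.+1) \sum_(l < n.+1) (F Pc Ps k l + 1 * F Ps Pc k l)))%C.
  rewrite -(sum2D (F Pc Pc) (F Ps Ps)) -(sum2D (F Pc Ps) (F Ps Pc)).
  by rewrite /N1 !cgpt_transform// mulN1r mul1r.
rewrite (complex_sum (fun k l => F Pc Pc k l + -1 * F Ps Ps k l)
  (fun k l => F Pc Ps k l + 1 * F Ps Pc k l)).
apply: eq_bigr => k _; apply: eq_bigr => l _; rewrite /F /N1 -/w /bicoef /=.
move: (w Pc Pc k l) (w Pc Ps k l) (w Ps Pc k l) (w Ps Ps k l) => wcc wcs wsc wss.
case: (sim_coef a z m k) (sim_coef a z n l) => [c1 c2] [e1 e2] /=.
by apply/eqP; rewrite eq_complex/=; apply/andP; split; apply/eqP; ring.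
Qed.

Lemma N2_transform m n : (0 < n)%N ->
  N2 gamma D m n = \sum_(1 <= k < m.+1) \sum_(1 <= l < n.+1)
    (sim_coef a z m k)^*%C * N2 sigma B k l * sim_coef a z n l.
Proof.
move=> n0; rewrite -drop0_sum; last 2 first.
- by move=> l; rewrite /N2 -/w !w0l subrr addr0 mulr0 mul0r.
- by move=> k; rewrite /N2 -/w !wk0 subrr addr0 mulr0 mul0r.
pose F p q k l := bicoef p q (sim_coef a z m k) (sim_coef a z n l) k l.
transitivity ((\sum_(k < m.+1) \sum_(l < n.+1) (F Pc Pc k l + 1 * F Ps Ps k l)) +i*
  (\sum_(k < m.+1) \sum_(l < n.+1) (F Pc Ps k l + -1 * F Ps Pc k l)))%C.
  rewrite -(sum2D (F Pc Pc) (F Ps Ps)) -(sum2D (F Pc Ps) (F Ps Pc)).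
  by rewrite /N2 !cgpt_transform// mulN1r mul1r.
rewrite (complex_sum (fun k l => F Pc Pc k l + 1 * F Ps Ps k l)
  (fun k l => F Pc Ps k l + -1 * F Ps Pc k l)).
apply: eq_bigr => k _; apply: eq_bigr => l _; rewrite /F /N2 -/w /bicoef /=.
move: (w Pc Pc k l) (w Pc Ps k l) (w Ps Pc k l) (w Ps Ps k l) => wcc wcs wsc wss.
case: (sim_coef a z m k) (sim_coef a z n l) => [c1 c2] [e1 e2] /=.
by apply/eqP; rewrite eq_complex/=; apply/andP; split; apply/eqP; ring.
Qed.

End complex_cgpt.

Section lower_triangular.
Context {R : realType}.
Implicit Types (u w z al : R[i]).

Lemma Cmx_gt u m k : (m < k)%N -> Cmx u m k = 0.
Proof. by rewrite ltnNge /Cmx => /negbTE ->. Qed.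

(** The matrix C^u is that of the substitution of 'X + u for 'X in polynomials,
    so that composition of substitutions gives [Cmx_comp]. *)
Lemma coef_exprXaddC u m k : (('X + u%:P) ^+ m)`_k = Cmx u m k.
Proof.
rewrite addrC exprDn coef_sum.
have [km|mk] := leqP k m; last first.
  rewrite Cmx_gt// big1// => i _; rewrite coefMn -rmorphXn coefCM coefXn.
  by rewrite gtn_eqF ?mulr0 ?mul0rn// (leq_ltn_trans _ mk)// -ltnS.
rewrite (bigD1 (Ordinal (km : (k < m.+1)%N)))//= big1 ?addr0.
  by rewrite coefMn -rmorphXn coefCM coefXn eqxx mulr1 /Cmx km mulr_natl.
move=> i /eqP ik; rewrite coefMn -rmorphXn coefCM coefXn.
case: eqP => [ki|_]; last by rewrite mulr0 mul0rn.
by exfalso; apply: ik; apply/val_inj.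
Qed.

Lemma Cmx_comp u w m j : (0 < j)%N ->
  \sum_(1 <= k < m.+1) Cmx u m k * Cmx w k j = Cmx (u + w) m j.
Proof.
move=> j0; rewrite -coef_exprXaddC.
have -> : 'X + (u + w)%:P = u%:P + ('X + w%:P) :> {poly R[i]}.
  by rewrite polyCD addrCA.
rewrite exprDn coef_sum -(big_mkord xpredT
  (fun k => ((u%:P ^+ (m - k) * ('X + w%:P) ^+ k) *+ 'C(m, k))`_j)).
rewrite [RHS]big_ltn// expr0 mulr1 subn0 bin0 -rmorphXn coefC gtn_eqF// add0r.
rewrite !big_nat; apply: eq_bigr => k /andP[_ km].
rewrite coefMn -rmorphXn coefCM coef_exprXaddC /Cmx -[X in (_ <= X)%N]/m -ltnS km.
by rewrite -[RHS]mulr_natl mulrA.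
Qed.

Lemma Cmx_scale al u m j : Cmx (al * u) m j * al ^+ j = al ^+ m * Cmx u m j.
Proof.
rewrite /Cmx; case: leqP => jm; last by rewrite mul0r mulr0.
have -> : al ^+ m = al ^+ (m - j) * al ^+ j by rewrite -exprD subnK.
by rewrite exprMn; ring.
Qed.

(** Stated with independent parameters on the left and on the right, because
    the left matrix is conjugated in J2 and not in J1. The inner sums are
    extended to a fixed range, where the entries of a triangular matrix are 0,
    and then the outer sums are carried out first. *)
Lemma triangular_transform (N : nat -> nat -> R[i]) u1 u2 z1 z2 al1 al2 w1 w2 m n :
  w1 + z1 = al1 * u1 -> w2 + z2 = al2 * u2 ->
  \sum_(1 <= k < m.+1) \sum_(1 <= l < n.+1)
    Cmx w1 m k * (\sum_(1 <= i < k.+1) \sum_(1 <= j < l.+1)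
      (Cmx z1 k i * al1 ^+ i) * N i j * (Cmx z2 l j * al2 ^+ j)) * Cmx w2 n l =
  al1 ^+ m * al2 ^+ n *
  \sum_(1 <= i < m.+1) \sum_(1 <= j < n.+1) Cmx u1 m i * N i j * Cmx u2 n j.
Proof.
move=> E1 E2.
have extend (F : nat -> R[i]) p q : (p <= q)%N -> (forall i, (p < i)%N -> F i = 0) ->
    \sum_(1 <= i < p.+1) F i = \sum_(1 <= i < q.+1) F i.
  move=> pq F0; rewrite [RHS](big_cat_nat (n := p.+1))//=.
  have -> : \sum_(p.+1 <= i < q.+1) F i = 0.
    by rewrite big_nat big1// => i /andP[pi _]; exact: F0.
  by rewrite addr0.
transitivity (\sum_(1 <= k < m.+1) \sum_(1 <= l < n.+1)
    \sum_(1 <= i < m.+1) \sum_(1 <= j < n.+1)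
      (Cmx w1 m k * Cmx z1 k i * al1 ^+ i) * N i j *
      (Cmx w2 n l * Cmx z2 l j * al2 ^+ j)).
  apply: eq_big_nat => k /andP[_ km].
  apply: eq_big_nat => l /andP[_ ln].
  rewrite (extend _ k m km); last first.
    by move=> i ki; rewrite big1// => j _; rewrite Cmx_gt// !mul0r.
  rewrite mulr_sumr mulr_suml; apply: eq_bigr => i _.
  rewrite (extend _ l n ln); last by move=> j lj; rewrite (Cmx_gt z2 lj) mul0r mulr0.
  rewrite mulr_sumr mulr_suml; apply: eq_bigr => j _; ring.
transitivity (\sum_(1 <= i < m.+1) \sum_(1 <= j < n.+1)
    \sum_(1 <= k < m.+1) \sum_(1 <= l < n.+1)
      (Cmx w1 m k * Cmx z1 k i * al1 ^+ i) * N i j *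
      (Cmx w2 n l * Cmx z2 l j * al2 ^+ j)).
  under eq_bigr do rewrite exchange_big/=.
  rewrite exchange_big/=; apply: eq_bigr => i _.
  under eq_bigr do rewrite exchange_big/=.
  by rewrite exchange_big.
rewrite mulr_sumr; apply: eq_big_nat => i /andP[i0 _].
rewrite mulr_sumr; apply: eq_big_nat => j /andP[j0 _].
transitivity ((\sum_(1 <= k < m.+1) Cmx w1 m k * Cmx z1 k i) * al1 ^+ i * N i j *
  ((\sum_(1 <= l < n.+1) Cmx w2 n l * Cmx z2 l j) * al2 ^+ j)).
  rewrite !mulr_suml; apply: eq_bigr => k _.
  by rewrite mulr_sumr; apply: eq_bigr => l _; ring.
rewrite !Cmx_comp// E1 E2 !Cmx_scale; ring.
Qed.

Lemma conj_Cmx u m k : (Cmx u m k)^*%C = Cmx (u^*%C) m k.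
Proof.
rewrite /Cmx; case: leqP => _; last by rewrite conjc0.
by rewrite rmorphM rmorphXn rmorph_nat.
Qed.

End lower_triangular.

(** * Invariance of the descriptors *)

Section descriptors.
Context {R : realType}.
Local Notation plT := (measurableTypeR R * measurableTypeR R)%type.
Variables (a z : R * R) (D : set (R * R)) (gamma : R * R -> R) (lam : R).
Hypotheses (a0 : a != 0) (oD : open D).
Let B := sim a z @^-1` D.
Let sigma := gamma \o sim a z.
Hypotheses (B_domain : smooth_bounded_domain B) (lB : finite_length B).
Hypotheses (msigma : measurable_fun (B : set plT) sigma)
  (bsigma : {ae lebesgue2, forall x : plT, B x -> `|sigma x| <= lam})
  (wpD : well_posed gamma D) (wpB : well_posed sigma B).
Hypothesis N0 : N2 sigma B 1 1 != 0.

Let al := cplx a.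
Let zc := cplx z.

Let al0 : al != 0.
Proof.
apply: contra a0; rewrite /al /cplx eq_complex/= => /andP[/eqP a1 /eqP a2].
by rewrite [a]surjective_pairing a1 a2.
Qed.

Let alc0 : al^*%C != 0.
Proof. by rewrite conjc_eq0. Qed.

Let N1T := N1_transform a0 oD B_domain lB msigma bsigma wpD wpB.
Let N2T := N2_transform a0 oD B_domain lB msigma bsigma wpD wpB.

(** With n_kl the entries of N2 of the preimage: N2_11 is multiplied by |a|^2,
    and N2_12 becomes conj(a) (2 a z n_11 + a^2 n_12). *)
Lemma u_shift_transform : u_shift gamma D = zc + al * u_shift sigma B.
Proof.
rewrite /u_shift !N2T//.
have C11 : sim_coef a z 1 1 = al.
  by rewrite /sim_coef /Cmx/= expr0 mulr1 expr1 mul1r.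
have C21 : sim_coef a z 2 1 = 2 * zc * al.
  by rewrite /sim_coef /Cmx/= !expr1.
have C22 : sim_coef a z 2 2 = al ^+ 2.
  by rewrite /sim_coef /Cmx/= expr0 mulr1 mul1r.
rewrite !big_nat1 big_ltn// big_nat1 C11 C21 C22.
move: (al^*%C) alc0 (N2 sigma B 1 1) N0 (N2 sigma B 1 2) => ac ac0 n11 n0 n12.
by field; rewrite ac0 n0 al0.
Qed.

Lemma J1_transform m n : J1 gamma D m n = al ^+ m * al ^+ n * J1 sigma B m n.
Proof.
rewrite /J1 u_shift_transform.
have E : - (zc + al * u_shift sigma B) + zc = al * - u_shift sigma B by ring.
rewrite -(triangular_transform (N1 sigma B) m n E E).
apply: eq_big_nat => k _; apply: eq_big_nat => l /andP[l0 _].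
by rewrite N1T.
Qed.

Lemma J2_transform m n : J2 gamma D m n = al^*%C ^+ m * al ^+ n * J2 sigma B m n.
Proof.
rewrite /J2 u_shift_transform.
have E : - (zc + al * u_shift sigma B) + zc = al * - u_shift sigma B by ring.
have Ec : (- (zc + al * u_shift sigma B))^*%C + zc^*%C =
    al^*%C * (- u_shift sigma B)^*%C.
  by rewrite -rmorphD -rmorphM E.
transitivity (\sum_(1 <= k < m.+1) \sum_(1 <= l < n.+1)
    Cmx (- (zc + al * u_shift sigma B))^*%C m k *
    (\sum_(1 <= i < k.+1) \sum_(1 <= j < l.+1)
      (Cmx (zc^*)%C k i * al^*%C ^+ i) * N2 sigma B i j * (Cmx zc l j * al ^+ j)) *
    Cmx (- (zc + al * u_shift sigma B)) n l).
  apply: eq_big_nat => k _; apply: eq_big_nat => l /andP[l0 _].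
  rewrite N2T// conj_Cmx; congr (_ * _ * _).
  apply: eq_bigr => i _; apply: eq_bigr => j _.
  by rewrite /sim_coef rmorphM rmorphXn/= conj_Cmx.
rewrite (triangular_transform (N2 sigma B) m n Ec E); congr (_ * _).
by apply: eq_bigr => k _; apply: eq_bigr => l _; rewrite conj_Cmx.
Qed.

Lemma norm_sqrtC_scale (x y c : R[i]) : `|x| = `|c| ^+ 2 * `|y| ->
  `|sqrtC x| = `|c| * `|sqrtC y|.
Proof.
move=> E; apply/eqP; rewrite -(@eqrXn2 _ 2) ?mulr_ge0//.
by rewrite exprMn -!normrX !sqrtCK E normrX.
Qed.

(** Numerator and denominator are multiplied by numbers of the same modulus. *)
Lemma norm_ratio (c1 c2 x d1 d2 : R[i]) : c2 != 0 -> `|c1| = `|c2| ->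
  `|d1| = `|c2| * `|d2| -> `|c1 * x / d1| = `|x / d2|.
Proof.
move=> c20 c12 dE; rewrite !normrM !normfV dE c12 invfM mulrACA mulfV ?mul1r//.
by rewrite normr_eq0.
Qed.

Let alm0 m n : al ^+ m * al ^+ n != 0.
Proof. by rewrite mulf_neq0// expf_neq0. Qed.

Let norm_alc m n : `|al^*%C ^+ m * al ^+ n| = `|al ^+ m * al ^+ n|.
Proof. by rewrite !normrM !normrX normcJ. Qed.

Let norm_denominator m n : `|sqrtC (J2 gamma D m m * J2 gamma D n n)| =
  `|al ^+ m * al ^+ n| * `|sqrtC (J2 sigma B m m * J2 sigma B n n)|.
Proof.
apply: norm_sqrtC_scale; rewrite (J2_transform m m) (J2_transform n n).
move: (J2 sigma B m m) (J2 sigma B n n) => x y.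
by rewrite mulrACA normrM (normrM (_ * _)) !norm_alc !normrM expr2; ring.
Qed.

Lemma I1_transform m n : I1 gamma D m n = I1 sigma B m n.
Proof.
rewrite /I1 /S1 (J1_transform m n).
exact: (norm_ratio _ (alm0 m n) erefl (norm_denominator m n)).
Qed.

Lemma I2_transform m n : I2 gamma D m n = I2 sigma B m n.
Proof.
rewrite /I2 /S2 (J2_transform m n).
exact: (norm_ratio _ (alm0 m n) (norm_alc m n) (norm_denominator m n)).
Qed.

End descriptors.

Section similarity_of_data.
Context {R : realType}.
Implicit Types (B D : set (R * R)) (sigma : R * R -> R) (z : R * R).

(** Rotation by theta, scaling by r and translation by z compose to [x |-> a x
    + z] with [a = r e^(i theta)]. *)
Lemma transform_setE B z (r theta : R) : r != 0 ->
  let a := (r * cos theta, r * sin theta) in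
  a != 0 /\ translate_set z (scale_set r (rotate_set theta B)) = simV a z @^-1` B.
Proof.
move=> r0 a; have a0 : a != 0.
  apply: contra r0; rewrite /a xpair_eqE/= !mulf_eq0 => /andP[/orP[//|/eqP c0] /orP[//|/eqP s0]].
  by have := cos2Dsin2 theta; rewrite c0 s0 expr0n addr0 => /eqP; rewrite eq_sym oner_eq0.
split=> //.
have simE x : sim a z x = r *: Defs.rot theta x + z.
  by rewrite /sim /rmul /Defs.rot /a; congr pair; rewrite /= /GRing.scale/=; ring.
apply/seteqP; split => [_ [_ [_ [x Bx <-] <-] <-]|x /= Bx].
  by rewrite /= -simE simK.
exists (r *: Defs.rot theta (simV a z x)); last by rewrite -simE simVK.
by exists (Defs.rot theta (simV a z x)) => //; exists (simV a z x).
Qed.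

Lemma transform_funE sigma z (r theta : R) : r != 0 ->
  translate_fun z (scale_fun r (rotate_fun theta sigma)) \o
    sim (r * cos theta, r * sin theta) z = sigma.
Proof.
move=> r0; apply/funext => -[x1 x2].
rewrite /= /translate_fun /scale_fun /rotate_fun /Defs.rot; congr (sigma _).
have cs := cos2Dsin2 theta; rewrite !expr2 in cs.
rewrite cosN sinN /sim /rmul; congr pair; rewrite /= /GRing.scale/=.
  transitivity (x1 * (cos theta * cos theta + sin theta * sin theta)); last by rewrite cs mulr1.
  by field.
transitivity (x2 * (cos theta * cos theta + sin theta * sin theta)); last by rewrite cs mulr1.
by field.
Qed.

(** The tensors have the value 0 where the problem is not well posed. *)
Lemma N2_neq0_well_posed gamma D m n : N2 gamma D m n != 0 -> well_posed gamma D.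
Proof.
apply: contraNP => nwp; apply/eqP; rewrite /N2 /cgpt asboolF//.
by rewrite addr0 subrr.
Qed.

Lemma N2_neq0_finite_length sigma B m n : bounded_set B -> well_posed sigma B ->
  N2 sigma B m n != 0 -> finite_length B.
Proof.
move=> bB wp; apply: contraNP => lB.
have c0 p q : cgpt sigma B p q m n = 0.
  apply: contrapT => /eqP; rewrite (cgptE wp) => c0; apply: lB.
  by apply: finite_length_of_functional bB _ c0; have [] := response_Hmhalf0 B sigma (Defs.harmonic q n).
by apply/eqP; rewrite /N2 !c0 addr0 subrr.
Qed.

End similarity_of_data.

Theorem mainTheorem5 (R : realType) (B : set (R * R)) (sigma : R * R -> R)
    (lambda : R)
    (B_domain : smooth_bounded_domain B)
    (sigma_measurable :
      measurable_fun setT (sigma : measurableTypeR R * measurableTypeR R -> R))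
    (sigma_outside : {ae lebesgue2, forall x : R * R, ~ B x -> sigma x = 1})
    (lambda_gt0 : 0 < lambda)
    (sigma_bounds :
      {ae lebesgue2, forall x : R * R, lambda^-1 <= sigma x <= lambda})
    (z : R * R) (r theta : R)
    (r_gt0 : 0 < r) (theta_bounds : 0 <= theta < 2 * pi)
    (D : set (R * R)) (gamma : R * R -> R)
    (D_def : D = translate_set z (scale_set r (rotate_set theta B)))
    (gamma_def :
      gamma = translate_fun z (scale_fun r (rotate_fun theta sigma))) :
  forall m n : nat, (1 <= m)%N -> (1 <= n)%N ->
    nonzero_denominators sigma B m n -> nonzero_denominators gamma D m n ->
    I1 gamma D m n = I1 sigma B m n /\ I2 gamma D m n = I2 sigma B m n.
Proof.
move=> m n _ _ [NB _ _] [ND _ _].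
have r0 : r != 0 by rewrite gt_eqF.
pose a := (r * cos theta, r * sin theta).
have [a0 DE] := transform_setE B z theta r0.
have sigmaE : sigma = gamma \o sim a z by rewrite gamma_def (transform_funE sigma z theta r0).
have BE : B = sim a z @^-1` D.
  rewrite D_def DE; apply/seteqP; split => x /=; rewrite ?simK//.
have [_ oB _ bB _] := B_domain.
have oD : open D.
  by rewrite D_def DE; apply: open_comp => // x _; exact: sim_continuous.
have wpB := N2_neq0_well_posed NB; have wpD := N2_neq0_well_posed ND.
have lB := N2_neq0_finite_length bB wpB NB.
have msigma : measurable_fun (B : set (measurableTypeR R * measurableTypeR R)) sigma.
  exact: measurable_funTS.
have bsigma : {ae lebesgue2, forall x : measurableTypeR R * measurableTypeR R,
    B x -> `|sigma x| <= lambda}.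
  apply: ae_mono sigma_bounds => x /andP[s1 s2] _.
  by rewrite ger0_norm// (le_trans _ s1)// invr_ge0 ltW.
rewrite sigmaE BE in B_domain NB lB msigma bsigma wpB *.
split.
  exact: (I1_transform a0 oD B_domain lB msigma bsigma wpD wpB NB).
exact: (I2_transform a0 oD B_domain lB msigma bsigma wpD wpB NB).
Qed.
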